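(* Let $1<Q<+\infty$. Suppose that $(X,d,\mu)$ is a complete, unbounded metric measure space with metric $d$ and Ahlfors $Q$-regular measure $\mu$ supporting a $Q$-Poincaré inequality. Then for every function $u\in\dot N^{1,Q}(X)$ there exists a $Q$-thin set $E$ such that $$\lim_{E\not\ni x\to+\infty}\left|\frac{u(x)}{\log^{\frac{Q-1}{Q}}(|x|)}\right|=0 .$$ Moreover, $$\lim_{x\to+\infty}\left|\frac{u_{B(x,1)}}{\log^{\frac{Q-1}{Q}}(|x|)}\right|=0\quad\text{for every function }u\in\dot N^{1,Q}(X),$$ where $u_{B(x,1)}:=\frac1{\mu(B(x,1))}\int_{B(x,1)}u\,d\mu$.
   Context: A metric measure space $(X,d,\mu)$ is a separable metric space $(X,d)$ with a nontrivial locally finite Borel-regular measure $\mu$. $B(x,r)$ is the ball of center $x$ and radius $r$. $\mu$ is Ahlfors $Q$-regular if there is a constant $C_Q\ge1$ with $r^Q/C_Q\le\mu(B(x,r))\le C_Qr^Q$ for all $x\in X$, $r>0$. Upper gradient: a Borel function $\rho:X\to[0,+\infty]$ is an upper gradient of a locally integrable function $u$ if $|u(x)-u(y)|\le\int_\gamma\rho\,ds$ for every rectifiable curve $\gamma$ connecting $x$ and $y$ (for all $x,y\in X$). $\dot N^{1,Q}(X)$ is the collection of all locally integrable functions on $X$ (defined pointwise everywhere) that have a $Q$-integrable upper gradient on $X$. $Q$-Poincaré inequality: every ball has finite positive measure and there are finite constants $C>0$, $\lambda\ge1$ such that $\frac1{\mu(B(x,r))}\int_{B(x,r)}|u-u_{B(x,r)}|\,d\mu\le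 Cr\left(\frac1{\mu(B(x,\lambda r))}\int_{B(x,\lambda r)}\rho^Q\,d\mu\right)^{1/Q}$ for all balls $B(x,r)$ and all pairs $(u,\rho)$ with $u$ integrable on balls and $\rho$ an upper gradient of $u$. A base point $O\in X$ is fixed, $|x|:=d(O,x)$, and $x\to+\infty$ means $|x|\to+\infty$; $\lim_{E\not\ni x\to+\infty}$ is the limit along $x\in X\setminus E$. $\log^{s}(t)$ means $(\log t)^s$. Hausdorff content: for $\beta\ge0$, $\mathcal H^\beta_{+\infty}(E)=\inf\{\sum_kr_k^\beta: E\subset\bigcup_kB_k,\ B_k \text{ a ball of radius } r_k\in(0,+\infty)\}$ (countable covers). $Q$-thin set: $E\subset X$ such that there is a finite constant $C\ge1$ with $\lim_{k\to+\infty}\sum_{j=k}^{+\infty}\frac{\mathcal H^{\alpha}_{+\infty}(E\cap A_{C2^{j+1}})}{(C2^{j+1})^\alpha}=0$ for all $0<\alpha<Q$, where $A_{C2^{j+1}}:=B(O,C2^{j+2})\setminus B(O,C2^{j+1})$. *)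

(* Defs.v *)
From HB Require Import structures.
From mathcomp Require Import all_boot all_order all_algebra.
From mathcomp Require Import all_classical all_reals all_analysis.
From mathcomp Require Import measurable_realfun.

Set Implicit Arguments.
Unset Strict Implicit.
Unset Printing Implicit Defensive.

Import Order.TTheory GRing.Theory Num.Theory.
Import numFieldNormedType.Exports.

Local Open Scope classical_set_scope.
Local Open Scope ring_scope.

(* Measurable types are pointed in MathComp-Analysis, so we work with pointed
   metric spaces. The canonical [point] only witnesses non-emptiness: the base
   point with respect to which |x| is measured is always the explicit
   argument [O] below. *)
#[short(type="pmetricType")]
HB.structure Definition PMetric (K : numDomainType) :=
  {M of Metric K M & isPointed M}.

Section MetricNotions.
Context {R : realType} {X : pmetricType R}.

Definition separable_space := exists2 D : set X, countable D & dense D.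

Definition complete_space :=
  forall x : nat -> X, cauchy (x @ \oo) -> exists l : X, x @ \oo --> l.

Definition unbounded_space := forall M : R, exists x y : X, M < mdist x y.

Definition borel : set (set X) := <<s @open X >>.

Definition borel_fun (f : X -> \bar R) :=
  measurable_fun [set: g_sigma_algebraType (@open X)] f.

(* the filter of "x --> +oo", i.e. mdist O x --> +oo *)
Definition at_infinity (O : X) : set_system X :=
  [set P | exists M : R, forall x, M < mdist O x -> P x].

Global Instance at_infinity_filter (O : X) : Filter (at_infinity O).
Proof.
split=> [|P S [M PM] [N SN]|P S PS [M PM]].
- by exists 0.
- exists (Num.max M N) => x; rewrite gt_max => /andP[Mx Nx].
  by split; [exact: PM|exact: SN].
- by exists M => x /PM /PS.
Qed.

End MetricNotions.
Arguments separable_space {R} X.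
Arguments complete_space {R} X.
Arguments unbounded_space {R} X.

Section Curves.
Context {R : realType} {X : pmetricType R}.
Implicit Types (c : R -> X) (a b s t : R).

(* metric analogue of [variation]: a partition a < s_0 < ... < s_(n-1) = b is
   given by the list of its points other than a *)
Definition polygonal_length a c (p : seq R) : R :=
  \sum_(i < size p) mdist (c (nth a (a :: p) i)) (c (nth a p i)).

Definition curve_length c a b : \bar R :=
  ereal_sup [set (polygonal_length a c p)%:E | p in itv_partition a b].

Definition rectifiable_curve c a b :=
  [/\ a <= b, {within `[a, b], continuous c} & (curve_length c a b < +oo)%E].

(* Arc-length reparametrization of c : [a, b] -> X, for 0 <= s <= length of c.
   For a rectifiable curve, t |-> curve_length c a t maps [a, b] onto
   [0, length of c] and c is constant on each of its fibres, so the choice of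
   the least element of the fibre is immaterial. *)
Definition arc_length_param c a b s : X :=
  c (inf [set t | a <= t <= b /\ curve_length c a t = s%:E]).

Definition line_integral (rho : X -> \bar R) c a b : \bar R :=
  (\int[lebesgue_measure]_(s in `[0%R, fine (curve_length c a b)])
     rho (arc_length_param c a b s))%E.

Definition upper_gradient (u : X -> R) (rho : X -> \bar R) :=
  [/\ borel_fun rho, forall x, (0 <= rho x)%E &
      forall c a b, rectifiable_curve c a b ->
        (`|u (c a) - u (c b)|%:E <= line_integral rho c a b)%E].

End Curves.

Section MetricMeasureSpace.
Context {R : realType} {X : pmetricType R}.
(* As usual for Borel-regular measures, mu is an outer measure, defined on all
   subsets; measurability and integration are relative to the sigma-algebra of
   its Caratheodory-measurable sets. *)
Variable mu : {outer_measure set X -> \bar R}.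
Local Open Scope ereal_scope.

Definition mu_integral (A : set X) (f : X -> \bar R) : \bar R :=
  \int[(mu : set (caratheodory_type mu) -> \bar R)]_(x in A) f x.

Definition mu_integrable (A : set X) (u : X -> R) :=
  (mu : set (caratheodory_type mu) -> \bar R).-integrable A (EFin \o u).

Definition locally_finite := forall x : X, exists2 r : R,
  (0 < r)%R & mu (ball x r) < +oo.

Definition borel_regular :=
  (borel `<=` mu.-caratheodory) /\
  forall A, exists B, [/\ borel B, A `<=` B & mu A = mu B].

Definition metric_measure_space :=
  [/\ separable_space X, 0 < mu setT, locally_finite & borel_regular].

Definition ahlfors_regular (Q : R) := exists2 C : R, (1 <= C)%R &
  forall (x : X) (r : R), (0 < r)%R ->
    (r `^ Q / C)%:E <= mu (ball x r) <= (C * r `^ Q)%:E.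

Definition loc_integrable (u : X -> R) := forall x : X, exists2 r : R,
  (0 < r)%R & mu_integrable (ball x r) u.

(* u_{B(x,r)} *)
Definition ball_mean (u : X -> R) (x : X) (r : R) : R :=
  ((fine (mu (ball x r)))^-1
     * fine (mu_integral (ball x r) (EFin \o u)))%R.

Definition poincare_inequality (Q : R) :=
  (forall (x : X) (r : R), (0 < r)%R -> 0 < mu (ball x r) < +oo) /\
  exists C lambda : R, [/\ (0 < C)%R, (1 <= lambda)%R &
    forall (u : X -> R) (rho : X -> \bar R),
      (forall (x : X) (r : R), (0 < r)%R -> mu_integrable (ball x r) u) ->
      upper_gradient u rho ->
      forall (x : X) (r : R), (0 < r)%R ->
        (mu (ball x r))^-1
          * mu_integral (ball x r) (fun y => `|u y - ball_mean u x r|%:E)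
        <= (C * r)%:E
           * ((mu (ball x (lambda * r)))^-1
                * mu_integral (ball x (lambda * r)) (fun y => rho y `^ Q))
             `^ (Q^-1)].

Definition dotN1 (Q : R) (u : X -> R) :=
  loc_integrable u /\
  exists2 rho : X -> \bar R, upper_gradient u rho &
    mu_integral setT (fun x => rho x `^ Q) < +oo.

End MetricMeasureSpace.

Section ThinSets.
Context {R : realType} {X : pmetricType R}.
Local Open Scope ereal_scope.

(* The covers are indexed by an arbitrary set K of naturals, so that finite
   (and empty) covers are allowed. *)
Definition hausdorff_content (beta : R) (E : set X) : \bar R :=
  ereal_inf [set h | exists (K : set nat) (x : nat -> X) (r : nat -> R),
    [/\ forall k, K k -> (0 < r k)%R,
        E `<=` \bigcup_(k in K) ball (x k) (r k) &
        h = \esum_(k in K) (r k `^ beta)%:E]].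

(* A_s = B(O, 2s) \ B(O, s) *)
Definition annulus (O : X) (s : R) : set X := ball O (2 * s)%R `\` ball O s.

Definition thin_set (O : X) (Q : R) (E : set X) :=
  exists2 C : R, (1 <= C)%R &
    forall alpha : R, (0 < alpha < Q)%R ->
      (\sum_(k <= j <oo)
         hausdorff_content alpha (E `&` annulus O (C * 2 ^+ j.+1)%R)
           / ((C * 2 ^+ j.+1) `^ alpha)%:E) @[k --> \oo] --> 0.

End ThinSets.

(* Main.v *)
(** Write p = (Q-1)/Q, and let rho be a Q-integrable upper gradient of u.

    Averages.  If u >= t on half of a ball and u <= s on half of a comparable
    ball nearby, the Poincare inequality for the truncation of u bounds
    (t-s)^Q by a constant times the integral of rho^Q over {s < u < t}.  About
    log|x| comparable balls lead from B(x,1) to a fixed ball; along this chain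
    the strips {s < |u| < t} between consecutive medians may be taken disjoint
    and above a given level T, so by Hoelder's inequality the median of |u|
    on B(x,1) is at most T + C (log|x|)^p (int_{|u|>T} rho^Q)^(1/Q) + C'.  As T
    is arbitrary, the average of |u| over B(x,1) is o((log|x|)^p).

    Points.  Enlarge rho to a lower semicontinuous rho' with rho'^Q = 1 + G
    and G integrable, and let E be the set of the x such that the integral of
    G over B(x, lambda 2^-k) exceeds q^(kQ) for some k, where q = q(|x|) < 1
    and 1/(1-q) = 2 + (log|x|)^(p/2).  Since q(|x|) tends to 1, covering by
    balls centred at maximal separated sets shows that E is thin.  For x not
    in E, let V(y) be the least cost, with respect to a Lipschitz function
    below rho', of a chain of small mesh from x to y.  This function is an
    upper gradient of V, and V(x) = 0, so the Poincare inequality on the balls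
    B(x, 2^-k) bounds the average of V over B(x,1) by C/(1-q).  Chains of cost
    less than L converge, as the mesh tends to 0 and the Lipschitz functions
    increase to rho', to a curve along which rho' integrates to at most 2L.
    Hence |u(x)| is at most the average of |u| over B(x,1) plus
    C (2 + (log|x|)^(p/2)), which is o((log|x|)^p). *)

From HB Require Import structures.
Require Import Defs.
From mathcomp Require Import all_boot all_order all_algebra.
From mathcomp Require Import all_classical all_reals all_analysis.
From mathcomp Require Import measurable_realfun.
From mathcomp Require Import ring lra.
Set Implicit Arguments.
Unset Strict Implicit.
Unset Printing Implicit Defensive.
Import Order.TTheory GRing.Theory Num.Theory.
Import numFieldNormedType.Exports.
Local Open Scope classical_set_scope.
Local Open Scope ring_scope.

(** * Curves *)

(** An upper gradient controls [u] only along curves, and [u] is defined at every point, so a point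
    has to be reached by curves. The infimum of the line integrals of rho' over curves from x has no
    evident measurability. Chain distances for Lipschitz functions are continuous, so the Poincare
    inequality applies to them; the monotone limit is taken only at the end. The summand 1 in rho'^Q
    = 1 + G makes cost dominate length, which keeps the chains in a bounded, hence totally bounded,
    set. It is harmless: the measure of B(x, lambda 2^-k) is at most a constant times 2^(-kQ), and q
    >= 1/2. The choice of q is a compromise. Thinness for every alpha > 0 needs q^(-Q) 2^(-alpha) <
    1 far out, so q must tend to 1; the geometric series of Poincare bounds costs 1 / (1 - q), which
    must remain o((log|x|)^p). For the averages, the Poincare bound is the same at all radii, since
    its exponent Q is also the dimension; Hoelder's inequality over log|x| steps then produces p = 1
    - 1/Q. *)

Section CurveLength.
Context {R : realType} {X : pmetricType R}.
Implicit Types (c : R -> X) (a b s t : R).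

Lemma polygonal_length_nil a c : polygonal_length a c [::] = 0.
Proof. by rewrite /polygonal_length big_ord0. Qed.

Lemma polygonal_length_cons a c z q :
  polygonal_length a c (z :: q) =
  mdist (c a) (c z) + polygonal_length z c q.
Proof.
rewrite /polygonal_length big_ord_recl /=; congr (_ + _).
apply: eq_bigr => i _; rewrite /= add0n.
by congr (mdist (c _) (c _)); apply: set_nth_default => //=; rewrite ltnS ltnW.
Qed.

Lemma polygonal_length_ge0 a c p : 0 <= polygonal_length a c p.
Proof. by apply: sumr_ge0 => i _; exact: mdist_ge0. Qed.

Lemma polygonal_length_cat a c p q :
  polygonal_length a c (p ++ q) =
  polygonal_length a c p + polygonal_length (last a p) c q.
Proof.
elim: p a => [|z p ih] a /=; first by rewrite polygonal_length_nil add0r.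
by rewrite !polygonal_length_cons ih addrA.
Qed.

Lemma polygonal_length_le c a b p : itv_partition a b p ->
  ((polygonal_length a c p)%:E <= curve_length c a b)%E.
Proof. by move=> pp; apply: ereal_sup_ubound; exists p. Qed.

Lemma itv_partition_exists a b : a <= b -> exists p, itv_partition a b p.
Proof.
rewrite le_eqVlt => /predU1P[->|ab]; first by exists [::]; split => //=.
by exists [:: b]; exact: itv_partition1.
Qed.

Lemma curve_length_ge0 c a b : a <= b -> (0 <= curve_length c a b)%E.
Proof.
move=> /itv_partition_exists[p /polygonal_length_le] /(_ c); apply: le_trans.
by rewrite lee_fin polygonal_length_ge0.
Qed.

Lemma mdist_le_curve_length c a b : a <= b ->
  ((mdist (c a) (c b))%:E <= curve_length c a b)%E.
Proof.
rewrite le_eqVlt => /predU1P[->|ab].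
  by rewrite mdistxx curve_length_ge0.
apply: le_trans (polygonal_length_le c (itv_partition1 ab)).
by rewrite polygonal_length_cons polygonal_length_nil addr0.
Qed.

Lemma curve_length_superadd c a t b : a <= t -> t <= b ->
  (curve_length c a t + curve_length c t b <= curve_length c a b)%E.
Proof.
move=> at_ tb; have [|fin] := eqVneq (curve_length c a b) +oo%E.
  by move=> ->; rewrite leey.
have key p q : itv_partition a t p -> itv_partition t b q ->
    ((polygonal_length a c p)%:E + (polygonal_length t c q)%:E
       <= curve_length c a b)%E.
  move=> pp pq; rewrite -EFinD.
  have <- : last a p = t by case: pp => _ /eqP.
  rewrite -polygonal_length_cat; apply: polygonal_length_le.
  exact: itv_partition_cat pp pq.
have fint : curve_length c t b \is a fin_num.
  have [p pp] := itv_partition_exists at_.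
  rewrite ge0_fin_numE ?curve_length_ge0//.
  apply: (@le_lt_trans _ _ (curve_length c a b)); last by rewrite ltey.
  apply: ge_ereal_sup => _ [q pq <-].
  apply: le_trans (key _ _ pp pq).
  by rewrite leeDr// lee_fin polygonal_length_ge0.
rewrite -leeBrDr//; apply: ge_ereal_sup => _ [p pp <-].
rewrite leeBrDr// -leeBrDl//; apply: ge_ereal_sup => _ [q pq <-].
by rewrite leeBrDl//; exact: key.
Qed.

(** Inserting [t] into a partition does not lower its polygonal length; the induction walks along
    the partition to the first point beyond [t]. *)
Lemma curve_length_split c a t b : a <= t -> t <= b ->
  curve_length c a b = (curve_length c a t + curve_length c t b)%E.
Proof.
move=> at_ tb; apply/eqP; rewrite eq_le curve_length_superadd// andbT.
apply: ge_ereal_sup => _ [p pp <-].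
elim: p a at_ pp => [|z q ih] a at_ pp.
  by rewrite polygonal_length_nil adde_ge0 ?curve_length_ge0.
have az : a < z by case: pp => /= /andP[].
rewrite polygonal_length_cons EFinD.
have [zt|tz] := leP z t.
  apply: (le_trans (leeD2l _ (ih _ zt (itv_partition_cons pp)))).
  rewrite addeA leeD2r//.
  apply: le_trans (leeD2r _ (mdist_le_curve_length c (ltW az))) _.
  exact: curve_length_superadd (ltW az) zt.
apply: (@le_trans _ _ ((mdist (c a) (c t))%:E +
   ((mdist (c t) (c z))%:E + (polygonal_length z c q)%:E))%E).
  by rewrite addeA leeD2r// -EFinD lee_fin metric_triangle.
apply: leeD; first exact: mdist_le_curve_length.
rewrite -EFinD -polygonal_length_cons; apply: polygonal_length_le.
by case: pp => /= /andP[_ zq] qb; split => //=; rewrite tz.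
Qed.

End CurveLength.

(** * Arc length is continuous, and its parametrization is 1-Lipschitz *)

Section ArcLength.
Context {R : realType} {X : pmetricType R}.
Variables (c : R -> X) (a b : R).
Hypothesis hc : rectifiable_curve c a b.
Local Notation L t := (fine (curve_length c a t)).

Let ab : a <= b. Proof. by case: hc. Qed.

Lemma curve_length_fin_num s t : a <= s -> s <= t -> t <= b ->
  curve_length c s t \is a fin_num.
Proof.
move=> as_ st tb; rewrite ge0_fin_numE ?curve_length_ge0//.
case: hc => _ _; apply: le_lt_trans.
rewrite (curve_length_split c (le_trans as_ st) tb) (curve_length_split c as_ st).
rewrite -addeA addeCA leeDl// adde_ge0// curve_length_ge0//.
Qed.

Lemma arc_length0 : L a = 0.
Proof.
have := curve_length_split c (lexx a) (lexx a).
have := curve_length_fin_num (lexx a) (lexx a) ab.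
by move=> /fineK <-; rewrite -EFinD => -[] /eqP; rewrite -subr_eq0 opprD addNKr oppr_eq0 => /eqP.
Qed.

Lemma curve_length_subE s t : a <= s -> s <= t -> t <= b ->
  curve_length c s t = (L t - L s)%:E.
Proof.
move=> as_ st tb; rewrite (curve_length_split c as_ st) fineD ?curve_length_fin_num//; last first.
  exact: le_trans tb.
by rewrite addrAC subrr add0r fineK// curve_length_fin_num.
Qed.

Lemma mdist_le_arc_length s t : a <= s -> s <= t -> t <= b ->
  mdist (c s) (c t) <= L t - L s.
Proof.
move=> as_ st tb; rewrite -lee_fin -curve_length_subE//.
exact: mdist_le_curve_length.
Qed.

Lemma arc_length_le s t : a <= s -> s <= t -> t <= b -> L s <= L t.
Proof.
move=> as_ st tb; rewrite -subr_ge0; apply: le_trans (mdist_le_arc_length as_ st tb).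
exact: mdist_ge0.
Qed.

Lemma rectifiable_curve_near t0 (e : R) : a <= t0 -> t0 <= b -> 0 < e ->
  exists2 d : R, 0 < d & forall t, a <= t -> t <= b -> `|t - t0| < d ->
    mdist (c t0) (c t) < e.
Proof.
move=> at0 t0b e0; case: hc => _ /subspace_continuousP /(_ t0) + _.
rewrite /= in_itv/= at0 t0b => /(_ isT) /cvg_ballP /(_ e e0).
move=> /nbhs_ballP[d /= d0 H]; exists d => // t a_t tb td.
have := H t; rewrite ballEmdist /= in_itv/= a_t tb; apply => //.
by rewrite /ball/= distrC.
Qed.

(** On the left, take a partition of [a, t0] whose polygonal length is within e/2 of [L t0]. For t
    inside its last edge, that edge is at most the detour through [c t], whose part up to [c t] is
    paid by [L t], while continuity makes the part from [c t] to [c t0] shorter than e/2. On the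
    right, the first edge of a partition of [t0, b] plays the same role. *)
Lemma arc_length_near t0 (e : R) : a <= t0 -> t0 <= b -> 0 < e ->
  exists2 d : R, 0 < d & forall t, a <= t -> t <= b -> `|t - t0| < d ->
    `|L t - L t0| < e.
Proof.
move=> at0 t0b e0; have e20 : 0 < e / 2 by rewrite divr_gt0.
have [d1 d10 near] := rectifiable_curve_near at0 t0b e20.
have [dl dl0 left] : exists2 d : R, 0 < d &
    forall t, a <= t -> t < t0 -> t0 - t < d -> L t0 - L t < e.
  move: (at0); rewrite le_eqVlt => /predU1P[<-|at0'].
    by exists 1 => // t a_t /(le_lt_trans a_t); rewrite ltxx.
  have : ((L t0 - e / 2)%:E < curve_length c a t0)%E.
    rewrite -(fineK (curve_length_fin_num (lexx a) at0 t0b)) lte_fin.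
    by rewrite ltrBlDr ltrDl.
  move=> /ereal_sup_gt[_ [p pp <-]]; rewrite lte_fin => Lp.
  case/lastP: p pp Lp => [|p z] pp Lp.
    by move/itv_partition_nil : pp at0' => ->; rewrite ltxx.
  have zt0 : z = t0 by case: pp => _; rewrite last_rcons => /eqP.
  subst z; case: pp; rewrite rcons_path => /andP[pp lpt0] _.
  set z := last a p in lpt0.
  have pz : itv_partition a z p by split.
  have az := itv_partition_le pz.
  exists (Num.min d1 (t0 - z)); first by rewrite lt_min d10 subr_gt0.
  move=> t a_t tt0; rewrite lt_min => /andP[td1 tz].
  have {}tz : z < t by move: tz; rewrite ltrD2l ltrN2.
  have tb : t <= b by rewrite (le_trans _ t0b)// ltW.
  have /near : `|t - t0| < d1 by rewrite distrC gtr0_norm// subr_gt0.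
  move=> /(_ a_t tb) dt.
  move: Lp; rewrite -cats1 polygonal_length_cat polygonal_length_cons.
  rewrite polygonal_length_nil addr0 -/z.
  have := polygonal_length_le c pz.
  rewrite -(fineK (curve_length_fin_num (lexx a) az (le_trans (ltW tz) tb))) lee_fin.
  have := mdist_le_arc_length az (ltW tz) tb.
  have := metric_triangle (c z) (c t) (c t0).
  rewrite (metric_sym (c t)).
  move=> *; lra.
have [dr dr0 right] : exists2 d : R, 0 < d &
    forall t, t <= b -> t0 < t -> t - t0 < d -> L t - L t0 < e.
  move: (t0b); rewrite le_eqVlt => /predU1P[->|t0b'].
    by exists 1 => // t a_t /lt_le_trans-/(_ _ a_t); rewrite ltxx.
  have Lfin := curve_length_fin_num at0 t0b (lexx b).
  have : ((fine (curve_length c t0 b) - e / 2)%:E < curve_length c t0 b)%E.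
    by rewrite -{2}(fineK Lfin) lte_fin ltrBlDr ltrDl.
  move=> /ereal_sup_gt[_ [p pp <-]]; rewrite lte_fin => Lp.
  case: p pp Lp => [|z p] pp Lp.
    by move/itv_partition_nil : pp t0b' => ->; rewrite ltxx.
  have pz := itv_partition_cons pp.
  have zb := itv_partition_le pz.
  have t0z : t0 < z by case: pp => /= /andP[].
  exists (Num.min d1 (z - t0)); first by rewrite lt_min d10 subr_gt0.
  move=> t tb tt0; rewrite lt_min => /andP[td1 tz].
  have {}tz : t < z by move: tz; rewrite ltrD2r.
  have a_t : a <= t by rewrite (le_trans at0)// ltW.
  have /near : `|t - t0| < d1 by rewrite gtr0_norm// subr_gt0.
  move=> /(_ a_t tb) dt.
  move: Lp; rewrite polygonal_length_cons.
  have := polygonal_length_le c pz.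
  have az : a <= z by rewrite (le_trans a_t)// ltW.
  rewrite (curve_length_subE az zb)// (curve_length_subE at0 t0b)//=.
  rewrite lee_fin /=.
  have := mdist_le_arc_length a_t (ltW tz) zb.
  have := metric_triangle (c t0) (c t) (c z).
  move=> *; lra.
exists (Num.min dl dr); first by rewrite lt_min dl0.
move=> t a_t tb; rewrite lt_min => /andP[tl tr].
have [tt0|tt0|->] := ltgtP t t0; last by rewrite subrr normr0.
- rewrite distrC ger0_norm ?subr_ge0 ?arc_length_le ?(ltW tt0)//.
  by rewrite left// -(gtr0_norm (_ : 0 < t0 - t)) ?subr_gt0// distrC.
- rewrite ger0_norm ?subr_ge0 ?arc_length_le ?(ltW tt0)//.
  by rewrite right// -(gtr0_norm (_ : 0 < t - t0)) ?subr_gt0.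
Qed.

Lemma arc_length_surj s : 0 <= s -> s <= L b ->
  exists t, [/\ a <= t, t <= b & L t = s].
Proof.
move=> s0 sb; have [||t] := @IVT R (fun t => L t) a b s ab.
- apply/subspace_continuousP => t0 /=; rewrite in_itv/= => /andP[at0 t0b].
  apply/cvg_ballP => e e0.
  have [d d0 H] := arc_length_near at0 t0b e0.
  apply/nbhs_ballP; exists d => //= t; rewrite /ball/= => td.
  rewrite in_itv/= => /andP[a_t tb].
  by rewrite distrC H// distrC.
- rewrite arc_length0 ge_min s0/= le_max sb orbT//.
- by rewrite in_itv/= => /andP[? ?] ?; exists t.
Qed.

Lemma eq_arc_length s t : a <= s -> s <= b -> a <= t -> t <= b ->
  L s = L t -> c s = c t.
Proof.
wlog st : s t / s <= t.
  move=> H; have [/H//|ts] := leP s t.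
  by move=> as_ sb a_t tb Lst; apply/esym/H => //; exact: ltW.
move=> as_ sb a_t tb Lst; apply: mdist_positivity; apply/eqP.
by rewrite eq_le mdist_ge0 andbT (le_trans (mdist_le_arc_length as_ st tb))// Lst subrr.
Qed.

(** The fibre of [L] over [s] contains its infimum because [L] is continuous, so the chosen
    parameter does have arc length [s]. *)
Lemma arc_length_paramP s : 0 <= s -> s <= L b ->
  exists t, [/\ a <= t, t <= b, L t = s & arc_length_param c a b s = c t].
Proof.
move=> s0 sb; rewrite /arc_length_param; set S := [set t | _].
have [t1 [at1 t1b Lt1]] := arc_length_surj s0 sb.
have St1 : S t1.
  split; first by rewrite at1.
  by rewrite -(fineK (curve_length_fin_num (lexx a) at1 t1b)) Lt1.
have lbS : lbound S a by move=> t [/andP[]].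
have infS : has_inf S by split; [exists t1|exists a].
have at0 : a <= inf S by apply: lb_le_inf => //; exists t1.
have t0t1 : inf S <= t1 by apply: ge_inf => //; exists a.
have t0b : inf S <= b by exact: le_trans t1b.
exists (inf S); split => //.
apply/eqP; rewrite eq_le; apply/andP; split.
  by rewrite -Lt1 arc_length_le.
apply/ler_addgt0Pr => e e0.
have [d d0 H] := arc_length_near at0 t0b e0.
have [t [/andP[a_t tb] St] td] := inf_adherent d0 infS.
have Lt : L t = s by rewrite St.
have : inf S <= t by apply: ge_inf; [exists a|split => //; rewrite a_t].
move=> t0t; have := H t a_t tb; rewrite ger0_norm ?subr_ge0// ltrBlDl => /(_ td).
by rewrite Lt => /ltr_normlW; rewrite ltrBlDl addrC => /ltW; rewrite addrC.
Qed.

Lemma arc_length_paramK t : a <= t -> t <= b ->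
  arc_length_param c a b (L t) = c t.
Proof.
move=> a_t tb; have [||t' [at' t'b Lt ->]] := @arc_length_paramP (L t).
- by rewrite -arc_length0 arc_length_le.
- by rewrite arc_length_le.
- exact: eq_arc_length.
Qed.

Lemma arc_length_param_lip s s' : 0 <= s -> s <= s' -> s' <= L b ->
  mdist (arc_length_param c a b s) (arc_length_param c a b s') <= s' - s.
Proof.
move=> s0 ss' s'b.
have [t [a_t tb Lt ->]] := arc_length_paramP s0 (le_trans ss' s'b).
have [t' [a_t' tb' Lt' ->]] := arc_length_paramP (le_trans s0 ss') s'b.
have [tt'|t't] := leP t t'.
  by rewrite -Lt -Lt' mdist_le_arc_length.
rewrite metric_sym (le_trans (mdist_le_arc_length a_t' (ltW t't) tb))// Lt Lt'.
have := arc_length_le a_t' (ltW t't) tb; rewrite Lt Lt' => ?; lra.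
Qed.

End ArcLength.

(** * Line integrals, subarcs, and a criterion for upper gradients *)

Section LineIntegral.
Context {R : realType} {X : pmetricType R}.
Implicit Types (c g : R -> X) (a b s t p q l : R).

Lemma continuous_borel_comp g (rho : X -> \bar R) :
  continuous g -> borel_fun rho -> measurable_fun [set: R] (rho \o g).
Proof.
move=> cg mrho.
apply: (@measurable_comp _ _ _ _ (g_sigma_algebraType (@open X)) _ setT) => //.
apply: (@measurability _ _ _ (g_sigma_algebraType (@open X)) _ _ open) => //.
move=> _ [V oV <-]; rewrite setTI.
by apply: open_measurable; apply: open_comp => // x _; exact: cg.
Qed.

Lemma lipschitz_continuous g :
  (forall s t, s <= t -> mdist (g s) (g t) <= t - s) -> continuous g.
Proof.
move=> gl s; apply/cvg_ballP => e e0; apply/nbhs_ballP; exists e => //= t.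
rewrite ballEmdist /ball /= => st; apply: le_lt_trans st.
have [le_st|/ltW le_ts] := leP s t.
  by rewrite distrC ger0_norm ?subr_ge0// gl.
by rewrite ger0_norm ?subr_ge0// metric_sym gl.
Qed.

Lemma lipschitz_borel_comp g l (rho : X -> \bar R) : 0 <= l ->
  (forall s t, 0 <= s -> s <= t -> t <= l -> mdist (g s) (g t) <= t - s) ->
  borel_fun rho -> measurable_fun `[0, l] (rho \o g).
Proof.
move=> l0 gl mrho.
(* Clamping to [0, l] extends the curve to a 1-Lipschitz map on the whole line, where measurability
   follows from continuity. *)
pose cl s := Num.max 0 (Num.min s l).
apply: (@eq_measurable_fun _ _ _ _ _ (rho \o (g \o cl))).
  move=> s; rewrite inE/= in_itv/= => /andP[s0 sl].
  by congr (rho (g _)); rewrite /cl (min_idPl sl) (max_idPr s0).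
apply: measurable_funTS; apply: continuous_borel_comp => //.
apply: lipschitz_continuous => s t st /=.
have clst : cl s <= cl t.
  by rewrite /cl ge_max !le_max lexx/= le_min !ge_min st lexx !orbT.
apply: le_trans (gl _ _ _ clst _) _.
- by rewrite le_max lexx.
- by rewrite ge_max l0 ge_min lexx orbT.
- rewrite /cl; case: (leP s l) => ?; case: (leP t l) => ?;
    rewrite ?(max_idPr l0); case: (leP 0 s) => ?; case: (leP 0 t) => ?; lra.
Qed.

Section shift.
Variable p : R.
Let phi : measurableTypeR R -> measurableTypeR R := +%R p.
Let mphi : measurable_fun [set: measurableTypeR R] phi.
Proof. exact: measurable_funD. Qed.
Let mphi_mixin := isMeasurableFun.Build _ _ _ _ _ mphi.
HB.instance Definition _ := mphi_mixin.

Lemma lebesgue_measure_shift (A : set R) : measurable A ->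
  pushforward lebesgue_measure phi A = lebesgue_measure A.
Proof.
move=> mA; apply/esym/lebesgue_measure_unique => //= _ [[a b]] _ <-.
rewrite /pushforward.
have -> : phi @^-1` `]a, b] = `]a - p, b - p]%classic.
  by apply/seteqP; split => s /=; rewrite !in_itv/= /phi => /andP[? ?]; apply/andP; split; lra.
by rewrite !lebesgue_measure_itv/= !lte_fin ltrD2r -!EFinB opprB addrA subrK.
Qed.

End shift.

Lemma ge0_integral_shift p q (F : R -> \bar R) :
  measurable_fun `[p, q] F -> (forall s, (0 <= F s)%E) ->
  (\int[lebesgue_measure]_(s in `[0%R, (q - p)%R]) F (p + s)%R =
   \int[lebesgue_measure]_(s in `[p, q]) F s)%E.
Proof.
move=> mF F0; rewrite (_ : `[0%R, (q - p)%R]%classic =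
    (+%R p : _ -> measurableTypeR R) @^-1` `[p, q]); last first.
  by apply/seteqP; split => s /=; rewrite !in_itv/= => /andP[? ?]; apply/andP; split; lra.
rewrite -ge0_integral_pushforward//=.
by apply: eq_measure_integral => //= A mA AS; exact: lebesgue_measure_shift.
Qed.

(** The subcurve between parameters of arc length p and q has the arc-length parametrization s |-> g
    (p + s), so its line integral is a translate of the integral over [p, q]. *)
Lemma upper_gradient_arc (u : X -> R) (rho : X -> \bar R) c a b p q :
  upper_gradient u rho -> rectifiable_curve c a b ->
  0 <= p -> p <= q -> q <= fine (curve_length c a b) ->
  (`|u (arc_length_param c a b p) - u (arc_length_param c a b q)|%:E <=
   \int[lebesgue_measure]_(s in `[p, q]) rho (arc_length_param c a b s))%E.
Proof.
move=> [mrho rho0 ug] hc p0 pq ql.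
set g := arc_length_param c a b; set l := fine _ in ql.
have pl : p <= l by exact: le_trans ql.
have q0 : 0 <= q by exact: le_trans pq.
have [tp [atp tpb Ltp gp]] := arc_length_paramP hc p0 pl.
have [tq [atq tqb Ltq gq]] := arc_length_paramP hc q0 ql.
have [tpq|tqp] := leP tp tq; last first.
  have := arc_length_le hc atq (ltW tqp) tpb; rewrite Ltp Ltq => qp.
  have -> : p = q by apply/le_anti/andP.
  by rewrite subrr normr0 integral_ge0// => s _; exact: rho0.
have hc' : rectifiable_curve c tp tq.
  split => //.
  - case: hc => _ + _; apply: continuous_subspaceW => s /=.
    by rewrite !in_itv/= => /andP[s1 s2]; rewrite (le_trans atp)//= (le_trans s2).
  - by rewrite (curve_length_subE hc)// ltry.
rewrite -/g in gp gq.
have := ug _ _ _ hc'; rewrite gp gq => /le_trans; apply.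
rewrite /line_integral (curve_length_subE hc)//= Ltp Ltq.
rewrite le_eqVlt; apply/orP; left; apply/eqP.
transitivity (\int[lebesgue_measure]_(s in `[0%R, (q - p)%R]) rho (g (p + s)%R))%E.
  apply: eq_integral => s; rewrite inE /= in_itv/= => /andP[s0 sl].
  have [|t [tpt ttq Lt ->]] := arc_length_paramP hc' s0.
    by rewrite (curve_length_subE hc)//= Ltp Ltq.
  move: Lt; rewrite (curve_length_subE hc)//=; last exact: le_trans tqb.
  rewrite Ltp => Lt; rewrite /g.
  have -> : p + s = fine (curve_length c a t) by rewrite -Lt addrC subrK.
  by rewrite arc_length_paramK// ?(le_trans atp)// (le_trans ttq).
rewrite (@ge0_integral_shift p q (rho \o g))//.
- apply: (@measurable_funS _ _ _ _ `[0, l]) => //.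
    by move=> s /=; rewrite !in_itv/= => /andP[ps sq]; rewrite (le_trans p0)//= (le_trans sq).
  apply: lipschitz_borel_comp => //; first exact: le_trans pl.
  exact: arc_length_param_lip.
- by move=> s; exact: rho0.
Qed.

Lemma curve_length_lip_le g a b (K : R) : a <= b ->
  (forall s t, a <= s -> s <= t -> t <= b -> mdist (g s) (g t) <= K * (t - s)) ->
  (curve_length g a b <= (K * (b - a))%:E)%E.
Proof.
move=> ab gl; apply: ge_ereal_sup => _ [r rr <-]; rewrite lee_fin.
elim: r a ab gl rr => [|z r ih] a ab gl rr.
  by rewrite polygonal_length_nil (itv_partition_nil rr) subrr mulr0.
have zb := itv_partition_le (itv_partition_cons rr).
have az : a <= z by case: rr => /= /andP[/ltW].
rewrite polygonal_length_cons.
have -> : K * (b - a) = K * (z - a) + K * (b - z) by ring.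
apply: lerD; first exact: gl.
apply: ih (itv_partition_cons rr) => // s t zs st tb.
by apply: gl => //; exact: le_trans zs.
Qed.

Lemma lipschitz_rectifiable g a b : a <= b ->
  (forall s t, a <= s -> s <= t -> t <= b -> mdist (g s) (g t) <= t - s) ->
  rectifiable_curve g a b.
Proof.
move=> ab gl; split => //; last first.
  apply: (@le_lt_trans _ _ (1 * (b - a))%:E); last by rewrite ltry.
  by apply: curve_length_lip_le => // s t as_ st tb; rewrite mul1r gl.
apply/subspace_continuousP => s /=; rewrite in_itv/= => /andP[as_ sb].
apply/cvg_ballP => e e0; apply/nbhs_ballP; exists e => //= t.
rewrite ballEmdist /ball /= in_itv/= => st /andP[a_t tb].
apply: le_lt_trans st.
have [le_st|/ltW le_ts] := leP s t.
  by rewrite distrC ger0_norm ?subr_ge0// gl.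
by rewrite ger0_norm ?subr_ge0// metric_sym gl.
Qed.

Lemma ge0_integral_itv_split (F : R -> \bar R) p q t : p <= q -> q <= t ->
  measurable_fun `[p, t] F -> (forall s, `[p, t]%classic s -> (0 <= F s)%E) ->
  (\int[lebesgue_measure]_(s in `[p, t]) F s =
   \int[lebesgue_measure]_(s in `[p, q]) F s +
   \int[lebesgue_measure]_(s in `[q, t]) F s)%E.
Proof.
move=> pq qt mF F0.
have E : `[p, t]%classic = `[p, q] `|` `]q, t].
  by rewrite -itv_bndbnd_setU// bnd_simp.
rewrite E ge0_integral_setU//.
- congr (_ + _)%E; apply: integral_itv_obnd_cbnd.
  by apply: measurable_funS mF => //; rewrite E; exact: subsetUr.
- by rewrite -E.
- by rewrite -E.
- apply/disj_setPRL => s /=; rewrite !in_itv/= => /andP[qs _].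
  by apply/negP; rewrite negb_and -!ltNge qs orbT.
Qed.

Lemma continuous_borel_fun (f : X -> R) : continuous f -> borel_fun (EFin \o f).
Proof.
move=> cf; apply/measurable_EFinP.
apply: (measurability _ (RGenOpens.measurableE R)).
move=> _ [_ [x [y ->]] <-]; rewrite setTI.
by apply: sub_gen_smallest; apply: open_comp => // z _; exact: cf.
Qed.

Lemma K_lipschitz_continuous (f : X -> R) (K : R) :
  (forall y z, f z <= f y + K * mdist y z) -> continuous f.
Proof.
move=> fl y; have K0 : 0 <= Num.max K 0 by rewrite le_max lexx orbT.
apply/cvg_ballP => e e0.
have e' : 0 < e / (Num.max K 0 + 1) by rewrite divr_gt0// ltr_wpDl.
apply/nbhs_ballP; exists (e / (Num.max K 0 + 1)) => //= z.
rewrite ballEmdist /ball /= ltr_pdivlMr ?ltr_wpDl// => yz.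
have yz0 := mdist_ge0 y z.
have le1 : K * mdist y z <= mdist y z * (Num.max K 0 + 1).
  rewrite mulrC ler_wpM2l//; apply: (@le_trans _ _ (Num.max K 0)).
    by rewrite le_max lexx.
  by rewrite lerDl.
have := fl y z; have := fl z y; rewrite (metric_sym z) => h1 h2.
by rewrite ltr_norml; apply/andP; split; lra.
Qed.

(** Cut the curve into pieces of arc length h < d. On each piece V varies by at most f h + K h^2,
    with f taken at the left end, and f h exceeds the integral of f over the piece by at most K h^2.
    With about l / h pieces the total error 2 K h l vanishes as h tends to 0. *)
Lemma le_lip_upper_gradient (V f : X -> R) (K d : R) :
  0 <= K -> 0 < d -> (forall y, 0 <= f y) ->
  (forall y z, f z <= f y + K * mdist y z) ->
  (forall y z, mdist y z < d ->
     `|V y - V z| <= (f y + K * mdist y z) * mdist y z) ->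
  upper_gradient V (EFin \o f).
Proof.
move=> K0 d0 f0 fl Vl.
have cf := K_lipschitz_continuous fl.
split; [exact: continuous_borel_fun|by move=> y; rewrite lee_fin|].
move=> c a b hc; rewrite /line_integral.
have ab : a <= b by case: hc.
set l := fine _; set g := arc_length_param c a b.
have l0 : 0 <= l by rewrite fine_ge0// curve_length_ge0.
have gl s t : 0 <= s -> s <= t -> t <= l -> mdist (g s) (g t) <= t - s.
  exact: arc_length_param_lip.
have <- : g 0 = c a.
  by rewrite /g -(arc_length0 hc) arc_length_paramK.
have <- : g l = c b by rewrite /g arc_length_paramK.
have mF : measurable_fun `[0, l] (fun s => (f (g s))%:E).
  by apply: (@lipschitz_borel_comp g l (EFin \o f)) => //; exact: continuous_borel_fun.
have F0 s : (0 <= (f (g s))%:E)%E by rewrite lee_fin.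
have step (h : R) n : 0 <= h -> h < d -> h *+ n <= l ->
    (`|V (g 0) - V (g (h *+ n))|%:E <=
      \int[lebesgue_measure]_(s in `[0%R, (h *+ n)%R]) (f (g s))%:E
        + ((2 * K * h * h) *+ n)%:E)%E.
  move=> h0 hd; elim: n => [|n ih] nl.
    rewrite !mulr0n subrr normr0 adde0 integral_ge0//.
  have nl' : h *+ n <= l by apply: le_trans nl; rewrite mulrS lerDr.
  have n0 : 0 <= h *+ n by rewrite mulrn_wge0.
  have nn : h *+ n <= h *+ n.+1 by rewrite mulrS lerDr.
  pose A := (\int[lebesgue_measure]_(s in `[0%R, (h *+ n)%R]) (f (g s))%:E)%E.
  pose B := (\int[lebesgue_measure]_(s in `[(h *+ n)%R, (h *+ n.+1)%R]) (f (g s))%:E)%E.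
  have := ih nl'; rewrite -/A => ihn.
  have sub p q : 0 <= p -> q <= l -> `[p, q]%classic `<=` `[0, l]%classic.
    move=> p0 ql s /=; rewrite !in_itv/= => /andP[ps sq].
    by rewrite (le_trans p0)//= (le_trans sq).
  rewrite (ge0_integral_itv_split n0 nn) -/A -/B; last 2 first.
  - by apply: measurable_funS mF => //; exact: sub.
  - by move=> s _.
  have dist_n : mdist (g (h *+ n)) (g (h *+ n.+1)) <= h.
    by apply: le_trans (gl _ _ n0 nn nl) _; rewrite mulrSr addrAC subrr add0r.
  have hB : ((f (g (h *+ n)) * h)%:E <= B + (K * h * h)%:E)%E.
    have cstE (r : R) : (\int[lebesgue_measure]_(s in `[(h *+ n)%R, (h *+ n.+1)%R]) (cst r%:E s) = (r * h)%:E)%E.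
      rewrite integral_cst//= lebesgue_measure_itv/= lte_fin.
      have [hh|hh] := ltP (h *+ n) (h *+ n.+1).
        by rewrite -EFinB -EFinM mulrSr addrAC subrr add0r.
      have -> : h = 0.
        apply/le_anti; rewrite h0 andbT.
        by move: hh; rewrite mulrS gerDr.
      by rewrite mulr0 mule0.
    rewrite -cstE -(cstE (K * h)) -ge0_integralD//; last 2 first.
    - by apply: measurable_funS mF => //; exact: sub.
    - by move=> s _; rewrite lee_fin mulr_ge0.
    apply: ge0_le_integral => //.
    - by move=> s _; exact: F0.
    - apply: emeasurable_funD => //.
      by apply: measurable_funS mF => //; exact: sub.
    - move=> s /=; rewrite in_itv/= => /andP[ns sn].
      rewrite -EFinD lee_fin.
      apply: le_trans (fl (g s) _) _; rewrite lerD2l ler_wpM2l//.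
      rewrite metric_sym; apply: le_trans (gl _ _ n0 ns (le_trans sn nl)) _.
      by move: sn; rewrite mulrSr => ?; lra.
  have hV : `|V (g 0) - V (g (h *+ n.+1))| <= `|V (g 0) - V (g (h *+ n))| + (f (g (h *+ n)) * h + K * h * h).
    apply: le_trans (ler_distD (V (g (h *+ n))) _ _) _; rewrite lerD2l.
    apply: le_trans (Vl _ _ (le_lt_trans dist_n hd)) _.
    rewrite -mulrDl; apply: ler_pM => //; rewrite ?addr_ge0 ?mulr_ge0 ?mdist_ge0//.
    by rewrite lerD2l ler_wpM2l.
  apply: (@le_trans _ _ (`|V (g 0) - V (g (h *+ n))|%:E + ((f (g (h *+ n)) * h)%:E + (K * h * h)%:E))%E).
    by rewrite -!EFinD lee_fin.
  apply: (@le_trans _ _ ((A + ((2 * K * h * h) *+ n)%:E) + ((B + (K * h * h)%:E) + (K * h * h)%:E))%E).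
    by apply: leeD => //; apply: leeD.
  rewrite -(addeA B) addeACA leeD2l// -!EFinD lee_fin (mulrSr (2 * K * h * h)) lerD2l; lra.
apply/lee_addgt0Pr => e e0.
(* With n + 1 > M pieces, the first entry gives h < d and the second bounds the accumulated error by
   e. *)
pose M := Num.max (l / d) (2 * K * l * l / e).
have [n] : exists n : nat, M < n.+1%:R.
  exists (Num.truncn M); rewrite truncnS_gt//.
rewrite gt_max => /andP[n1 n2].
have n0 : 0 < n.+1%:R :> R by rewrite ltr0n.
have hl : (l / n.+1%:R) *+ n.+1 = l by rewrite -mulr_natr divfK// gt_eqF.
have := step (l / n.+1%:R) n.+1; rewrite hl divr_ge0// ?lexx// => /(_ isT) H.
apply: (le_trans (H _ isT)).
  by rewrite ltr_pdivrMr// mulrC -ltr_pdivrMr.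
rewrite leeD2l// lee_fin -mulr_natr.
have -> : 2 * K * (l / n.+1%:R) * (l / n.+1%:R) * n.+1%:R = 2 * K * l * l / n.+1%:R.
  by field; rewrite gt_eqF.
by rewrite ler_pdivrMr// [leRHS]mulrC -ler_pdivrMr// ltW.
Qed.

End LineIntegral.

(** * Outer regularity and lower semicontinuous majorants *)

Lemma nonincreasing_measure_small d (T : measurableType d) (R : realType)
    (m : {measure set T -> \bar R}) (J : (set T)^nat) (e : R) :
  (forall n, measurable (J n)) -> (m (J 0%N) < +oo)%E ->
  {homo J : n p / (n <= p)%N >-> (p <= n)%O} -> \bigcap_n J n = set0 ->
  0 < e -> exists n, (m (J n) <= e%:E)%E.
Proof.
move=> mJ J0 Jhomo JI e0; apply/not_existsP => Je.
have : ((m \o J) n @[n --> \oo] --> 0)%E.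
  by rewrite -(measure0 m) -JI; apply: nonincreasing_cvg_mu => //; rewrite JI.
move=> /(cvge_to_ge (b := e%:E)); rewrite lee_fin leNgt e0 => H.
by apply: notF; apply: H; near=> n; move/negP: (Je n); rewrite -ltNge => /ltW.
Unshelve. all: by end_near. Qed.

Section BorelMeasure.
Context {R : realType} {X : pmetricType R}.
Variable mu : {outer_measure set X -> \bar R}.
Hypothesis mu_breg : borel_regular mu.
Hypothesis mu_ball_fin : forall (x : X) (r : R), (mu (ball x r) < +oo)%E.

Lemma open_mball (x : X) (r : R) : open (ball x r).
Proof.
rewrite openE => y; rewrite ballEmdist /= => xy.
apply/nbhs_ballP; exists (r - mdist x y); first by rewrite /= subr_gt0.
move=> z; rewrite !ballEmdist/= => yz.
by have := metric_triangle x y z => ?; lra.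
Qed.

Lemma bigcup_ball_nat (x : X) : \bigcup_n ball x n%:R = [set: X].
Proof.
apply/seteqP; split => // y _; exists (Num.truncn (mdist x y)).+1 => //.
by rewrite ballEmdist /= truncnS_gt.
Qed.

Lemma open_borel (U : set X) : open U -> borel U.
Proof. by move=> oU; apply: sub_gen_smallest. Qed.

Lemma borel_caratheodory (A : set X) :
  borel A -> measurable (A : set (caratheodory_type mu)).
Proof. by move=> bA; apply: (proj1 mu_breg). Qed.

Lemma open_caratheodory (U : set X) :
  open U -> measurable (U : set (caratheodory_type mu)).
Proof. by move=> oU; apply: borel_caratheodory; exact: open_borel. Qed.

Lemma ball_caratheodory (x : X) (r : R) :
  measurable (ball x r : set (caratheodory_type mu)).
Proof. exact/open_caratheodory/open_mball. Qed.

Lemma borel_fun_caratheodory (f : X -> \bar R) : borel_fun f ->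
  measurable_fun [set: caratheodory_type mu] f.
Proof.
move=> mf _ B mB; rewrite setTI; apply: borel_caratheodory.
by have := mf measurableT B mB; rewrite setTI.
Qed.

Lemma borel_setC (A : set X) : borel A -> borel (~` A).
Proof. by move=> bA; have := measurableC (bA : measurable (A : set (g_sigma_algebraType (@open X)))). Qed.

Lemma borel_bigcup (A : (set X)^nat) : (forall n, borel (A n)) -> borel (\bigcup_n A n).
Proof.
move=> bA; exact: (@bigcupT_measurable _ (g_sigma_algebraType (@open X))).
Qed.

(** The excess is measured inside B only: B will be a ball, where the measure is finite and
    continuity from above is available. *)
Let outer_approx (B A : set X) := forall e : R, 0 < e ->
  exists U, [/\ open U, A `<=` U & (mu ((U `\` A) `&` B) <= e%:E)%E].

Lemma outer_measure_bigcup_le (A : (set X)^nat) (e : R) : 0 <= e ->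
  (forall n, mu (A n) <= (e / (2 ^ n.+1)%:R)%:E)%E ->
  (mu (\bigcup_n A n) <= e%:E)%E.
Proof.
move=> e0 Ae; apply: le_trans (outer_measure_sigma_subadditive mu A) _.
apply: le_trans (epsilon_trick0 xpredT e0).
by apply: lee_nneseries => n _ => //; exact: outer_measure_ge0.
Qed.

Let outer_approx_bigcup B (A : (set X)^nat) : (forall n, outer_approx B (A n)) ->
  outer_approx B (\bigcup_n A n).
Proof.
move=> oA e e0.
have en n : 0 < e / (2 ^ n.+1)%:R by rewrite divr_gt0// ltr0n expn_gt0.
have /choice[U HU] n := oA n _ (en n).
exists (\bigcup_n U n); split.
- by apply: bigcup_open => n _; case: (HU n).
- by move=> x [n _ Anx]; exists n => //; case: (HU n) => _ + _; apply.
- apply: le_trans (outer_measure_bigcup_le (ltW e0) (fun n => _ : (mu ((U n `\` A n) `&` B) <= _)%E)).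
    apply: le_outer_measure => x [[[n _ Ux] nA] Bx]; exists n => //; split => //; split => //.
    by move=> Ax; apply: nA; exists n.
  by move=> n; case: (HU n).
Qed.

(** An infinite intersection of open sets need not be open. The part [J n] of the union that the
    first n sets miss inside the ball has measure tending to 0, so intersecting finitely many of the
    open sets suffices; half of e pays for [J N] and half for the approximations. *)
Let outer_approx_bigcupC x r (A : (set X)^nat) :
  (forall n, borel (A n)) ->
  (forall n, outer_approx (ball x r) (~` A n)) ->
  outer_approx (ball x r) (~` \bigcup_n A n).
Proof.
move=> bA oA e e0; set B := ball x r; set U := \bigcup_n A n.
have e20 : 0 < e / 2 by rewrite divr_gt0.
have en n : 0 < e / 2 / (2 ^ n.+1)%:R by rewrite divr_gt0// ltr0n expn_gt0.
have /choice[V HV] n := oA n _ (en n).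
pose J n := (U `\` \bigcup_(i < n) A i) `&` B.
have mJ n : measurable (J n : set (caratheodory_type mu)).
  apply: measurableI; last exact: ball_caratheodory.
  apply: measurableD; apply: bigcup_measurable => k _; exact: borel_caratheodory.
have J0 : \bigcap_n J n = set0.
  rewrite -subset0 => y Jy; have [[[k _ Ak] _] _] := Jy 0 I.
  by have [[_ +] _] := Jy k.+1 I; apply; exists k => /=.
have [N JN] : exists N, (mu (J N) <= (e / 2)%:E)%E.
  apply: (nonincreasing_measure_small (m := mu : {measure set (caratheodory_type mu) -> \bar R})) => //.
    by apply: le_lt_trans (mu_ball_fin x r); apply: le_outer_measure => y [].
  move=> n p np; apply/subsetPset => y [[Uy nAy] By]; split => //; split => //.
  by move=> [k /= kn Ak]; apply: nAy; exists k => //=; exact: leq_trans np.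
exists (\bigcap_(i < N) V i); split.
- rewrite bigcap_mkord; elim/big_ind : _ => [|? ? ? ?|i _]; [exact: openT|exact: openI|].
  by case: (HV i).
- move=> y nU k _; have [_ + _] := HV k; apply => Ak.
  by apply: nU; exists k.
- pose W n := (V n `\` ~` A n) `&` B.
  apply: (@le_trans _ _ (mu (J N `|` \bigcup_n W n))).
    apply: le_outer_measure => y [[Vy /contrapT Uy] By].
    have [[k /= kN Ak]|nAy] := pselect ((\bigcup_(i < N) A i) y).
      by right; exists k => //; split => //; split; [exact: Vy|].
    by left.
  apply: le_trans (outer_measureU2 _ _ _) _.
  rewrite (splitr e) EFinD; apply: leeD => //.
  by apply: outer_measure_bigcup_le (ltW e20) _ => n; case: (HV n).
Qed.

(** The Borel sets that are approximable together with their complements form a sigma-algebra. It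
    contains an open U because the complement of U is the intersection of its open neighbourhoods
    [D n] of radius 1/(n+1). *)
Let outer_approx_borel x r (A : set X) : borel A ->
  outer_approx (ball x r) A /\ outer_approx (ball x r) (~` A).
Proof.
pose G := [set A : set X | [/\ borel A, outer_approx (ball x r) A &
   outer_approx (ball x r) (~` A)]].
suff : borel `<=` G by move=> /(_ A) H /H[].
have open_approx U : open U -> outer_approx (ball x r) U.
  by move=> oU e e0; exists U; split => //; rewrite setDv set0I outer_measure0 lee_fin ltW.
apply: smallest_sub.
- split.
  + split; [by apply: open_borel; exact: open0|by apply: open_approx; exact: open0|].
    by rewrite setC0; apply: open_approx; exact: openT.
  + move=> B [bB aB aBC]; rewrite setTD; split => //; first exact: borel_setC.
    by rewrite setCK.
  + move=> B GB; split.
    * by apply: borel_bigcup => n; case: (GB n).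
    * by apply: outer_approx_bigcup => n; case: (GB n).
    * by apply: outer_approx_bigcupC => n; case: (GB n).
- move=> U oU; split; [exact: open_borel|exact: open_approx|].
  pose D n := \bigcup_(y in ~` U) ball y n.+1%:R^-1.
  have oD n : open (D n) by apply: bigcup_open => y _; exact: open_mball.
  have -> : ~` U = ~` \bigcup_n ~` D n.
    apply/seteqP; split => [y Uy [n _ nD]|y nD Uy].
      by apply: nD; exists y => //; apply: ballxx.
    apply: nD; have /nbhs_ballP[d /= d0 dU] : nbhs y U by exact: open_nbhs_nbhs.
    have [n nd] : exists n : nat, n.+1%:R^-1 < d.
      exists (Num.truncn d^-1); rewrite invf_plt ?posrE//.
      exact: truncnS_gt.
    exists n => // -[z Uz zy]; apply: Uz; apply: dU.
    by apply: ball_sym; apply: le_ball zy; exact: ltW.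
  apply: outer_approx_bigcupC => n.
    by apply: borel_setC; exact: open_borel.
  by rewrite setCK; exact: open_approx.
Qed.

Lemma borel_outer_regular (x : X) (A : set X) (e : R) : borel A -> 0 < e ->
  exists U, [/\ open U, A `<=` U & (mu (U `\` A) <= e%:E)%E].
Proof.
move=> bA e0.
have en n : 0 < e / (2 ^ n.+1)%:R by rewrite divr_gt0// ltr0n expn_gt0.
have /choice[U HU] n := (outer_approx_borel x n%:R bA).1 _ (en n).
exists (\bigcup_n (U n `&` ball x n%:R)); split.
- apply: bigcup_open => n _; apply: openI; last exact: open_mball.
  by case: (HU n).
- move=> y Ay; have : [set: X] y by [].
  rewrite -(bigcup_ball_nat x) => -[n _ xy]; exists n => //; split => //.
  by case: (HU n) => _ + _; apply.
- apply: le_trans (outer_measure_bigcup_le (A := fun n => (U n `\` A) `&` ball x n%:R) (ltW e0) _).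
    apply: le_outer_measure => y [[n _ [Uy By]] nAy].
    by exists n.
  by move=> n; case: (HU n).
Qed.

(** Borel regularity gives a hull of equal measure for each bounded piece of L. The measure of a
    piece is finite, so equality of measures makes the difference null. *)
Lemma borel_hull (x : X) (L : set X) :
  measurable (L : set (caratheodory_type mu)) ->
  exists B, [/\ borel B, L `<=` B & mu (B `\` L) = 0%E].
Proof.
move=> mL; have /choice[B HB] n := mu_breg.2 (L `&` ball x n%:R).
exists (\bigcup_n B n); split.
- by apply: borel_bigcup => n; case: (HB n).
- move=> y Ly; have : [set: X] y by [].
  rewrite -(bigcup_ball_nat x) => -[n _ xy]; exists n => //.
  by case: (HB n) => _ + _; apply.
- apply/eqP; rewrite eq_le outer_measure_ge0 andbT.
  apply: (@le_trans _ _ (mu (\bigcup_n (B n `\` (L `&` ball x n%:R))))).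
    apply: le_outer_measure => y [[n _ By] nLy]; exists n => //; split => //.
    by move=> [].
  apply: outer_measure_bigcup_le => // n; rewrite mul0r.
  have [bB LB BL] := HB n.
  have mLn : measurable (L `&` ball x n%:R : set (caratheodory_type mu)).
    by apply: measurableI => //; exact: ball_caratheodory.
  have Bfin : (mu (L `&` ball x n%:R) < +oo)%E.
    by apply: le_lt_trans (mu_ball_fin x n%:R); apply: le_outer_measure => y [].
  have -> : mu (B n `\` (L `&` ball x n%:R)) =
      (mu (B n) - mu (B n `&` (L `&` ball x n%:R)))%E.
    apply: (@measureD _ (caratheodory_type mu) R mu) => //.
      exact: borel_caratheodory.
    by move: Bfin; rewrite BL.
  rewrite setIidr// -BL subee// ge0_fin_numE ?outer_measure_ge0//.
Qed.

End BorelMeasure.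

(** * Lower semicontinuous majorants by dyadic layers *)

Section VitaliCaratheodory.
Context {R : realType} {X : pmetricType R}.

(** For A n = {F > 2^n} this sum lies between F - 1 and 2 F, and it is lower semicontinuous as soon
    as every A n is open. Enlarging superlevel sets to open sets therefore yields a lower
    semicontinuous majorant. *)
Definition dyadic_layers (A : (set X)^nat) (x : X) : \bar R :=
  (\sum_(n <oo) (2 ^+ n * \1_(A n) x)%:E)%E.

Let layer_ge0 (A : (set X)^nat) x n : (0 <= (2 ^+ n * \1_(A n) x : R)%:E)%E.
Proof. by rewrite lee_fin mulr_ge0// exprn_ge0. Qed.

Lemma dyadic_layers_ge0 A x : (0 <= dyadic_layers A x)%E.
Proof. by apply: nneseries_ge0 => n _ _; exact: layer_ge0. Qed.

Lemma dyadic_layers_gt A x (a : R) : (a%:E < dyadic_layers A x)%E ->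
  exists n, a < \sum_(i < n) 2 ^+ i * \1_(A i) x.
Proof.
move=> aG; apply/not_existsP => na; move: aG; apply/negP; rewrite -leNgt.
apply: lime_le; first by apply: is_cvg_nneseries => n _ _; exact: layer_ge0.
near=> n; rewrite big_mkord sumEFin lee_fin leNgt; apply/negP; exact: na.
Unshelve. all: by end_near. Qed.

Lemma dyadic_layers_lsc A (a : R) : (forall n, open (A n)) ->
  open [set x | (a%:E < dyadic_layers A x)%E].
Proof.
move=> oA; rewrite openE => x /= /dyadic_layers_gt[n an].
have : \forall y \near x, forall i : 'I_n, (\1_(A i) x : R) <= \1_(A i) y.
  apply: filter_forall => i; have [Aix|nAix] := pselect (A i x); last first.
    by apply: nearW => y; rewrite indicE memNset.
  have : nbhs x (A i) by exact: open_nbhs_nbhs.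
  by apply: filterS => y Aiy; rewrite !indicE !mem_set.
apply: filterS => y /= H.
apply: (@lt_le_trans _ _ (\sum_(i < n) 2 ^+ i * \1_(A i) y)%:E).
  rewrite lte_fin; apply: lt_le_trans an _; apply: ler_sum => i _.
  by rewrite ler_wpM2l ?exprn_ge0.
rewrite -sumEFin -(big_mkord xpredT (fun i => (2 ^+ i * \1_(A i) y)%:E)).
by apply: nneseries_lim_ge => *; exact: layer_ge0.
Qed.

Lemma lsc_borel_fun (G : X -> \bar R) :
  (forall a : R, open [set x | (a%:E < G x)%E]) -> borel_fun G.
Proof.
move=> oG; apply: (measurability _ (ErealGenOInfty.measurableE R)).
move=> _ [_ [x ->] <-]; rewrite setTI; apply: sub_gen_smallest.
rewrite (_ : _ @^-1` _ = [set y | (x%:E < G y)%E])//.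
by apply/seteqP; split => y /=; rewrite in_itv/= andbT.
Qed.

(** The highest active layer dominates: if 2^n < F x, the layers below n add up to at most 2^n, so
    the sum up to n is at most 2 F x. *)
Lemma dyadic_layers_superlevel_le (F : X -> \bar R) x : (0 <= F x)%E ->
  (dyadic_layers (fun n => [set y | (2 ^+ n)%:E < F y]) x <= 2%:E * F x)%E.
Proof.
case E : (F x) => [r| |] // r0; last by rewrite gt0_muley ?lte_fin// leey.
pose S n := [set y | ((2 ^+ n)%:E < F y)%E].
rewrite lee_fin in r0.
have key n : (\sum_(i < n) 2 ^+ i * \1_(S i) x <= 2 ^+ n :> R) /\
    (\sum_(i < n) 2 ^+ i * \1_(S i) x <= 2 * r).
  elim: n => [|n [ih1 ih2]]; first by rewrite !big_ord0 expr0 mulr_ge0.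
  rewrite !big_ord_recr/= indicE; case: (boolP (x \in S n)) => [|_].
    by rewrite inE/S/= E lte_fin => nr; rewrite mulr1 exprS; split; lra.
  rewrite mulr0 addr0 exprS; split => //.
  have : 0 <= 2 ^+ n :> R by rewrite exprn_ge0.
  by lra.
rewrite /dyadic_layers; apply: lime_le.
  by apply: is_cvg_nneseries => n _ _; exact: (layer_ge0 S).
by near=> n; rewrite big_mkord sumEFin -EFinM lee_fin; exact: (key n).2.
Unshelve. all: by end_near. Qed.

(** If F x > 2^N, the layers 0 to N are all active and sum to 2^(N+1) - 1. Truncating F at 2^N
    permits an induction that also covers the value +oo. *)
Lemma le_dyadic_layers_superlevel (F : X -> \bar R) (A : (set X)^nat) x :
  (forall n, [set y | (2 ^+ n)%:E < F y]%E `<=` A n) ->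
  (F x <= 1 + dyadic_layers A x)%E.
Proof.
move=> FA.
have key N : (mine (F x) (2 ^+ N)%:E <= 1 + dyadic_layers A x)%E.
  apply: (@le_trans _ _ (1 + \sum_(i < N) (2 ^+ i * \1_(A i) x)%:E)%E); last first.
    rewrite leeD2l// -(big_mkord xpredT (fun i => (2 ^+ i * \1_(A i) x)%:E)).
    by apply: nneseries_lim_ge => *; exact: layer_ge0.
  elim: N => [|N ih].
    by rewrite big_ord0 adde0 expr0 ge_min lexx orbT.
  have [FN|NF] := leP (F x) (2 ^+ N)%:E.
    apply: (@le_trans _ _ (mine (F x) (2 ^+ N)%:E)).
      by rewrite (min_idPl FN) ge_min lexx.
    by apply: le_trans ih _; rewrite leeD2l// big_ord_recr/= leeDl.
  rewrite ge_min; apply/orP; right; rewrite sumEFin -EFinD lee_fin.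
  have -> : \sum_(i < N.+1) 2 ^+ i * \1_(A i) x = \sum_(i < N.+1) 2 ^+ i :> R.
    apply: eq_bigr => i _; rewrite indicE mem_set ?mulr1//.
    apply: FA => /=; apply: le_lt_trans NF; rewrite lee_fin.
    by rewrite ler_eXn2l ?ltr1n// -ltnS.
  have := subrX1 (2 : R) N.+1; rewrite (_ : 2 - 1 = 1 :> R); last by lra.
  by rewrite mul1r => <-; rewrite addrC subrK.
have large (r : R) : exists N, r <= 2 ^+ N.
  exists (Num.truncn `|r|).+1.
  apply: le_trans (ler_norm r) _; apply: le_trans (ltW (truncnS_gt _)) _.
  by rewrite -natrX ler_nat ltnW// ltn_expl.
case: (F x) key => [r| |] key; last by rewrite leNye.
  have [N rN] := large r.
  by have := key N; rewrite (min_idPl _)// lee_fin.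
rewrite leye_eq; apply/eqP/eq_infty => r; have [N rN] := large r.
apply: le_trans (key N); rewrite (min_idPr _) ?leey//.
Qed.

End VitaliCaratheodory.

Section VitaliCaratheodoryMeasure.
Context {R : realType} {X : pmetricType R}.
Variable mu : {outer_measure set X -> \bar R}.
Hypothesis mu_breg : borel_regular mu.
Hypothesis mu_ball_fin : forall (x : X) (r : R), (mu (ball x r) < +oo)%E.

Lemma integral_dyadic_layers (A : (set X)^nat) :
  (forall n, measurable (A n : set (caratheodory_type mu))) ->
  (mu_integral mu setT (dyadic_layers A) = \sum_(n <oo) (2 ^+ n)%:E * mu (A n))%E.
Proof.
move=> mA; rewrite /mu_integral /dyadic_layers integral_nneseries//.
- apply: eq_eseriesr => n _.
  rewrite (@integralZl_indic _ (caratheodory_type mu) R mu setT _ (fun=> A n))//.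
    by rewrite integral_indic// setIT.
  by rewrite ltNge exprn_ge0.
- by move=> n; apply/measurable_EFinP; apply: measurable_funM.
Qed.

Lemma lsc_majorant (x0 : X) (F : X -> \bar R) :
  borel_fun F -> (forall x, 0 <= F x)%E -> (mu_integral mu setT F < +oo)%E ->
  exists G : X -> \bar R, [/\ forall x, (0 <= G x)%E,
    forall a : R, open [set x | (a%:E < G x)%E],
    forall x, (F x <= 1 + G x)%E & (mu_integral mu setT G < +oo)%E].
Proof.
move=> mF F0 Fint.
pose S n := [set x | ((2 ^+ n)%:E < F x)%E].
have bS n : borel (S n).
  have := mF measurableT _ (emeasurable_itv `](2 ^+ n)%:E, +oo[%E).
  rewrite setTI (_ : _ @^-1` _ = S n)//.
  by apply/seteqP; split => x /=; rewrite in_itv/= andbT.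
(* The excess of [A n] over [S n] enters the integral with weight 2^n; with this bound the excesses
   contribute at most 1 in all. *)
have e0 n : 0 < (2 ^+ n * (2 ^ n.+1)%:R : R)^-1.
  by rewrite invr_gt0 mulr_gt0 ?exprn_gt0// ltr0n expn_gt0.
have /choice[A HA] n := borel_outer_regular mu_breg mu_ball_fin x0 (bS n) (e0 n).
have mS n : measurable (S n : set (caratheodory_type mu)) by exact: borel_caratheodory.
have mA n : measurable (A n : set (caratheodory_type mu)).
  by apply: open_caratheodory => //; case: (HA n).
exists (dyadic_layers A); split.
- exact: dyadic_layers_ge0.
- by move=> a; apply: dyadic_layers_lsc => n; case: (HA n).
- by move=> x; apply: le_dyadic_layers_superlevel => n; case: (HA n).
- rewrite integral_dyadic_layers//.
  have lay n : ((2 ^+ n)%:E * mu (A n) <= (2 ^+ n)%:E * mu (S n) + (1 / (2 ^ n.+1)%:R)%:E)%E.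
    have [_ SA AS] := HA n.
    apply: (@le_trans _ _ ((2 ^+ n)%:E * (mu (S n) + mu (A n `\` S n)))%E).
      apply: lee_wpmul2l; first by rewrite lee_fin exprn_ge0.
      apply: le_trans (outer_measureU2 _ _ _); apply: le_outer_measure => x Ax.
      by have [Sx|nSx] := pselect (S n x); [left|right].
    rewrite ge0_muleDr ?outer_measure_ge0// leeD2l//.
    apply: le_trans (lee_wpmul2l _ AS) _; first by rewrite lee_fin exprn_ge0.
    by rewrite -EFinM lee_fin invfM mulrA divff ?mul1r.
  have St0 n : (0 <= (2 ^+ n)%:E * mu (S n))%E.
    by rewrite mule_ge0 ?outer_measure_ge0// lee_fin exprn_ge0.
  apply: (@le_lt_trans _ _ (\sum_(n <oo) ((2 ^+ n)%:E * mu (S n)) + 1)%E).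
    apply: le_trans (epsilon_trick xpredT St0 ler01).
    apply: lee_nneseries => // n _.
    by rewrite mule_ge0 ?outer_measure_ge0// lee_fin exprn_ge0.
  apply: lte_add_pinfty; last by rewrite ltry.
  rewrite -integral_dyadic_layers//.
  apply: (@le_lt_trans _ _ (2%:E * mu_integral mu setT F)%E); last first.
    by rewrite lte_mul_pinfty// lee_fin.
  have mFc := borel_fun_caratheodory mu_breg mF.
  rewrite /mu_integral -ge0_integralZl_EFin//.
  apply: ge0_le_integral => //.
  + by move=> x _; exact: dyadic_layers_ge0.
  + apply: ge0_emeasurable_sum => // n _.
    by apply/measurable_EFinP; apply: measurable_funM.
  + exact: measurable_funeM.
  + by move=> x _; exact: dyadic_layers_superlevel_le.
Qed.

End VitaliCaratheodoryMeasure.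

(** * Separated sets and properness *)

Section SeparatedSets.
Context {R : realType} {X : pmetricType R}.

Definition separated (r : R) (s : seq X) := pairwise (fun x y => r <= mdist x y) s.

Lemma maximal_separated (r : R) (F : set X) (N : nat) : 0 < r ->
  (forall s, separated r s -> (forall x, x \in s -> F x) -> (size s <= N)%N) ->
  exists s, [/\ separated r s, forall x, x \in s -> F x &
    F `<=` [set y | exists2 x, x \in s & mdist x y < r]].
Proof.
move=> r0 FN.
pose P n := `[< exists s, [/\ separated r s, forall x, x \in s -> F x & size s = n] >].
have exP : exists n, P n by exists 0%N; apply/asboolP; exists [::]; split.
have Pub n : P n -> (n <= N)%N.
  by move=> /asboolP[s [ss sF <-]]; exact: FN.
case: (ex_maxnP exP Pub) => n /asboolP[s [ss sF sn]] nmax.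
exists s; split => // y Fy; apply/not_exists2P => H.
have : P n.+1.
  apply/asboolP; exists (y :: s); split => /=; last by rewrite sn.
    rewrite /separated /= -/(separated r s) ss andbT; apply/allP => x xs.
    by case: (H x) => // /negP; rewrite -leNgt metric_sym.
  by move=> x; rewrite inE => /predU1P[->//|/sF].
by move=> /nmax; rewrite ltnn.
Qed.

(** The balls of radius r/2 about separated points are disjoint and are removed from A one after the
    other. [M] is the class of sets from which this removal is superadditive: it is everything for
    [mu], and the measurable sets for an integral. *)
Lemma packing_le (M : set (set X)) (nu : set X -> \bar R) (r th : R) (A : set X)
    (s : seq X) :
  (forall B, (0 <= nu B)%E) ->
  (forall B C, M B -> open C -> C `<=` B ->
    M (B `\` C) /\ (nu C + nu (B `\` C) <= nu B)%E) ->
  (forall x : X, open (ball x (r / 2))) ->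
  separated r s -> (forall x, x \in s -> (th%:E <= nu (ball x (r / 2)))%E) ->
  M A -> (forall x, x \in s -> ball x (r / 2) `<=` A) ->
  (((size s)%:R * th)%:E <= nu A)%E.
Proof.
move=> nu0 nuD bo; elim: s A => [|x s ih] A /=; first by rewrite mul0r.
move=> /andP[/allP xs ss] th_s MA sA.
have [MD le] := nuD A (ball x (r / 2)) MA (bo x) (sA x (mem_head _ _)).
apply: le_trans le.
rewrite mulrS mulrDl mul1r EFinD; apply: leeD; first exact/th_s/mem_head.
apply: ih => // y ys; first by apply: th_s; rewrite inE ys orbT.
move=> z; rewrite ballEmdist /= => yz; split.
  by apply: (sA y); rewrite ?inE ?ys ?orbT// ballEmdist.
rewrite ballEmdist/= => xz; have := xs y ys.
have := metric_triangle x z y; rewrite (metric_sym z y) => ? ?.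
by clear nu0; lra.
Qed.

Lemma ultra_fmap T U (f : T -> U) (F : set_system T) :
  UltraFilter F -> UltraFilter (f @ F).
Proof.
move=> FU; split; first exact: fmap_proper_filter.
move=> G GF FG; apply/seteqP; split => // A GA.
have [//|nFA] := in_ultra_setVsetC (f @^-1` A) FU.
have GnA : G (~` A) by exact: FG.
have : G set0 by rewrite -(setICr A); exact: filterI.
by move/filter_not_empty.
Qed.

Lemma ultra_cover_seq (F : set_system X) (s : seq X) (r : R) (A : set X) :
  UltraFilter F -> F A -> A `<=` [set y | exists2 x, x \in s & mdist x y < r] ->
  exists x, F (ball x r).
Proof.
move=> FU; elim: s A => [|x s ih] A FA As.
  by exfalso; apply: (@filter_not_empty _ F); apply: filterS FA => y /As[].
have [|FC] := in_ultra_setVsetC (ball x r) FU; first by exists x.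
apply: (ih (A `&` ~` ball x r)); first exact: filterI.
move=> y [/As[z]]; rewrite inE => /predU1P[->|zs zy].
  by rewrite ballEmdist.
by move=> _; exists z.
Qed.

End SeparatedSets.

(** * Convergence of bounded ultrafilters and integrability on balls *)

Section Proper.
Context {R : realType} {X : pmetricType R}.
Variable mu : {outer_measure set X -> \bar R}.
Variable Q : R.
Hypothesis mu_breg : borel_regular mu.
Hypothesis X_complete : complete_space X.
Hypothesis mu_regular : ahlfors_regular mu Q.

Lemma ahlfors_ball_fin (x : X) (r : R) : (mu (ball x r) < +oo)%E.
Proof.
have [C C1 HC] := mu_regular.
have r0 : 0 < Num.max r 1 by rewrite lt_max ltr01 orbT.
have /andP[_ H] := HC x _ r0.
apply: le_lt_trans (le_lt_trans H (ltry _)).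
by apply: le_outer_measure; apply: le_ball; rewrite le_max lexx.
Qed.

Lemma mu_open_setD (B C : set X) : open C -> C `<=` B ->
  (mu C + mu (B `\` C) <= mu B)%E.
Proof.
move=> /(open_caratheodory mu_breg) mC CB.
by rewrite [leRHS](mC B) (setIidr CB) setDE.
Qed.

Lemma bounded_totally_bounded (z : X) (rho r : R) : 0 < r ->
  exists s : seq X, ball z rho `<=` [set y | exists2 x, x \in s & mdist x y < r].
Proof.
move=> r0; have [C C1 HC] := mu_regular.
have r20 : 0 < r / 2 by rewrite divr_gt0.
pose A := ball z (rho + r / 2); pose th := (r / 2) `^ Q / C.
have C0 : 0 < C by rewrite (lt_le_trans ltr01).
have th0 : 0 < th by rewrite divr_gt0// powR_gt0.
have [|s [_ _ Fs]] := @maximal_separated R X r (ball z rho) (Num.truncn (fine (mu A) / th)).+1 r0.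
  move=> s ss sF; have Afin : mu A \is a fin_num.
    by rewrite ge0_fin_numE ?outer_measure_ge0// ahlfors_ball_fin.
  have : (((size s)%:R * th)%:E <= mu A)%E.
    apply: (@packing_le _ _ setT mu r) => //.
    - by move=> B D _ oD DB; split => //; exact: mu_open_setD.
    - by move=> x; exact: open_mball.
    - by move=> x _; have /andP[] := HC x _ r20.
    - move=> x /sF; rewrite /A !ballEmdist /= => zx y; rewrite /= => xy.
      by have := metric_triangle z x y => ?; lra.
  rewrite -(fineK Afin) lee_fin -ler_pdivlMr// => H.
  by rewrite -(ler_nat R); apply: le_trans H (ltW (truncnS_gt _)).
by exists s.
Qed.

(** Total boundedness puts a ball of radius 1/(n+1) into the ultrafilter for each n. Any two of
    these balls meet, so their centres form a Cauchy sequence, and F converges to its limit. *)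
Lemma ultra_bounded_cvg (F : set_system X) (z : X) (rho : R) :
  UltraFilter F -> F (ball z rho) -> exists l : X, F --> l.
Proof.
move=> FU Fz.
have n0 n : 0 < n.+1%:R^-1 :> R by rewrite invr_gt0 ltr0n.
have : forall n : nat, exists y, F (ball y n.+1%:R^-1).
  move=> n; have [s sz] := bounded_totally_bounded z rho (n0 n).
  exact: ultra_cover_seq FU Fz sz.
move=> /choice[y Fy].
have small (e : R) : 0 < e -> exists N : nat, forall n, (N <= n)%N -> n.+1%:R^-1 < e.
  move=> e0; exists (Num.truncn e^-1) => n Nn; rewrite invf_plt ?posrE//.
  by apply: lt_le_trans (truncnS_gt _) _; rewrite ler_nat.
have yy n m : mdist (y n) (y m) < n.+1%:R^-1 + m.+1%:R^-1.
  have [w] := filter_ex (filterI (Fy n) (Fy m)).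
  rewrite !ballEmdist /= => -[nw mw]; have := metric_triangle (y n) w (y m).
  by rewrite (metric_sym w) => /le_lt_trans; apply; exact: ltrD.
have [l yl] : exists l : X, y @ \oo --> l.
  apply: X_complete; apply/cauchy_ballP => e e0.
  have [N HN] := small (e / 2) (divr_gt0 e0 (ltr0Sn _ _)).
  pose T := [set y n | n in [set n | (N <= n)%N]].
  exists (T, T) => /=.
    by split; exists N => // n Nn; exists n.
  move=> [_ _] /= [[n Nn <-] [m Nm <-]]; rewrite ballEmdist/=; apply: lt_trans (yy n m) _.
  by rewrite (splitr e) ltrD// HN.
exists l; apply/cvg_ballP => e e0.
have e20 : 0 < e / 2 by rewrite divr_gt0.
have [N HN] := small (e / 2) e20.
have /cvg_ballP/(_ _ e20)[M _ HM] := yl.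
have := HM (maxn N M) (leq_maxr _ _).
have := HN (maxn N M) (leq_maxl _ _).
set n := maxn N M => ne; rewrite ballEmdist /= => ly.
apply: filterS (Fy n) => w; rewrite !ballEmdist /= => yw.
apply: le_lt_trans (metric_triangle l (y n) w) _.
by rewrite (splitr e) ltrD// (lt_trans yw).
Qed.

(** Compactness in ideal form. The sets contained in a set of integrability form an ideal. If the
    ball were not in it, the complements within the ball would generate a proper filter; a finer
    ultrafilter converges to some l, hence contains a small ball about l, which lies in the
    ideal. *)
Lemma loc_integrable_ball (u : X -> R) : loc_integrable mu u ->
  forall (x : X) (r : R), mu_integrable mu (ball x r) u.
Proof.
move=> lu z rho.
pose I := [set A : set X | exists B : set X, [/\ A `<=` B,
  measurable (B : set (caratheodory_type mu)) & mu_integrable mu B u]].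
have IU A B : I A -> I B -> I (A `|` B).
  move=> [A' [AA mA /integrableP[mfA iA]]] [B' [BB mB /integrableP[mfB iB]]].
  have mAB : measurable (A' `|` B' : set (caratheodory_type mu)) by exact: measurableU.
  exists (A' `|` B'); split => //; first exact: setUSS.
  have mf : measurable_fun (A' `|` B' : set (caratheodory_type mu)) (EFin \o u).
    by apply/measurable_funU.
  apply/integrableP; split => //.
  have E : A' `|` B' = A' `|` (B' `\` A').
    apply/seteqP; split => x; last by move=> [|[]]; [left|right].
    by have [?|?] := pselect (A' x); [left|move=> []//; right].
  rewrite E ge0_integral_setU//.
  - apply: lte_add_pinfty => //; apply: le_lt_trans iB.
    apply: ge0_subset_integral => //; first exact: measurableD.
    exact: measurableT_comp.
  - exact: measurableD.
  - by rewrite -E; exact: measurableT_comp.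
  - by apply/disj_setPRL => x [].
have [[B [zB mB iB]]|nI] := pselect (I (ball z rho)).
  by apply: integrableS iB => //; exact: ball_caratheodory.
exfalso.
pose F := [set P : set X | exists2 A, I A & ball z rho `\` A `<=` P].
have FF : ProperFilter F.
  split.
  - move=> [A IA zA]; apply: nI; have [B [AB mB iB]] := IA.
    exists B; split => // x zx; apply: AB; apply: contrapT => nA.
    exact: (zA x).
  - split.
    + exists set0 => //; exists set0; split => //.
      apply/integrableP; split; first exact: measurable_fun_set0.
      by rewrite integral_set0 ltry.
    + move=> P S [A IA AP] [B IB BS]; exists (A `|` B); first exact: IU.
      move=> x [zx nAB]; split; [apply: AP|apply: BS]; split => // ?; apply: nAB; by [left|right].
    + by move=> P S PS [A IA AP]; exists A => // x /AP /PS.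
have [G [GU FG]] := ultraFilterLemma FF.
have I0 : I set0.
  exists set0; split => //; apply/integrableP; split; first exact: measurable_fun_set0.
  by rewrite integral_set0 ltry.
have Gz : G (ball z rho).
  by apply: FG; exists set0 => // x [].
have [l Gl] := ultra_bounded_cvg GU Gz.
have [r r0 ir] := lu l.
have Gr : G (ball l r) by apply: Gl; exact: nbhsx_ballx.
have Gnr : G (~` ball l r).
  apply: FG; exists (ball l r); last by move=> x [].
  by exists (ball l r); split => //; exact: ball_caratheodory.
have : G set0 by rewrite -(setICr (ball l r)); exact: filterI.
exact: filter_not_empty.
Qed.

End Proper.

(** * Truncation, medians and averages *)

Section Truncation.
Context {R : realType}.

Definition clip (s t x : R) : R := Num.max s (Num.min x t).

Lemma clip_between (s t x : R) : s <= t -> s <= clip s t x <= t.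
Proof.
by move=> st; rewrite /clip le_max lexx ge_max st ge_min lexx orbT.
Qed.

Lemma clipN (s t x : R) : s <= t -> clip (- t) (- s) (- x) = - clip s t x.
Proof.
by move=> st; rewrite /clip; case: (leP x t) => ?; case: (leP (- x) (- s)) => ?;
   case: (leP s x) => ?; case: (leP s t) => ?; case: (leP (- t) (- x)) => ?;
   case: (leP (- t) (- s)) => ?; lra.
Qed.

(** [q] is the first time at which h reaches b, and [p] the last time before [q] at which h is at
    most a. Strictly between them a < h < b, and [a, b] lies in [s, t]. *)
Let crossing_up (h : R -> R) (l s t : R) : 0 <= l -> s < t ->
  (forall p e : R, 0 <= p -> p <= l -> 0 < e -> exists2 d : R, 0 < d &
     forall q : R, 0 <= q -> q <= l -> `|q - p| < d -> `|h q - h p| < e) ->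
  clip s t (h 0) < clip s t (h l) ->
  exists p q : R, [/\ 0 <= p, p <= q, q <= l,
    clip s t (h l) - clip s t (h 0) <= h q - h p &
    forall r : R, p < r -> r < q -> s < h r /\ h r < t].
Proof.
move=> l0 st hcont; set a := clip s t (h 0); set b := clip s t (h l) => ab.
have /andP[sa at_] : s <= a <= t by apply: clip_between; exact: ltW.
have /andP[sb bt] : s <= b <= t by apply: clip_between; exact: ltW.
have h0a : h 0 <= a.
  move: ab bt; rewrite /a /clip; case: (leP (h 0) t) => ?; case: (leP s (h 0)) => ?; case: (leP s t) => ?; lra.
have bhl : b <= h l.
  move: ab sa; rewrite /b /clip; case: (leP (h l) t) => ?; case: (leP s (h l)) => ?; case: (leP s t) => ?; lra.
pose Sq := [set r : R | 0 <= r <= l /\ b <= h r].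
have Sql : Sq l by split; rewrite ?l0 ?lexx.
have Sqlb : lbound Sq 0 by move=> r [/andP[]].
have infq : has_inf Sq by split; [exists l|exists 0].
pose q := inf Sq.
have q0 : 0 <= q by apply: lb_le_inf => //; exists l.
have ql : q <= l by apply: ge_inf => //; exists 0.
have hq (r : R) : 0 <= r -> r < q -> h r < b.
  move=> r0 rq; rewrite ltNge; apply/negP => br; move: (rq); rewrite ltNge => /negP; apply.
  apply: ge_inf; [by exists 0|split => //].
  by rewrite r0 /= (ltW (lt_le_trans rq ql)).
have bhq : b <= h q.
  rewrite leNgt; apply/negP => hqb.
  have [d d0 Hd] := hcont q (b - h q) q0 ql (ltac:(by rewrite subr_gt0)).
  have [r [/andP[r0 rl] br] rqd] := inf_adherent d0 infq.
  have qr : q <= r by apply: ge_inf; [exists 0|split => //; rewrite r0].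
  have := Hd r r0 rl; rewrite ger0_norm ?subr_ge0// ltrBlDl => /(_ rqd).
  by move=> /ltr_normlW; lra.
pose Sp := [set r : R | 0 <= r <= q /\ h r <= a].
have Sp0 : Sp 0 by split; rewrite ?lexx.
have supp : has_sup Sp by split; [exists 0|exists q => r [/andP[]]].
pose p := sup Sp.
have pq : p <= q by apply: ge_sup; [exists 0|move=> r [/andP[]]].
have p0 : 0 <= p by apply: ub_le_sup => //; case: supp.
have hpa : h p <= a.
  rewrite leNgt; apply/negP => ahp.
  have [d d0 Hd] := hcont p (h p - a) p0 (le_trans pq ql) (ltac:(by rewrite subr_gt0)).
  have [r [/andP[r0 rq] ra] rpd] := sup_adherent d0 supp.
  have rp : r <= p by apply: ub_le_sup; [case: supp|split => //; rewrite r0].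
  have rpd' : `|r - p| < d by rewrite distrC ger0_norm ?subr_ge0// ltrBlDl -ltrBlDr.
  have := Hd r r0 (le_trans rq ql) rpd'.
  by rewrite distrC => /ltr_normlW; lra.
exists p, q; split => //; first lra.
move=> r pr rq; have r0 : 0 <= r by rewrite (le_trans p0)// ltW.
split; last by apply: lt_le_trans bt; exact: hq.
apply: le_lt_trans sa _; rewrite ltNge; apply/negP => hra.
move: pr; rewrite ltNge => /negP; apply; apply: ub_le_sup; first by case: supp.
by split => //; rewrite r0 ltW.
Qed.

(** The variation of the clipped function is already seen on an interval spent inside the strip,
    which is why only the gradient on the strip matters. A fall of h is a rise of -h with the levels
    -t and -s. *)
Lemma clip_crossing (h : R -> R) (l s t : R) : 0 <= l -> s < t ->
  (forall p e : R, 0 <= p -> p <= l -> 0 < e -> exists2 d : R, 0 < d &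
     forall q : R, 0 <= q -> q <= l -> `|q - p| < d -> `|h q - h p| < e) ->
  exists p q : R, [/\ 0 <= p, p <= q, q <= l,
    `|clip s t (h 0) - clip s t (h l)| <= `|h p - h q| &
    forall r : R, p < r -> r < q -> s < h r /\ h r < t].
Proof.
move=> l0 st hcont.
have [c0l|cl0|c0l] := ltgtP (clip s t (h 0)) (clip s t (h l)).
- have [p [q [p0 pq ql cpq H]]] := crossing_up l0 st hcont c0l.
  exists p, q; split => //; rewrite distrC ger0_norm ?subr_ge0 ?(ltW c0l)//.
  by apply: le_trans cpq _; rewrite distrC ler_norm.
- have [|||p [q [p0 pq ql cpq H]]] := @crossing_up (\- h) l (- t) (- s) l0.
  + by rewrite ltrN2.
  + move=> p e p0 pl e0; have [d d0 Hd] := hcont p e p0 pl e0.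
    by exists d => // q q0 ql qp; rewrite /= -opprD normrN; exact: Hd.
  + by rewrite /= !(clipN _ (ltW st)) ltrN2.
  exists p, q; split => //.
    rewrite ger0_norm ?subr_ge0 ?(ltW cl0)//.
    move: cpq; rewrite /= !(clipN _ (ltW st)) => cpq.
    by apply: le_trans (ler_norm _); lra.
  by move=> r pr rq; have := H r pr rq; rewrite /= ltrN2 ltrNl opprK => -[].
- exists 0, 0; split => //; first by rewrite c0l subrr normr0.
  by move=> r r0 /(lt_trans r0); rewrite ltxx.
Qed.

End Truncation.

(** * Absolute continuity of the integral *)

Section SmallIntegral.
Local Open Scope ereal_scope.
Context d (T : measurableType d) (R : realType) (m : {measure set T -> \bar R}).

(** By monotone convergence the truncation of F at some n loses at most e/2 of the integral. A set
    of measure at most (e/2) / (n+1) receives at most e/2 from the truncation, which is bounded by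
    n. *)
Lemma ge0_integral_uniformly_small (D : set T) (F : T -> \bar R) (e : R) :
  measurable D -> measurable_fun D F -> (forall x, D x -> 0 <= F x) ->
  \int[m]_(x in D) F x < +oo -> (0 < e)%R ->
  exists2 c : R, (0 < c)%R & forall A, measurable A -> A `<=` D ->
    m A <= c%:E -> \int[m]_(x in A) F x <= e%:E.
Proof.
move=> mD mF F0 Fint e0; have e20 : (0 < e / 2)%R by rewrite divr_gt0.
pose Fn (n : nat) x := mine (F x) n%:R%:E.
have mFn n : measurable_fun D (Fn n) by apply: measurable_mine.
have Fn0 n x : D x -> 0 <= Fn n x by move=> Dx; rewrite le_min F0//= lee_fin.
have FnF n x : Fn n x <= F x by rewrite ge_min lexx.
have Ffin : \int[m]_(x in D) F x \is a fin_num.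
  by rewrite ge0_fin_numE// integral_ge0.
have [n Hn] : exists n, \int[m]_(x in D) F x <= \int[m]_(x in D) Fn n x + (e / 2)%:E.
  have limF x : D x -> Fn ^~ x n @[n --> \oo] --> F x.
    move=> Dx; rewrite /Fn; case E : (F x) => [r| |].
    + apply: cvg_near_cst; exists (Num.truncn `|r|).+1 => // n /= rn.
      apply/min_idPl; rewrite lee_fin; apply: le_trans (ler_norm r) _.
      by apply: le_trans (ltW (truncnS_gt _)) _; rewrite ler_nat.
    + apply/cvgeyPge => r; exists (Num.truncn `|r|).+1 => // n /= rn.
      rewrite min_r ?leey// lee_fin; apply: le_trans (ler_norm r) _.
      by apply: le_trans (ltW (truncnS_gt _)) _; rewrite ler_nat.
    + by have := F0 x Dx; rewrite E.
  have cvgI : \int[m]_(x in D) Fn n x @[n --> \oo] --> \int[m]_(x in D) F x.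
    have -> : \int[m]_(x in D) F x = \int[m]_(x in D) limn (Fn ^~ x).
      by apply: eq_integral => x /set_mem Dx; apply/esym/cvg_lim => //; exact: limF.
    apply: cvg_monotone_convergence => // x Dx n p np.
    by rewrite /Fn le_min ge_min lexx /= ge_min lee_fin ler_nat np orbT.
  apply/not_existsP => H.
  have : \int[m]_(x in D) F x <= \int[m]_(x in D) F x - (e / 2)%:E.
    apply: cvge_to_le cvgI _; near=> n; move/negP: (H n); rewrite -ltNge => /ltW.
    by move=> ?; rewrite leeBrDr.
  move: Ffin; case: (\int[m]_(x in D) F x) => [r| |]// _.
  by rewrite -EFinB lee_fin leNgt ltrBlDr ltrDl e20.
have n0 : (0 < n%:R + 1 :> R)%R by rewrite ltr_wpDl.
exists (e / 2 / (n%:R + 1))%R; first by rewrite divr_gt0.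
move=> A mA AD mAc.
have mDA : measurable (D `\` A) by exact: measurableD.
have DE : D = A `|` (D `\` A) by rewrite setDUK.
have dj : [disjoint A & D `\` A] by apply/disj_setPRL => x [].
have split_int G : measurable_fun D G -> (forall x, D x -> 0 <= G x) ->
    \int[m]_(x in D) G x = \int[m]_(x in A) G x + \int[m]_(x in D `\` A) G x.
  by move=> mG G0; rewrite {1}DE ge0_integral_setU// -DE.
rewrite !split_int// in Hn; last by move=> x; exact: Fn0.
have DAF : \int[m]_(x in D `\` A) Fn n x <= \int[m]_(x in D `\` A) F x.
  apply: ge0_le_integral => //; try by apply: measurable_funS mF => // x [].
  - by move=> x [Dx _]; exact: Fn0.
  - by apply: measurable_funS (mFn n) => // x [].
have DAfin : \int[m]_(x in D `\` A) F x \is a fin_num.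
  rewrite ge0_fin_numE; last by apply: integral_ge0 => x [Dx _]; exact: F0.
  by apply: le_lt_trans Fint; apply: ge0_subset_integral.
have AFn : \int[m]_(x in A) Fn n x <= (e / 2)%:E.
  apply: (@le_trans _ _ (\int[m]_(x in A) cst n%:R%:E x)).
    apply: ge0_le_integral => //.
    - by move=> x Ax; apply: Fn0; exact: AD.
    - exact: measurable_funS (mFn n).
    - by move=> x _; rewrite ge_min lexx orbT.
  rewrite integral_cst//; apply: le_trans (lee_wpmul2l _ mAc) _; first by rewrite lee_fin.
  rewrite -EFinM lee_fin mulrCA ler_piMr//; first exact: ltW.
  by rewrite ler_pdivrMr// mul1r lerDl.
rewrite -(leeD2rE _ _ DAfin); apply: le_trans Hn _.
apply: (@le_trans _ _ ((e / 2)%:E + \int[m]_(x in D `\` A) F x + (e / 2)%:E)).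
  by rewrite leeD2r// leeD.
by rewrite addeAC -EFinD -splitr.
Unshelve. all: by end_near. Qed.

End SmallIntegral.

(** * Upper gradients of truncations *)

Section TruncatedGradient.
Context {R : realType} {X : pmetricType R}.

(* The strip need not be Borel, so B stands for a Borel hull of it. The factor
   eps off B, later sent to 0, keeps the line integral infinite whenever that of
   rho is: along such a curve u need not be continuous. *)
Lemma clip_upper_gradient (u : X -> R) (rho : X -> \bar R) (s t eps : R)
    (B : set X) : s < t -> 0 < eps -> eps <= 1 -> borel B ->
  [set x | s < u x /\ u x < t] `<=` B -> upper_gradient u rho ->
  upper_gradient (clip s t \o u)
    (fun x => if x \in B then rho x else (eps%:E * rho x)%E).
Proof.
move=> st eps0 eps1 bB LB ug; have [mrho rho0 _] := ug.
set g := fun x => _.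
have mg : borel_fun g.
  apply: (@measurable_fun_ifT _ _ (g_sigma_algebraType (@open X))) => //.
    apply: (@measurable_fun_bool _ (g_sigma_algebraType (@open X)) _ _ true).
    rewrite setTI (_ : _ @^-1` _ = B)//.
    by apply/seteqP; split => x /=; [move=> /set_mem|move=> /mem_set].
  exact: measurable_funeM.
have g0 x : (0 <= g x)%E.
  by rewrite /g; case: ifP => // _; rewrite mule_ge0// lee_fin ltW.
split => // c a b hc; rewrite /line_integral.
have ab : a <= b by case: hc.
set l := fine _; set y := arc_length_param c a b.
have l0 : 0 <= l by rewrite fine_ge0// curve_length_ge0.
have yl p q : 0 <= p -> p <= q -> q <= l -> mdist (y p) (y q) <= q - p.
  exact: arc_length_param_lip.
have <- : y 0 = c a by rewrite /y -(arc_length0 hc) arc_length_paramK.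
have <- : y l = c b by rewrite /y arc_length_paramK.
have mF : measurable_fun `[0, l] (rho \o y) by exact: lipschitz_borel_comp.
have mG : measurable_fun `[0, l] (g \o y) by exact: lipschitz_borel_comp.
have [Foo|Ffin] := leP +oo%E (\int[lebesgue_measure]_(r in `[0%R, l]) rho (y r))%E.
  apply: (@le_trans _ _ +oo%E); first by rewrite leey.
  rewrite -(@gt0_muley _ eps%:E) ?lte_fin//.
  apply: (@le_trans _ _ (eps%:E * \int[lebesgue_measure]_(r in `[0%R, l]) rho (y r))%E).
    by apply: lee_wpmul2l => //; rewrite lee_fin ltW.
  rewrite -ge0_integralZl_EFin ?(ltW eps0)//.
  apply: ge0_le_integral => //.
  - by move=> r _; rewrite mule_ge0// lee_fin ltW.
  - exact: measurable_funeM.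
  - move=> r _; rewrite /g; case: ifP => // _.
    by rewrite -[leRHS]mul1e; apply: lee_wpmul2r.
have sub p q : 0 <= p -> q <= l -> `[p, q]%classic `<=` `[0, l]%classic.
  move=> p0 ql r /=; rewrite !in_itv/= => /andP[pr rq].
  by rewrite (le_trans p0)//= (le_trans rq).
have uy p q : 0 <= p -> p <= q -> q <= l ->
    (`|u (y p) - u (y q)|%:E <= \int[lebesgue_measure]_(r in `[p, q]) rho (y r))%E.
  exact: upper_gradient_arc.
(* Here the line integral of [rho] is finite, so its absolute continuity makes [u \o y] continuous.
   On ]p, q[ the curve lies in the strip, where the new gradient equals [rho]. *)
have [|p [q [p0 pq ql pqle pqst]]] := @clip_crossing R (u \o y) l s t l0 st.
  move=> p e p0 pl e0; have e20 : 0 < e / 2 by rewrite divr_gt0.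
  have [|||||d d0 Hd] := @ge0_integral_uniformly_small _ _ R lebesgue_measure `[0, l] (rho \o y) (e / 2) => //.
    by move=> r _; exact: rho0.
  have Hd' p' q' : 0 <= p' -> p' <= q' -> q' <= l -> q' - p' < d ->
      `|u (y p') - u (y q')| < e.
    move=> p0' pq' ql' pqd.
    apply: (@le_lt_trans _ _ (e / 2)); last by rewrite ltr_pdivrMr// ltr_pMr// ltr1n.
    rewrite -lee_fin; apply: le_trans (uy _ _ p0' pq' ql') _.
    apply: Hd => //; first exact: sub.
    rewrite /= lebesgue_measure_itv/=; case: ifP => _; last by rewrite lee_fin ltW.
    by rewrite -EFinB lee_fin ltW.
  exists d => // q q0 ql qpd.
  have [pq|/ltW qp] := leP p q.
    by rewrite distrC; apply: Hd' => //; exact: le_lt_trans (ler_norm _) qpd.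
  apply: Hd' => //; rewrite distrC in qpd; exact: le_lt_trans (ler_norm _) qpd.
apply: (@le_trans _ _ `|u (y p) - u (y q)|%:E); first by rewrite lee_fin.
apply: le_trans (uy _ _ p0 pq ql) _.
have mFpq : measurable_fun `]p, q[ (rho \o y).
  apply: measurable_funS mF => //; apply: subset_trans (sub p q p0 ql).
  by move=> r /=; rewrite !in_itv/= => /andP[/ltW-> /ltW->].
rewrite (integral_itv_bndoo _ _ mFpq).
apply: (@le_trans _ _ (\int[lebesgue_measure]_(r in `]p, q[) g (y r))%E).
  rewrite le_eqVlt; apply/orP; left; apply/eqP; apply: eq_integral => r.
  rewrite inE /= in_itv/= => /andP[pr rq]; rewrite /g ifT// inE.
  by apply: LB; exact: pqst.
apply: ge0_subset_integral => //.
apply: subset_trans (sub p q p0 ql).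
by move=> r /=; rewrite !in_itv/= => /andP[/ltW-> /ltW->].
Qed.

End TruncatedGradient.

(** * The Poincare inequality for truncations *)

Section Oscillation.
Context {R : realType} {X : pmetricType R}.
Variable mu : {outer_measure set X -> \bar R}.
Variable Q : R.
Hypothesis Q_gt1 : 1 < Q.
Hypothesis mu_breg : borel_regular mu.
Hypothesis X_complete : complete_space X.
Hypothesis mu_regular : ahlfors_regular mu Q.
Hypothesis mu_poincare : poincare_inequality mu Q.

Let Q0 : 0 < Q. Proof. exact: lt_trans Q_gt1. Qed.

Lemma ahlfors_fine : exists2 C : R, 1 <= C & forall (x : X) (r : R), 0 < r ->
  r `^ Q / C <= fine (mu (ball x r)) <= C * r `^ Q.
Proof.
have [C C1 HC] := mu_regular; exists C => // x r r0.
have := HC x r r0; rewrite -!lee_fin fineK//.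
by rewrite ge0_fin_numE ?outer_measure_ge0// (ahlfors_ball_fin mu_regular).
Qed.

Lemma mu_ballE (x : X) (r : R) : mu (ball x r) = (fine (mu (ball x r)))%:E.
Proof.
by rewrite fineK// ge0_fin_numE ?outer_measure_ge0// (ahlfors_ball_fin mu_regular).
Qed.

Lemma fine_mu_ball_gt0 (x : X) (r : R) : 0 < r -> 0 < fine (mu (ball x r)).
Proof.
move=> r0; have [C C1 HC] := ahlfors_fine; have /andP[+ _] := HC x r r0.
by apply: lt_le_trans; rewrite divr_gt0 ?powR_gt0// (lt_le_trans _ C1).
Qed.

(** Ahlfors regularity makes the measure of B(x, lam r) to the power -1/Q cancel the factor r,
    because the exponent of the inequality equals the dimension. The mean oscillation is thus
    bounded by the energy alone, uniformly in r. *)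
Lemma poincare_ball : exists C lam : R, [/\ 0 <= C, 1 <= lam &
  forall (u : X -> R) (rho : X -> \bar R),
    (forall (x : X) (r : R), 0 < r -> mu_integrable mu (ball x r) u) ->
    upper_gradient u rho -> forall (x : X) (r E : R), 0 < r -> 0 <= E ->
    (mu_integral mu (ball x (lam * r)) (fun y => rho y `^ Q) <= E%:E)%E ->
    (mu_integral mu (ball x r) (fun y => `|u y - ball_mean mu u x r|%:E)
      <= (C * E `^ Q^-1 * fine (mu (ball x r)))%:E)%E ].
Proof.
have [_ [Cp [lam [Cp0 lam1 HP]]]] := mu_poincare.
have [CA CA1 HA] := ahlfors_fine.
have CA0 : 0 < CA by exact: lt_le_trans CA1.
exists (Cp * CA `^ Q^-1), lam; split => //; first by rewrite mulr_ge0 ?powR_ge0 ?ltW.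
move=> u rho uint ug x r E r0 E0 rhoE.
have lam0 : 0 < lam by exact: lt_le_trans lam1.
have lr0 : 0 < lam * r by rewrite mulr_gt0.
have := HP u rho uint ug x r r0.
set I1 := mu_integral _ _ _; set I2 := mu_integral _ _ _ in rhoE *.
have m0 := fine_mu_ball_gt0 x r0; have m0' := fine_mu_ball_gt0 x lr0.
rewrite (mu_ballE x r) (mu_ballE x (lam * r)); set m := fine _ in m0 *; set m' := fine _ in m0' *.
rewrite !inver !gt_eqF// => H.
rewrite mulrC EFinM -lee_pdivrMl//; apply: le_trans H _.
have mV0 : 0 <= m'^-1 by rewrite invr_ge0 ltW.
have lrQ0 : 0 < (lam * r) `^ Q by rewrite powR_gt0.
have CAl : 0 <= CA / (lam * r) `^ Q by rewrite divr_ge0// ltW.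
have Cpr : 0 <= Cp * r by rewrite mulr_ge0// ltW.
have rle : (m'^-1 * E) `^ Q^-1 <= (CA / (lam * r) `^ Q * E) `^ Q^-1.
  apply: ge0_ler_powR; rewrite ?nnegrE ?invr_ge0 ?(mulr_ge0 mV0) ?(mulr_ge0 CAl)//.
    exact: ltW.
  apply: ler_wpM2r => //; rewrite -[leRHS]invrK lef_pV2 ?posrE//.
    by rewrite invfM invrK mulrC; have /andP[] := HA x (lam * r) lr0.
  by rewrite invr_gt0 divr_gt0.
apply: (@le_trans _ _ ((Cp * r)%:E * ((m'^-1 * E) `^ Q^-1)%:E)%E).
  apply: lee_wpmul2l; first by rewrite lee_fin.
  rewrite -poweR_EFin; apply: gt0_ler_poweR.
  - by rewrite invr_ge0 ltW.
  - rewrite in_itv/= leey andbT mule_ge0//.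
    by apply: integral_ge0 => y _; exact: poweR_ge0.
  - by rewrite in_itv/= leey andbT lee_fin mulr_ge0.
  - by rewrite EFinM; apply: lee_wpmul2l.
rewrite -EFinM lee_fin.
apply: le_trans (ler_wpM2l Cpr rle) _.
have -> : (CA / (lam * r) `^ Q * E) `^ Q^-1 = CA `^ Q^-1 / (lam * r) * E `^ Q^-1.
  rewrite powRM// powRM ?(ltW CA0)//; last by rewrite invr_ge0 ltW.
  rewrite -powRN -powRrM mulNr mulfV ?gt_eqF// powR_inv1//.
  exact: ltW.
rewrite mulrA ler_wpM2r ?powR_ge0//.
have -> : Cp * r * (CA `^ Q^-1 / (lam * r)) = Cp * CA `^ Q^-1 / lam.
  by field; rewrite !gt_eqF.
rewrite ler_pdivrMr// ler_peMr// mulr_ge0 ?powR_ge0//.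
exact: ltW.
Qed.

Local Notation C := (caratheodory_type mu).
Let m : {measure set C -> \bar R} := mu.

Lemma measurable_ball (x : X) (r : R) : measurable (ball x r : set C).
Proof. exact: ball_caratheodory. Qed.
Hint Resolve measurable_ball : core.

Lemma ball_integrable_measurable (u : X -> R) :
  (forall (x : X) (r : R), 0 < r -> mu_integrable mu (ball x r) u) ->
  measurable_fun [set: C] u.
Proof.
move=> uint; have E : [set: X] = \bigcup_n ball (point : X) n.+1%:R.
  apply/seteqP; split => // y _; exists (Num.truncn (mdist point y)) => //.
  by rewrite ballEmdist /= truncnS_gt.
have E' : [set: C] = \bigcup_n ball (point : X) n.+1%:R := E.
rewrite E'; apply/measurable_fun_bigcup => n; first exact: measurable_ball.
by have /integrableP[/measurable_EFinP] := uint point n.+1%:R (ltr0Sn _ _).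
Qed.

Lemma clip_ball_integrable (u : X -> R) (s t : R) (x : X) (r : R) : s <= t ->
  measurable_fun [set: C] u -> mu_integrable mu (ball x r) (clip s t \o u).
Proof.
move=> st mu_; apply: (@measurable_bounded_integrable _ C R m) => //.
- exact: (ahlfors_ball_fin mu_regular).
- apply: measurable_maxr => //; apply: measurable_minr => //.
  exact: measurable_funTS.
- exists (`|s| + `|t|); split; first exact: num_real.
  move=> M HM y _ /=; apply: ltW; apply: le_lt_trans HM.
  have /andP[h1 h2] := clip_between (u y) st.
  have := ler_norm t; have := ler_norm (- s); rewrite normrN.
  have := normr_ge0 s; have := normr_ge0 t => *.
  by rewrite ler_norml; apply/andP; split; lra.
Qed.

Lemma measurable_poweR_borel (rho : X -> \bar R) : borel_fun rho ->
  measurable_fun [set: C] (fun y => (rho y `^ Q)%E).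
Proof.
move=> mrho; apply: (measurableT_comp (measurable_poweR _)).
exact: borel_fun_caratheodory.
Qed.

Lemma measurable_level (u : X -> R) (s t : R) : measurable_fun [set: C] u ->
  measurable ([set y | s < u y /\ u y < t] : set C).
Proof.
move=> mu_; have := mu_ measurableT _ (measurable_itv `]s, t[).
rewrite setTI (_ : _ @^-1` _ = [set y | s < u y /\ u y < t])//.
by apply/seteqP; split => y /=; rewrite in_itv/= => /andP.
Qed.

(** The Borel hull exceeds the strip by a null set, and off the hull the factor eps^Q is at most
    eps, since eps <= 1 and Q >= 1. *)
Lemma clip_gradient_energy (u : X -> R) (rho : X -> \bar R) (s t eps : R) :
  measurable_fun [set: C] u -> upper_gradient u rho ->
  s < t -> 0 < eps -> eps <= 1 ->
  exists2 g, upper_gradient (clip s t \o u) g &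
    (mu_integral mu setT (fun y => g y `^ Q) <=
     mu_integral mu [set y | s < u y /\ u y < t]%R (fun y => rho y `^ Q) +
     eps%:E * mu_integral mu setT (fun y => rho y `^ Q))%E.
Proof.
move=> mu_ ug st eps0 eps1; set L := [set y | _].
have [mrho rho0 _] := ug.
have mL : measurable (L : set C) by exact: measurable_level.
have [B [bB LB BL0]] := borel_hull mu_breg (ahlfors_ball_fin mu_regular) point mL.
have mB : measurable (B : set C) by exact: borel_caratheodory.
pose g x := if x \in B then rho x else (eps%:E * rho x)%E.
exists g; first exact: clip_upper_gradient LB ug.
have mrQ := measurable_poweR_borel mrho.
have rQ0 y : (0 <= rho y `^ Q)%E by exact: poweR_ge0.
have mrQ' D : measurable D -> measurable_fun (D : set C) (fun y => (rho y `^ Q)%E).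
  by move=> mD; apply: measurable_funTS.
have intB : mu_integral mu B (fun y => rho y `^ Q)%E = mu_integral mu L (fun y => rho y `^ Q)%E.
  rewrite /mu_integral (@ge0_negligible_integral _ C R m B (B `\` L))//.
  - by rewrite setDD setIidr.
  - exact: measurableD.
  - exact: mrQ'.
rewrite -intB.
pose f y := (rho y `^ Q)%E.
have gE y : (g y `^ Q <= (f \_ B) y + eps%:E * f y)%E.
  rewrite /g patchE; case: ifPn => yB.
    by rewrite leeDl// mule_ge0 ?rQ0// lee_fin ltW.
  (* Off B the restriction takes the default value [point], which is 0 in the extended reals. *)
  rewrite -[point]/(0%E : \bar R) add0e poweRM//; last by rewrite lee_fin ltW.
  apply: lee_wpmul2r => //; rewrite poweR_EFin lee_fin.
  by rewrite -[leRHS]powRr1 ?(ltW eps0)// ger_powR ?eps0//= ltW.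
have mfB : measurable_fun [set: C] (f \_ B).
  by apply/(measurable_restrictT _ mB); exact: mrQ'.
have fB0 y : (0 <= (f \_ B) y)%E by rewrite patchE; case: ifP => _; [exact: rQ0|exact: lexx].
apply: (@le_trans _ _ (\int[m]_y ((f \_ B) y + eps%:E * f y))%E).
  apply: ge0_le_integral => //.
  - by move=> y _; exact: poweR_ge0.
  - apply: measurable_poweR_borel.
    by have [] := clip_upper_gradient st eps0 eps1 bB LB ug.
  - by apply: emeasurable_funD => //; exact: measurable_funeM.
rewrite ge0_integralD//; last 2 first.
- by move=> y _; apply: mule_ge0; [rewrite lee_fin ltW|exact: rQ0].
- exact: measurable_funeM.
rewrite -integral_mkcond ge0_integralZl_EFin//; last exact: ltW.
by move=> y _; exact: rQ0.
Qed.

Lemma osc_lower_bound (v : X -> R) (G A1 A2 : set X) (s t c : R) :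
  measurable (G : set C) -> measurable (A1 : set C) -> measurable (A2 : set C) ->
  measurable_fun [set: C] v ->
  s < t -> A1 `<=` G -> A2 `<=` G ->
  (forall y, A1 y -> v y = t) -> (forall y, A2 y -> v y = s) ->
  (`|t - c|%:E * mu A1 + `|s - c|%:E * mu A2 <=
    mu_integral mu G (fun y => `|v y - c|%:E))%E.
Proof.
move=> mG mA1 mA2 mv st A1G A2G vt vs.
have dj : [disjoint A1 & A2].
  apply/disj_setPRL => y Ay By; have := vt y By; rewrite (vs y Ay) => ts.
  by move: st; rewrite ts ltxx.
have mf D : measurable_fun (D : set C) (fun y => `|v y - c|%:E).
  apply/measurable_EFinP; apply: measurableT_comp => //.
  by apply: measurable_funB => //; exact: measurable_funTS.
apply: (@le_trans _ _ (\int[m]_(y in A1 `|` A2) `|v y - c|%:E)%E); last first.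
  apply: ge0_subset_integral => //; first exact: measurableU.
  by rewrite subUset.
rewrite ge0_integral_setU//; apply: leeD.
- rewrite -integral_cst//; apply: ge0_le_integral => // y Ay /=.
    by rewrite lee_fin.
  by rewrite vt.
- rewrite -integral_cst//; apply: ge0_le_integral => // y Ay /=.
    by rewrite lee_fin.
  by rewrite vs.
Qed.

Lemma mu_ball_comparable : exists2 L : R, 0 < L &
  forall (z y : X) (r r' : R), 0 < r -> r <= 4 * r' ->
    fine (mu (ball z r)) <= L * fine (mu (ball y r')).
Proof.
have [CA CA1 HA] := ahlfors_fine.
have CA0 : 0 < CA by exact: lt_le_trans CA1.
exists (CA * 4 `^ Q * CA); first by rewrite !mulr_gt0// powR_gt0.
move=> z y r r' r0 rr'; have r'0 : 0 < r' by lra.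
have /andP[_ h1] := HA z r r0; have /andP[h2 _] := HA y r' r'0.
apply: le_trans h1 _; rewrite -!mulrA ler_wpM2l ?(ltW CA0)//.
apply: (@le_trans _ _ (4 `^ Q * r' `^ Q)).
  rewrite -powRM//; last exact: ltW.
  by apply: ge0_ler_powR; rewrite ?nnegrE ?(ltW Q0) ?(ltW r0)// mulr_ge0// ltW.
rewrite ler_wpM2l ?powR_ge0//.
by move: h2; rewrite ler_pdivrMr// mulrC.
Qed.

(** Let c be the mean of the clipped function over the large ball. It takes the values t and s on
    sets that each carry at least the fraction 1/(2L) of the ball, and |t - c| + |s - c| >= t - s,
    so its mean oscillation controls t - s. The gradient of [clip_gradient_energy] leaves an error
    eps I, with I the total energy, which vanishes as eps tends to 0. *)
Lemma poincare_step : exists2 K : R, 0 <= K &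
  forall (u : X -> R) (rho : X -> \bar R),
    measurable_fun [set: C] u ->
    upper_gradient u rho -> (mu_integral mu setT (fun y => rho y `^ Q) < +oo)%E ->
  forall (z y1 y2 : X) (r r1 r2 s t : R), 0 < r -> r <= 4 * r1 -> r <= 4 * r2 ->
    ball y1 r1 `<=` ball z r -> ball y2 r2 `<=` ball z r -> s < t ->
    (mu (ball y1 r1) <= 2%:E * mu (ball y1 r1 `&` [set y | t <= u y]%R))%E ->
    (mu (ball y2 r2) <= 2%:E * mu (ball y2 r2 `&` [set y | u y <= s]%R))%E ->
    (t - s) `^ Q <=
      K * fine (mu_integral mu [set y | s < u y /\ u y < t]%R (fun y => rho y `^ Q)%E).
Proof.
have [C0 [lam [C00 lam1 HP]]] := poincare_ball.
have [L L0 HL] := mu_ball_comparable.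
exists ((2 * L * C0) `^ Q); first exact: powR_ge0.
move=> u rho mu_ ug Ifin z y1 y2 r r1 r2 s t r0 rr1 rr2 sub1 sub2 st med1 med2.
pose v := clip s t \o u.
have vint (x : X) (r' : R) : 0 < r' -> mu_integrable mu (ball x r') v.
  by move=> _; apply: clip_ball_integrable => //; exact: ltW.
have mv : measurable_fun [set: C] v by exact: ball_integrable_measurable.
set I := mu_integral mu setT _ in Ifin.
have rQ0 y : (0 <= rho y `^ Q)%E by exact: poweR_ge0.
have I0 : (0 <= I)%E by apply: integral_ge0.
have mL := measurable_level s t mu_.
set EL := mu_integral mu [set y | s < u y /\ u y < t] _.
have EL0 : (0 <= EL)%E by apply: integral_ge0.
have ELfin : EL \is a fin_num.
  rewrite ge0_fin_numE//; apply: le_lt_trans Ifin; apply: ge0_subset_integral => //.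
  by apply: measurable_poweR_borel; case: ug.
have Ifn : I \is a fin_num by rewrite ge0_fin_numE.
have key (eps : R) : 0 < eps -> eps <= 1 ->
    (t - s) `^ Q <= (2 * L * C0) `^ Q * (fine EL + eps * fine I).
  move=> eps0 eps1.
  have [g ugg gE] := clip_gradient_energy mu_ ug st eps0 eps1.
  set E' := fine EL + eps * fine I.
  have E'0 : 0 <= E' by rewrite addr_ge0 ?fine_ge0// mulr_ge0 ?fine_ge0// ltW.
  have gE' : (mu_integral mu (ball z (lam * r)) (fun y => g y `^ Q) <= E'%:E)%E.
    apply: (@le_trans _ _ (mu_integral mu setT (fun y => g y `^ Q))%E).
      apply: ge0_subset_integral => //.
      + by apply: measurable_poweR_borel; case: ugg.
      + by move=> y _; exact: poweR_ge0.
    by apply: le_trans gE _; rewrite /E' EFinD EFinM !fineK.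
  have := HP v g vint ugg z r E' r0 E'0 gE'.
  set c := ball_mean mu v z r => osc.
  pose A1 := ball y1 r1 `&` [set y | t <= u y].
  pose A2 := ball y2 r2 `&` [set y | u y <= s].
  have mA1 : measurable (A1 : set C).
    apply: measurableI => //.
    have := mu_ measurableT _ (measurable_itv `[t, +oo[).
    rewrite setTI (_ : _ @^-1` _ = [set y | t <= u y])//.
    by apply/seteqP; split => y /=; rewrite in_itv/= andbT.
  have mA2 : measurable (A2 : set C).
    apply: measurableI => //.
    have := mu_ measurableT _ (measurable_itv `]-oo, s]).
    by rewrite setTI (_ : _ @^-1` _ = [set y | u y <= s]).
  have low : (`|t - c|%:E * mu A1 + `|s - c|%:E * mu A2 <=
      mu_integral mu (ball z r) (fun y => `|v y - c|%:E))%E.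
    apply: osc_lower_bound => //.
    + by move=> y [/sub1].
    + by move=> y [/sub2].
    + by move=> y [_ /= tu]; rewrite /v /clip/= (min_idPr tu) (max_idPr (ltW st)).
    + move=> y [_ /= us]; rewrite /v /clip/= (min_idPl (le_trans us (ltW st))).
      exact: (max_idPl us).
  have Afin (A : set X) (x : X) (r' : R) : A `<=` ball x r' -> mu A \is a fin_num.
    move=> Ax; rewrite ge0_fin_numE ?outer_measure_ge0//.
    apply: le_lt_trans (ahlfors_ball_fin mu_regular x r').
    exact: le_outer_measure.
  have A1fin : mu A1 \is a fin_num by apply: (Afin _ y1 r1) => y [].
  have A2fin : mu A2 \is a fin_num by apply: (Afin _ y2 r2) => y [].
  have B0 := fine_mu_ball_gt0 z r0.
  set M := fine (mu (ball z r)) in B0 *.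
  have half y' r' A : r <= 4 * r' -> mu A \is a fin_num ->
      (mu (ball y' r') <= 2%:E * mu A)%E -> M <= 2 * L * fine (mu A).
    move=> rr' Af; rewrite mu_ballE -(fineK Af) -EFinM lee_fin => h.
    apply: le_trans (HL z y' r r' r0 rr') _.
    by rewrite [2 * L]mulrC -mulrA ler_wpM2l ?(ltW L0).
  have A1L := half _ _ _ rr1 A1fin med1.
  have A2L := half _ _ _ rr2 A2fin med2.
  have := le_trans low osc.
  rewrite -(fineK A1fin) -(fineK A2fin) -!EFinM -EFinD lee_fin -/M.
  set a1 := fine (mu A1) in A1L *; set a2 := fine (mu A2) in A2L * => H.
  have tsM : (t - s) * M <= (2 * L * C0 * E' `^ Q^-1) * M.
    apply: (@le_trans _ _ (2 * L * (`|t - c| * a1 + `|s - c| * a2))).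
      apply: (@le_trans _ _ ((`|t - c| + `|s - c|) * M)).
        rewrite ler_wpM2r ?(ltW B0)//.
        by have := ler_norm (t - c); have := ler_norm (- (s - c)); rewrite normrN; lra.
      rewrite mulrDl mulrDr; apply: lerD.
        by rewrite mulrCA ler_wpM2l.
      by rewrite mulrCA ler_wpM2l.
    have -> : 2 * L * C0 * E' `^ Q^-1 * M = 2 * L * (C0 * E' `^ Q^-1 * M) by ring.
    by rewrite ler_wpM2l// mulr_ge0// ltW.
  have {tsM} ts : t - s <= 2 * L * C0 * E' `^ Q^-1 by rewrite -(ler_pM2r B0).
  have LC0 : 0 <= 2 * L * C0 by rewrite !mulr_ge0// ltW.
  apply: (@le_trans _ _ ((2 * L * C0 * E' `^ Q^-1) `^ Q)).
    by apply: ge0_ler_powR; rewrite ?nnegrE ?(ltW Q0) ?subr_ge0 ?(ltW st)// mulr_ge0// powR_ge0.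
  by rewrite powRM ?powR_ge0// -powRrM mulVf ?gt_eqF// powRr1.
apply/ler_addgt0Pr => e e0.
set K := (2 * L * C0) `^ Q in key *.
have K0 : 0 <= K by exact: powR_ge0.
have KI0 : 0 <= K * fine I by rewrite mulr_ge0// fine_ge0.
pose eps := Num.min 1 (e / (K * fine I + 1)).
have KI1 : 0 < K * fine I + 1 by rewrite ltr_wpDl.
have eps0 : 0 < eps by rewrite lt_min ltr01 divr_gt0.
have eps1 : eps <= 1 by rewrite ge_min lexx.
apply: le_trans (key eps eps0 eps1) _; rewrite mulrDr lerD2l mulrCA.
apply: (@le_trans _ _ (e / (K * fine I + 1) * (K * fine I))).
  by rewrite ler_wpM2r// ge_min lexx orbT.
by rewrite mulrAC ler_pdivrMr// ler_wpM2l ?(ltW e0)// lerDl.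
Qed.

End Oscillation.

(** * Medians and their variation along chains of balls *)

Section Medians.
Context {R : realType} {X : pmetricType R}.
Variable mu : {outer_measure set X -> \bar R}.
Variable Q : R.
Hypothesis Q_gt1 : 1 < Q.
Hypothesis mu_breg : borel_regular mu.
Hypothesis X_complete : complete_space X.
Hypothesis mu_regular : ahlfors_regular mu Q.
Hypothesis mu_poincare : poincare_inequality mu Q.
Local Notation C := (caratheodory_type mu).
Let m : {measure set C -> \bar R} := mu.
Let Q0 : 0 < Q. Proof. exact: lt_trans Q_gt1. Qed.

Definition is_median (u : X -> R) (D : set X) (a : R) :=
  (mu D <= 2%:E * mu (D `&` [set y | a <= u y]%R))%E /\
  (mu D <= 2%:E * mu (D `&` [set y | u y <= a]%R))%E.

(** The median is the supremum of the levels a for which u >= a on at least half of the ball. Both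
    halves of the claim survive the passage to the supremum by continuity from above: the intervals
    [a - 1/(n+1), a[ and ]a, a + 1/(n+1)[ decrease to the empty set. *)
Lemma median_exists (u : X -> R) (x : X) (r : R) : 0 < r ->
  measurable_fun [set: C] u -> exists a, is_median u (ball x r) a.
Proof.
move=> r0 mu_; set D := ball x r.
have D0 : 0 < fine (mu D) := fine_mu_ball_gt0 mu_regular x r0.
have mD : measurable (D : set C) by exact: ball_caratheodory.
pose nu (B : set R) := fine (mu (D `&` (u @^-1` B))).
have mB B : measurable B -> measurable (D `&` (u @^-1` B) : set C).
  by move=> /(mu_ measurableT) mB; apply: measurableI => //; rewrite -[u @^-1` B]setTI.
have nufin B : mu (D `&` (u @^-1` B)) = (nu B)%:E.
  rewrite fineK// ge0_fin_numE ?outer_measure_ge0//.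
  apply: le_lt_trans (ahlfors_ball_fin mu_regular x r).
  by apply: le_outer_measure => y [].
have nuU A B : measurable A -> measurable B -> A `&` B = set0 ->
    nu (A `|` B) = nu A + nu B.
  move=> mA mB' AB; apply: EFin_inj; rewrite EFinD -!nufin.
  have dj : (D `&` u @^-1` A) `&` (D `&` u @^-1` B) = set0.
    by rewrite -setIA [_ `&` (D `&` _)]setICA setIA -setIA -preimage_setI AB preimage_set0 !setI0.
  have H := measureU m (mB _ mA) (mB _ mB') dj.
  by rewrite preimage_setU setIUr; exact: H.
have nule A B : A `<=` B -> nu A <= nu B.
  by move=> AB; rewrite -lee_fin -!nufin; apply: le_outer_measure; apply: setIS => y /AB.
have nuT : nu setT = fine (mu D) by rewrite /nu preimage_setT setIT.
have small (J : (set R)^nat) e : (forall n, measurable (J n)) ->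
    (forall n p, (n <= p)%N -> J p `<=` J n) -> \bigcap_n J n = set0 -> 0 < e ->
    exists n, nu (J n) <= e.
  move=> mJ Jle J0 e0.
  have H : exists n, (mu (D `&` u @^-1` (J n)) <= e%:E)%E.
    apply: (@nonincreasing_measure_small _ C R mu (fun n => D `&` u @^-1` (J n))) => //.
    + by move=> n; exact: mB.
    + by have := ltry (nu (J 0%N)); rewrite -nufin; exact.
    + by move=> n p np; apply/subsetPset; apply: setIS => y /(Jle n p np).
    + rewrite -subset0 => y Jy; have : (\bigcap_n J n) (u y) by move=> n _; case: (Jy n I).
      by rewrite J0.
  by have [n Hn] := H; exists n; rewrite -lee_fin -nufin.
have mge a : measurable ([set z | a <= z] : set R).
  by rewrite (_ : [set z | _] = `[a, +oo[%classic)//; apply/seteqP; split => z /=; rewrite in_itv/= andbT.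
have mlt a : measurable ([set z | z < a] : set R).
  by rewrite (_ : [set z | _] = `]-oo, a[%classic)//; apply/seteqP; split => z /=; rewrite in_itv.
have mle a : measurable ([set z | z <= a] : set R).
  by rewrite (_ : [set z | _] = `]-oo, a]%classic)//; apply/seteqP; split => z /=; rewrite in_itv.
have natbound (z : R) : exists n : nat, z < n%:R /\ - n%:R < z.
  exists (Num.truncn `|z|).+1; have := truncnS_gt `|z|.
  by rewrite ltr_norml => /andP[].
pose c := fine (mu D).
pose S := [set a | c <= 2 * nu [set z | a <= z]].
have c0 : 0 < c by [].
have ltge a : nu [set z | a <= z] + nu [set z | z < a] = c.
  rewrite -nuU//; last first.
    by rewrite -subset0 => z [/= az]; rewrite ltNge az.
  rewrite -/c /c -nuT; congr nu; apply/seteqP; split => // z _.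
  by have [za|az] := ltP z a; [right|left].
have S0 : S !=set0.
  have [||||n Hn] := @small (fun n => [set z | z < - n%:R]) (c / 2).
  - by move=> n; exact: mlt.
  - by move=> n p np z /= zp; apply: lt_le_trans zp _; rewrite lerN2 ler_nat.
  - rewrite -subset0 => z Jz; have [n [_ nz]] := natbound z.
    by have := Jz n I; rewrite /= ltNge (ltW nz).
  - by rewrite divr_gt0.
  by exists (- n%:R); rewrite /S /=; have := ltge (- n%:R); lra.
have Sub : has_ubound S.
  have [||||n Hn] := @small (fun n => [set z | n%:R <= z]) (c / 4).
  - by move=> n; exact: mge.
  - by move=> n p np z /= zp; apply: le_trans zp; rewrite ler_nat.
  - rewrite -subset0 => z Jz; have [n [zn _]] := natbound z.
    by have := Jz n I; rewrite /= leNgt zn.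
  - by rewrite divr_gt0.
  exists n%:R => a Sa; rewrite leNgt; apply/negP => na.
  have : nu [set z | a <= z] <= nu [set z | n%:R <= z].
    by apply: nule => z /=; apply: le_trans; exact: ltW.
  by move: Sa; rewrite /S /=; lra.
have supS : has_sup S by split.
pose a := sup S; exists a.
have inv0 n : 0 < n.+1%:R^-1 :> R by rewrite invr_gt0 ltr0n.
have inv_small (e : R) : 0 < e -> exists n : nat, n.+1%:R^-1 < e.
  move=> e0; exists (Num.truncn e^-1); rewrite invf_plt ?posrE//.
  exact: truncnS_gt.
have inv_le n p : (n <= p)%N -> p.+1%:R^-1 <= n.+1%:R^-1 :> R.
  by move=> np; rewrite lef_pV2 ?posrE ?ltr0n// ler_nat.
have DE : mu D = c%:E by rewrite -[D]setIT -[in LHS](preimage_setT u) nufin nuT.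
have m1 : c <= 2 * nu [set z | a <= z].
  rewrite leNgt; apply/negP => lt.
  pose e := (c - 2 * nu [set z | a <= z]) / 4.
  have e0 : 0 < e by rewrite divr_gt0// subr_gt0.
  have mJ n : measurable ([set z | a - n.+1%:R^-1 <= z /\ z < a] : set R).
    rewrite (_ : [set z | _] = `[a - n.+1%:R^-1, a[%classic)//.
    by apply/seteqP; split => z /=; rewrite in_itv/= => /andP.
  have [||||n Hn] := @small (fun n => [set z | a - n.+1%:R^-1 <= z /\ z < a]) e => //.
  - move=> n p np z /= [h1 h2]; split => //; apply: le_trans h1.
    by rewrite lerD2l lerN2 inv_le.
  - rewrite -subset0 => z Jz; have [_ za] := Jz 0%N I.
    have [n nz] := inv_small (a - z) (ltac:(by rewrite subr_gt0)).
    by have [+ _] := Jz n I; rewrite leNgt ltrBrDl -ltrBrDr => /negP; apply.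
  have [b Sb ab] := sup_adherent (inv0 n) supS.
  have := nuU _ _ (mJ n) (mge a); rewrite -subset0 => /(_ _)/wrap[].
    by move=> z [[_ za]]; rewrite /= leNgt za.
  have : nu [set z | b <= z] <= nu ([set z | a - n.+1%:R^-1 <= z /\ z < a] `|` [set z | a <= z]).
    apply: nule => z /= bz; have [az|za] := leP a z; [by right|left; split => //].
    by apply: ltW; apply: lt_le_trans bz.
  move: Sb Hn; rewrite /S /e /=; lra.
have m2 : c <= 2 * nu [set z | z <= a].
  rewrite leNgt; apply/negP => lt.
  pose e := (c - 2 * nu [set z | z <= a]) / 4.
  have e0 : 0 < e by rewrite divr_gt0// subr_gt0.
  have mJ n : measurable ([set z | a < z /\ z < a + n.+1%:R^-1] : set R).
    rewrite (_ : [set z | _] = `]a, a + n.+1%:R^-1[%classic)//.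
    by apply/seteqP; split => z /=; rewrite in_itv/= => /andP.
  have [||||n Hn] := @small (fun n => [set z | a < z /\ z < a + n.+1%:R^-1]) e => //.
  - move=> n p np z /= [h1 h2]; split => //; apply: lt_le_trans h2 _.
    by rewrite lerD2l inv_le.
  - rewrite -subset0 => z Jz; have [az _] := Jz 0%N I.
    have [n nz] := inv_small (z - a) (ltac:(by rewrite subr_gt0)).
    by have [_] := Jz n I; rewrite ltNge -lerBrDl ltW.
  have := nuU _ _ (mJ n) (mle a); rewrite -subset0 => /(_ _)/wrap[].
    by move=> z [[+ _]]; rewrite /= ltNge => /negP.
  have : nu [set z | z < a + n.+1%:R^-1] <= nu ([set z | a < z /\ z < a + n.+1%:R^-1] `|` [set z | z <= a]).
    by apply: nule => z /= bz; have [az|za] := leP z a; [right|left].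
  have : ~ S (a + n.+1%:R^-1).
    move=> Sa; have : a + n.+1%:R^-1 <= a by apply: ub_le_sup.
    by rewrite leNgt ltrDl inv0.
  have := ltge (a + n.+1%:R^-1).
  move: Hn; rewrite /S /e /= => h1 h2 /negP; rewrite -ltNge; lra.
split.
  by rewrite DE -[X in (D `&` X)]/(u @^-1` [set z | a <= z]) nufin -EFinM lee_fin.
by rewrite DE -[X in (D `&` X)]/(u @^-1` [set z | z <= a]) nufin -EFinM lee_fin.
Qed.

(** If d > k, the last term is d (d / k)^(Q - 1). This is a linearized Hoelder inequality: each step
    of a chain can be charged separately, and k is optimized once the number of steps is known. *)
Let le_add_powR (k d : R) : 0 < k -> 0 < d -> d <= k + k `^ (1 - Q) * d `^ Q.
Proof.
move=> k0 d0; have [dk|kd] := leP d k.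
  by rewrite (le_trans dk)// lerDl mulr_ge0// powR_ge0.
apply: (@le_trans _ _ (k `^ (1 - Q) * d `^ Q)); last by rewrite lerDr ltW.
have -> : 1 - Q = - (Q - 1) by rewrite opprB.
have dQ : d `^ Q = d * d `^ (Q - 1).
  by rewrite mulr_powRB1// ltW.
rewrite powRN dQ mulrCA ler_peMr ?(ltW d0)// mulrC ler_pdivlMr ?powR_gt0// mul1r.
by apply: ge0_ler_powR; rewrite ?nnegrE ?subr_ge0 ?(ltW Q_gt1) ?(ltW k0) ?(ltW d0) ?(ltW kd).
Qed.

Definition level_energy (u : X -> R) (rho : X -> \bar R) (a : R) :=
  fine (mu_integral mu [set y | a < u y] (fun y => rho y `^ Q)%E).

Section LevelEnergy.
Variables (u : X -> R) (rho : X -> \bar R).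
Hypothesis mu_ : measurable_fun [set: C] u.
Hypothesis mrho : borel_fun rho.
Hypothesis Ifin : (mu_integral mu setT (fun y => rho y `^ Q) < +oo)%E.

Let mgt (a : R) : measurable ([set y | a < u y] : set C).
Proof.
have := mu_ measurableT (measurable_itv `]a, +oo[).
rewrite setTI (_ : _ @^-1` _ = [set y | a < u y])//.
by apply/seteqP; split => y /=; rewrite in_itv/= andbT.
Qed.

Let mrQ D : measurable_fun (D : set C) (fun y => (rho y `^ Q)%E).
Proof. by apply: measurable_funTS; exact: measurable_poweR_borel. Qed.

Lemma integral_energy_fin_num (D : set X) : measurable (D : set C) ->
  mu_integral mu D (fun y => rho y `^ Q)%E \is a fin_num.
Proof.
move=> mD; rewrite ge0_fin_numE; last by apply: integral_ge0 => y _; exact: poweR_ge0.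
apply: le_lt_trans Ifin; apply: ge0_subset_integral => //.
by move=> y _; exact: poweR_ge0.
Qed.

Lemma level_energy_ge0 a : 0 <= level_energy u rho a.
Proof. by apply: fine_ge0; apply: integral_ge0 => y _; exact: poweR_ge0. Qed.

Lemma level_energy_strip (s t : R) : s < t ->
  fine (mu_integral mu [set y | s < u y /\ u y < t] (fun y => rho y `^ Q)%E)
    + level_energy u rho t <= level_energy u rho s.
Proof.
move=> st; have mL := measurable_level s t mu_.
rewrite -lee_fin EFinD !fineK ?integral_energy_fin_num//.
rewrite /mu_integral -ge0_integral_setU//.
- apply: ge0_subset_integral => //; first exact: measurableU.
  + by move=> y _; exact: poweR_ge0.
  + by move=> y /= [[]//|]; exact: lt_trans.
- by move=> y _; exact: poweR_ge0.
- by apply/disj_setPRL => y /= ty [_]; apply/negP; rewrite -leNgt ltW.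
Qed.

Lemma level_energy_le (s t : R) : s <= t -> level_energy u rho t <= level_energy u rho s.
Proof.
rewrite le_eqVlt => /predU1P[->//|st]; apply: le_trans (level_energy_strip st).
by rewrite lerDr fine_ge0// integral_ge0// => y _; exact: poweR_ge0.
Qed.

(** As u is finite everywhere, the sets {u <= n} exhaust the space and their energies tend to the
    total energy. *)
Lemma level_energy_small (e : R) : 0 < e -> exists2 a, 0 <= a & level_energy u rho a <= e.
Proof.
move=> e0; pose F (n : nat) := [set y | u y <= n%:R].
have mF n : measurable (F n : set C).
  by have := measurableC (mgt n%:R); rewrite (_ : ~` _ = F n)//; apply/seteqP; split => y; rewrite /F /=; [move=> /negP|move=> h; apply/negP]; rewrite -leNgt.
have FT : \bigcup_n F n = setT.
  apply/seteqP; split => // y _; exists (Num.truncn `|u y|).+1 => //=.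
  by apply: le_trans (ler_norm _) _; rewrite ltW// truncnS_gt.
have rQ0 y : (0 <= rho y `^ Q)%E by exact: poweR_ge0.
have cvg := @ge0_nondecreasing_set_cvg_integral _ C R F (fun y => rho y `^ Q)%E m.
have Tfin := integral_energy_fin_num (@measurableT _ C).
have [n Hn] : exists n, (mu_integral mu setT (fun y => rho y `^ Q) <=
    mu_integral mu (F n) (fun y => rho y `^ Q) + e%:E)%E.
  apply/not_existsP => H.
  have : (mu_integral mu setT (fun y => rho y `^ Q) <=
      mu_integral mu setT (fun y => rho y `^ Q) - e%:E)%E.
    rewrite -{1}FT; apply: cvge_to_le (cvg _ _ _ _) _ => //.
    + by move=> n p np; apply/subsetPset => y /= h; apply: le_trans h _; rewrite ler_nat.
    + near=> n; move/negP: (H n); rewrite -ltNge => /ltW h.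
      by rewrite leeBrDr.
  move: Tfin; case: (mu_integral mu setT _) => [r| |]// _.
  by rewrite -EFinB lee_fin leNgt ltrBlDr ltrDl e0.
exists n%:R => //; rewrite -lee_fin fineK ?integral_energy_fin_num//.
have Ffin := integral_energy_fin_num (mF n).
rewrite -(leeD2lE _ _ Ffin); apply: le_trans Hn.
rewrite /mu_integral -ge0_integral_setU//.
- apply: ge0_subset_integral => //; first exact: measurableU.
- by apply/disj_setPRL => y /= ny; apply/negP; rewrite -ltNge.
Unshelve. all: by end_near. Qed.

(* Since d <= k + k^(1-Q) d^Q, each step of the chain raises the level by k plus
   a multiple of the energy of the strip crossed; following the running minimum
   of the medians makes these strips disjoint. *)
Lemma median_chain (K k T : R) (N : nat) (y : nat -> X) (r a : nat -> R) :
  0 <= K -> 0 < k ->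
  (forall (z y1 y2 : X) (r r1 r2 s t : R), 0 < r -> r <= 4 * r1 -> r <= 4 * r2 ->
    ball y1 r1 `<=` ball z r -> ball y2 r2 `<=` ball z r -> s < t ->
    (mu (ball y1 r1) <= 2%:E * mu (ball y1 r1 `&` [set y | t <= u y]%R))%E ->
    (mu (ball y2 r2) <= 2%:E * mu (ball y2 r2 `&` [set y | u y <= s]%R))%E ->
    (t - s) `^ Q <=
      K * fine (mu_integral mu [set y | s < u y /\ u y < t]%R (fun y => rho y `^ Q)%E)) ->
  (forall i, is_median u (ball (y i) (r i)) (a i)) ->
  (forall i, (i < N)%N -> exists z r', [/\ 0 < r', r' <= 4 * r i, r' <= 4 * r i.+1,
    ball (y i) (r i) `<=` ball z r' & ball (y i.+1) (r i.+1) `<=` ball z r']) ->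
  a 0%N <= Num.max T (a N) + N%:R * k + k `^ (1 - Q) * K * level_energy u rho T.
Proof.
move=> K0 k0 step med adj.
have kQ0 : 0 <= k `^ (1 - Q) * K by rewrite mulr_ge0 ?powR_ge0.
set c := k `^ (1 - Q) * K in kQ0 *.
suff H i : (i <= N)%N -> exists M, [/\ T <= M, M <= Num.max T (a i) &
    a 0%N <= M + i%:R * k + c * level_energy u rho M].
  have [M [TM Ma HM]] := H N (leqnn N); apply: le_trans HM _.
  apply: lerD; first by rewrite lerD2r.
  by apply: ler_wpM2l => //; exact: level_energy_le.
elim: i => [_|i ih iN].
  exists (Num.max T (a 0%N)); rewrite le_max lexx mul0r addr0; split => //.
  apply: (@le_trans _ _ (Num.max T (a 0%N))); first by rewrite le_max lexx orbT.
  by rewrite lerDl mulr_ge0// level_energy_ge0.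
have [M [TM Ma HM]] := ih (ltnW iN).
have ik : i.+1%:R * k = i%:R * k + k by rewrite -natr1 mulrDl mul1r.
have [Ma'|aM] := leP M (Num.max T (a i.+1)).
  by exists M; split => //; apply: le_trans HM _; rewrite lerD2r lerD2l ik lerDl ltW.
set M' := Num.max T (a i.+1) in aM *.
exists M'; rewrite le_max lexx; split => //.
have aM' : a i.+1 <= M' by rewrite le_max lexx orbT.
have TM' : T <= M' by rewrite le_max lexx.
have Mai : M <= a i by move: Ma; rewrite le_max => /orP[MT|//]; lra.
have [z [r' [r'0 ri ri1 sub1 sub2]]] := adj i iN.
have := step z (y i) (y i.+1) r' (r i) (r i.+1) M' M r'0 ri ri1 sub1 sub2 aM.
have [h1 _] := med i; have [_ h2] := med i.+1 => /(_ _ _)/wrap[].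
  apply: le_trans h1 _; apply: lee_wpmul2l => //; apply: le_outer_measure.
  by apply: setIS => w /=; exact: le_trans.
  apply: le_trans h2 _; apply: lee_wpmul2l => //; apply: le_outer_measure.
  by apply: setIS => w /= h; exact: le_trans aM'.
set E := fine _ => HE.
have d0 : 0 < M - M' by rewrite subr_gt0.
have := le_add_powR k0 d0 => Hd.
have Hs := level_energy_strip aM; rewrite -/E in Hs.
have HcE : k `^ (1 - Q) * (M - M') `^ Q <= c * (level_energy u rho M' - level_energy u rho M).
  rewrite /c -mulrA ler_wpM2l ?powR_ge0//; apply: le_trans HE _.
  by rewrite ler_wpM2l//; lra.
by rewrite mulrBr in HcE; rewrite ik; lra.
Qed.

End LevelEnergy.

End Medians.

(** * Growth of the averages over unit balls *)

Section MeanGrowth.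
Context {R : realType} {X : pmetricType R}.
Variable mu : {outer_measure set X -> \bar R}.
Variable Q : R.
Hypothesis Q_gt1 : 1 < Q.
Hypothesis mu_breg : borel_regular mu.
Hypothesis X_complete : complete_space X.
Hypothesis mu_regular : ahlfors_regular mu Q.
Hypothesis mu_poincare : poincare_inequality mu Q.
Local Notation C := (caratheodory_type mu).
Let m : {measure set C -> \bar R} := mu.
Let Q0 : 0 < Q. Proof. exact: lt_trans Q_gt1. Qed.

Lemma upper_gradient_norm (u : X -> R) (rho : X -> \bar R) :
  upper_gradient u rho -> upper_gradient (fun y => `|u y|) rho.
Proof.
move=> [mrho rho0 ug]; split => // c a b hc; apply: le_trans (ug c a b hc).
by rewrite lee_fin ler_dist_dist.
Qed.

Lemma mu_integrable_norm (u : X -> R) (x : X) (r : R) :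
  mu_integrable mu (ball x r) u -> mu_integrable mu (ball x r) (fun y => `|u y|).
Proof. by move=> iu; exact: (integrable_abse iu). Qed.

Lemma ball_mean_norm (u : X -> R) (x : X) (r : R) :
  mu_integrable mu (ball x r) u ->
  `|ball_mean mu u x r| <= ball_mean mu (fun y => `|u y|) x r.
Proof.
move=> iu; have mB := ball_caratheodory mu_breg x r.
have [mfu _] := integrableP _ _ _ iu.
rewrite /ball_mean normrM ger0_norm ?invr_ge0 ?fine_ge0 ?outer_measure_ge0//.
apply: ler_wpM2l; first by rewrite invr_ge0 fine_ge0 ?outer_measure_ge0.
have fin := integrable_fin_num mB iu.
have fin' := integrable_fin_num mB (mu_integrable_norm iu).
rewrite -lee_fin; have := le_abse_integral m mB mfu.
rewrite /mu_integral -[X in (_ <= X)%E]fineK//.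
by rewrite -[X in (`|X|)%E]fineK.
Qed.

(** If the mean c exceeds the median a, then |u - c| >= c - a on at least half of the ball, so (c -
    a)/2 is at most the mean oscillation. *)
Lemma ball_mean_le_median : exists2 K : R, 0 <= K &
  forall (u : X -> R) (rho : X -> \bar R),
    (forall (x : X) (r : R), 0 < r -> mu_integrable mu (ball x r) u) ->
    upper_gradient u rho -> (mu_integral mu setT (fun y => rho y `^ Q) < +oo)%E ->
    forall (x : X) (r a : R), 0 < r -> is_median mu u (ball x r) a ->
    ball_mean mu u x r <=
      a + K * fine (mu_integral mu setT (fun y => rho y `^ Q)%E) `^ Q^-1.
Proof.
have [C0 [lam [C00 lam1 HP]]] := poincare_ball Q_gt1 mu_regular mu_poincare.
exists (2 * C0); first by rewrite mulr_ge0.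
move=> u rho uint ug Ifin x r a r0 [_ med].
have rQ0 y : (0 <= rho y `^ Q)%E by exact: poweR_ge0.
have mu_ := ball_integrable_measurable mu_breg uint.
set c := ball_mean mu u x r; set I := mu_integral mu setT _ in Ifin *.
have I0 : (0 <= I)%E by exact: integral_ge0.
have Ifn : I \is a fin_num by rewrite ge0_fin_numE.
have mB := ball_caratheodory mu_breg x r.
have [ca|ac] := leP c a.
  by apply: le_trans ca _; rewrite lerDl !mulr_ge0// powR_ge0.
have B0 := fine_mu_ball_gt0 mu_regular x r0.
have := HP u rho uint ug x r (fine I) r0 (fine_ge0 I0) _.
rewrite fineK// => /(_ _)/wrap[].
  apply: ge0_subset_integral => //; [exact: ball_caratheodory|].
  by apply: measurable_poweR_borel => //; case: ug.
move=> osc; pose A := ball x r `&` [set y | u y <= a].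
have mA : measurable (A : set C).
  apply: measurableI => //.
  have := mu_ measurableT _ (measurable_itv `]-oo, a]).
  by rewrite setTI (_ : _ @^-1` _ = [set y | u y <= a]).
have low : ((c - a)%:E * mu A <= mu_integral mu (ball x r) (fun y => `|u y - c|%:E))%E.
  apply: (@le_trans _ _ (\int[m]_(y in A) `|u y - c|%:E)%E).
    rewrite -integral_cst//; apply: ge0_le_integral => //.
    - by move=> y _ /=; rewrite lee_fin subr_ge0 ltW.
    - apply/measurable_EFinP; apply: measurableT_comp => //.
      by apply: measurable_funB => //; exact: measurable_funTS.
    - move=> y [_ /= ua]; rewrite lee_fin distrC.
      by apply: le_trans (ler_norm _); rewrite lerD2l lerN2.
  apply: ge0_subset_integral => //; last by move=> y [].
  apply/measurable_EFinP; apply: measurableT_comp => //.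
  by apply: measurable_funB => //; exact: measurable_funTS.
have := le_trans low osc.
have Afin : mu A \is a fin_num.
  rewrite ge0_fin_numE ?outer_measure_ge0//.
  apply: le_lt_trans (ahlfors_ball_fin mu_regular x r).
  by apply: le_outer_measure => y [].
rewrite -(fineK Afin) -EFinM lee_fin => H.
move: med; rewrite (mu_ballE mu_regular) -/A -(fineK Afin) -EFinM lee_fin => med.
set M := fine (mu (ball x r)) in B0 H med.
rewrite -lerBlDl -(ler_pM2r B0).
apply: (@le_trans _ _ ((c - a) * (2 * fine (mu A)))).
  by rewrite ler_wpM2l// subr_ge0 ltW.
by rewrite mulrCA -!mulrA ler_wpM2l// mulrA.
Qed.

Lemma lt_pow2_log (d : R) : 0 < d -> d < 2 ^+ (Num.truncn (ln d / ln 2)).+1.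
Proof.
move=> d0; have ln2 : 0 < ln (2 : R) by rewrite ln_gt0// ltr1n.
rewrite -ltr_ln ?posrE ?exprn_gt0// lnXn//.
by rewrite -[ltRHS]mulr_natr [ltRHS]mulrC -ltr_pdivrMr// truncnS_gt.
Qed.

Lemma powR_unbounded (A e p : R) : 0 < e -> 0 < p ->
  exists2 M : R, 1 < M & forall l : R, M < l -> A <= e * l `^ p.
Proof.
move=> e0 p0; exists (Num.max 2 ((`|A| / e) `^ p^-1)).
  by rewrite lt_max ltr1n.
move=> l; rewrite gt_max => /andP[l2 Al].
have l0 : 0 < l by apply: lt_trans l2.
apply: le_trans (ler_norm A) _; rewrite mulrC -ler_pdivrMr//.
rewrite -[leLHS]powRr1 ?divr_ge0 ?(ltW e0)// -[X in _ `^ X <= _](@mulVf _ p) ?gt_eqF// powRrM.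
by apply: ge0_ler_powR; rewrite ?nnegrE ?powR_ge0 ?(ltW p0) ?(ltW l0) ?(ltW Al).
Qed.

Let pow2S j : (2 ^+ j.+1 : R) <= 4 * 2 ^+ j.
Proof. by rewrite exprS ler_wpM2r ?exprn_ge0// ler_nat. Qed.

Let pow2_4 j : (2 ^+ j : R) <= 4 * 2 ^+ j.
Proof. by rewrite ler_peMl ?exprn_ge0// ler1n. Qed.

Lemma mean_norm_growth (O : X) (u : X -> R) (e : R) : dotN1 mu Q u -> 0 < e ->
  exists M : R, forall x, M < mdist O x ->
    ball_mean mu (fun y => `|u y|) x 1 <= e * ln (mdist O x) `^ ((Q - 1) / Q).
Proof.
move=> [lu [rho ugu Ifin]] e0; set p := (Q - 1) / Q.
have p0 : 0 < p by rewrite divr_gt0// subr_gt0.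
pose U y := `|u y|.
have Uint (x : X) (r : R) : 0 < r -> mu_integrable mu (ball x r) U.
  by move=> _; apply: mu_integrable_norm; exact: (loc_integrable_ball mu_breg X_complete mu_regular lu).
have ug : upper_gradient U rho by exact: upper_gradient_norm.
have mrho : borel_fun rho by case: ug.
have mU := ball_integrable_measurable mu_breg Uint.
have [K K0 HK] := poincare_step Q_gt1 mu_breg mu_regular mu_poincare.
have [C0 C00 HC] := ball_mean_le_median.
set I := fine (mu_integral mu setT (fun y => rho y `^ Q)%E) in HC.
have medex (b : X * R) : exists a, 0 < b.2 -> is_median mu U (ball b.1 b.2) a.
  have [b0|b0] := ltP 0 b.2; last by exists 0.
  by have [a Ha] := median_exists mu_breg mu_regular b.1 b0 mU; exists a.
have [med Hmed] := choice medex.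
(* The number n of doublings is at most ln d / ln 2 + 1, hence at most c ln d, because ln d > 1. *)
pose c : R := (ln 2)^-1 + 1.
have ln2 : 0 < ln (2 : R) by rewrite ln_gt0// ltr1n.
have c0 : 0 < c by rewrite addr_gt0// invr_gt0.
have cp0 : 0 < c `^ p by rewrite powR_gt0.
(* The steps of the chain contribute at most 3 eta n^p and the energy at most eta n^p; since n <= c
   ln d, the sum 4 eta n^p is at most (e/2) (ln d)^p. *)
pose eta := e / (8 * c `^ p).
have eta0 : 0 < eta by rewrite divr_gt0// mulr_gt0.
(* In [median_chain] the energy above T is multiplied by K eta^(1-Q) n^p; the bound eta / Ke on that
   energy brings the term below eta n^p. *)
pose Ke := K * eta `^ (1 - Q) + 1.
have Ke0 : 0 < Ke by rewrite ltr_wpDl// mulr_ge0// powR_ge0.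
have [T T0 HT] := level_energy_small mu_breg mU mrho Ifin (divr_gt0 eta0 Ke0).
pose A := Num.max T (med (O, 1)) + C0 * I `^ Q^-1.
have [M M1 HM] := powR_unbounded A (divr_gt0 e0 (ltr0Sn R 1)) p0.
exists (expR M) => x Mx; set d := mdist O x in Mx *.
have d0 : 0 < d by apply: lt_trans Mx; exact: expR_gt0.
have Ml : M < ln d by rewrite -(expRK M) ltr_ln ?posrE ?expR_gt0.
have l1 : 1 < ln d by exact: lt_trans Ml.
have l0 : 0 < ln d by exact: lt_trans l1.
pose n := (Num.truncn (ln d / ln 2)).+1.
have dn : d < 2 ^+ n by exact: lt_pow2_log.
have n0 : 0 < n%:R :> R by rewrite ltr0n.
have nl : n%:R <= c * ln d.
  rewrite /n /c mulrDl mul1r -[leLHS]natr1; apply: lerD; last exact: ltW.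
  rewrite [leRHS]mulrC; have := truncn_le (ln d / ln 2).
  by rewrite divr_ge0 ?(ltW l0) ?(ltW ln2).
pose yy i := if (i <= n)%N then x else O.
pose rr i : R := if (i <= n)%N then 2 ^+ i else 2 ^+ (n.*2.+1 - i).
have rr0 i : 0 < rr i by rewrite /rr; case: ifP => _; rewrite exprn_gt0.
(* This power of n balances the two costs: both n k and k^(1-Q) are of order n^p, with p = 1 -
   1/Q. *)
pose k := eta * n%:R `^ (- Q^-1).
have k0 : 0 < k by rewrite mulr_gt0// powR_gt0.
have adj i : (i < n.*2.+1)%N -> exists (z : X) (r' : R), [/\ 0 < r',
    r' <= 4 * rr i, r' <= 4 * rr i.+1, ball (yy i) (rr i) `<=` ball z r' &
    ball (yy i.+1) (rr i.+1) `<=` ball z r'].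
  move=> iN; rewrite /yy /rr.
  have [ni|ni|ni] := ltngtP i n.
  - exists x, (2 ^+ i.+1); split => //.
    + by apply: le_ball; rewrite ler_eXn2l ?ltr1n.
  - have -> : (n.*2.+1 - i = (n.*2.+1 - i.+1).+1)%N by rewrite subnSK.
    set j := (n.*2.+1 - i.+1)%N.
    exists O, (2 ^+ j.+1); split => //.
    + by apply: le_ball; rewrite ler_eXn2l ?ltr1n.
  (* The jump: as d < 2^n, the ball B(O, 2^(n+1)) contains B(x, 2^n) as well as B(O, 2^n). *)
  - rewrite ni.
    have -> : (n.*2.+1 - n.+1 = n)%N by rewrite subSS -addnn addnK.
    exists O, (2 ^+ n.+1); split => //.
    + move=> z; rewrite !ballEmdist /= => xz.
      apply: le_lt_trans (metric_triangle O x z) _.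
      by rewrite exprS mulrDl mul1r ltrD.
    + by apply: le_ball; rewrite ler_eXn2l ?ltr1n.
have := @median_chain _ _ mu Q Q_gt1 mu_breg U rho mU mrho Ifin K k T n.*2.+1 yy rr
  (fun i => med (yy i, rr i)) K0 k0 (HK U rho mU ug Ifin)
  (fun i => Hmed (yy i, rr i) (rr0 i)) adj.
rewrite /yy /rr leq0n expr0.
have -> : (n.*2.+1 <= n)%N = false by rewrite leqNgt ltnS -addnn leq_addr.
rewrite subnn expr0 => chain.
have medx : is_median mu U (ball x 1) (med (x, 1)) by exact: (Hmed (x, 1) ltr01).
have := HC U rho Uint ug Ifin x 1 _ ltr01 medx; rewrite -/I => mean.
apply: le_trans mean _.
have pE : n%:R `^ p = n%:R * n%:R `^ (- Q^-1) :> R.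
  have -> : p = 1 + - Q^-1 by rewrite /p mulrBl divff ?gt_eqF// mul1r.
  rewrite powRD; last by apply/implyP => _; rewrite gt_eqF.
  by rewrite powRr1 ?(ltW n0).
have npos : 0 <= n%:R `^ p :> R by exact: powR_ge0.
have t1 : (n.*2.+1)%:R * k <= 3 * eta * n%:R `^ p.
  rewrite /k pE; set w := n%:R `^ (- Q^-1).
  have w0 : 0 <= w by exact: powR_ge0.
  rewrite -[leRHS]mulrA [leLHS]mulrCA [leRHS]mulrCA ler_wpM2l ?(ltW eta0)//.
  rewrite mulrA ler_wpM2r// -natrM ler_nat -addnn.
  by rewrite (_ : 3 = 2 + 1)%N// mulnDl mul1n mul2n -addnn -addn1 leq_add2l.
have t2 : k `^ (1 - Q) * K * level_energy mu Q U rho T <= eta * n%:R `^ p.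
  have -> : k `^ (1 - Q) = eta `^ (1 - Q) * n%:R `^ p.
    rewrite /k powRM ?powR_ge0 ?(ltW eta0)// -powRrM; congr (_ * _ `^ _).
    by rewrite /p mulrC mulrN -mulNr opprB.
  rewrite -mulrA mulrAC ler_wpM2r// mulrA [_ * K]mulrC.
  apply: (@le_trans _ _ (K * eta `^ (1 - Q) * (eta / Ke))).
    by apply: ler_wpM2l => //; rewrite mulr_ge0 ?powR_ge0.
  by rewrite mulrCA ler_piMr ?(ltW eta0)// ler_pdivrMr// mul1r lerDl.
have npl : n%:R `^ p <= c `^ p * ln d `^ p.
  rewrite -powRM ?(ltW c0) ?(ltW l0)//.
  by apply: ge0_ler_powR; rewrite ?nnegrE ?(ltW p0) ?(ltW n0) ?mulr_ge0 ?(ltW c0) ?(ltW l0).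
have t3 : 4 * eta * n%:R `^ p <= e / 2 * ln d `^ p.
  apply: (@le_trans _ _ (4 * eta * (c `^ p * ln d `^ p))).
    by apply: ler_wpM2l => //; rewrite mulr_ge0// ltW.
  by rewrite mulrA /eta le_eqVlt; apply/orP; left; apply/eqP; field; rewrite gt_eqF.
apply: (@le_trans _ _ (A + 4 * eta * n%:R `^ p)).
  rewrite /A addrAC lerD2r; apply: le_trans chain _.
  rewrite -addrA lerD2l; apply: le_trans (lerD t1 t2) _.
  by rewrite -mulrDl -[X in _ + X]mul1r -mulrDl natr1.
have -> : e * ln d `^ p = e / 2 * ln d `^ p + e / 2 * ln d `^ p.
  by rewrite -mulrDl -splitr.
by apply: lerD => //; exact: HM.
Qed.

Lemma mean_norm_limit (O : X) (u : X -> R) : dotN1 mu Q u ->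
  `|ball_mean mu u x 1 / ln (mdist O x) `^ ((Q - 1) / Q)|
    @[x --> at_infinity O] --> (0 : R).
Proof.
move=> Nu; apply/cvgr0Pnorm_le => e e0; have [M HM] := mean_norm_growth O Nu e0.
exists (Num.max M (expR 1)) => x; rewrite gt_max => /andP[Mx ex].
have l0 : 0 < ln (mdist O x) `^ ((Q - 1) / Q).
  apply: powR_gt0; apply: lt_trans ltr01 _.
  by rewrite -(expRK (1 : R)) ltr_ln ?posrE ?expR_gt0//; apply: lt_trans ex; exact: expR_gt0.
rewrite normr_id normrM normfV (gtr0_norm l0) ler_pdivrMr//.
apply: le_trans (HM x Mx); apply: ball_mean_norm.
by case: Nu => lu _; exact: (loc_integrable_ball mu_breg X_complete mu_regular lu).
Qed.

End MeanGrowth.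

(** * Chains and their limit curves *)

Section Chains.
Context {R : realType} {X : pmetricType R}.
Implicit Types (f : X -> R) (x y z : X) (p q r : seq X) (d e N S T : R).

Definition mesh d : rel X := fun a b => mdist a b < d.

(** A Riemann sum of f along the chain, with f evaluated at the starting vertex of each edge. *)
Fixpoint chain_cost f x p : R :=
  if p is y :: q then f x * mdist x y + chain_cost f y q else 0.

(** Accumulated cost serves as time: this is the last vertex reached at cost at most T, and the
    endpoint of the chain once T exceeds the total cost. *)
Fixpoint chain_point f x p T : X :=
  if p is y :: q then
    if T < f x * mdist x y then x else chain_point f y q (T - f x * mdist x y)
  else x.

(* The extra value N truncates the infimum and makes it meaningful when no
   chain joins x to y. *)
Definition chain_dist f d N x y : R :=
  inf [set c | c = N \/ exists p, [/\ path (mesh d) x p, last x p = y &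
                                      c = chain_cost f x p]].

Section Cost.
Variable f : X -> R.
Hypothesis f1 : forall x, 1 <= f x.

Let f0 x : 0 <= f x. Proof. exact: le_trans (f1 x). Qed.

Lemma chain_cost_ge0 x p : 0 <= chain_cost f x p.
Proof. by elim: p x => //= y q ih x; rewrite addr_ge0// mulr_ge0// mdist_ge0. Qed.

Lemma chain_cost_rcons x p y :
  chain_cost f x (rcons p y) = chain_cost f x p + f (last x p) * mdist (last x p) y.
Proof. by elim: p x => [|z q ih] x /=; [rewrite addr0 add0r|rewrite ih addrA]. Qed.

(** Since f >= 1, a chain of cost at most D never leaves the ball of radius D about its start, so
    the lower bound b applies to every edge. In the induction, a step to y uses up d(x, y) of D. *)
Lemma chain_cost_lower x p b D : chain_cost f x p <= D -> 0 <= b ->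
  (forall w, mdist x w <= D -> b <= f w) ->
  b * mdist x (last x p) <= chain_cost f x p.
Proof.
move=> pD b0; elim: p x D pD => [|y q ih] x D /= pD bD; first by rewrite mdistxx mulr0.
have xx : mdist x x <= D.
  rewrite mdistxx; apply: le_trans pD; rewrite addr_ge0 ?chain_cost_ge0//.
  by rewrite mulr_ge0// mdist_ge0.
have fd : mdist x y <= f x * mdist x y by rewrite ler_peMl// mdist_ge0.
have bd : b * mdist x y <= f x * mdist x y.
  by rewrite ler_wpM2r ?mdist_ge0//; exact: bD.
have qD : chain_cost f y q <= D - mdist x y by lra.
have := ih y _ qD _ => /(_ _)/wrap[].
  by move=> w yw; apply: bD; have := metric_triangle x y w; lra.
have : b * mdist x (last y q) <= b * (mdist x y + mdist y (last y q)).
  by rewrite ler_wpM2l// metric_triangle.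
by rewrite mulrDr; lra.
Qed.

Lemma mdist_le_chain_cost x p : mdist x (last x p) <= chain_cost f x p.
Proof.
by rewrite -[leLHS]mul1r; apply: chain_cost_lower (lexx _) _ _.
Qed.

Lemma chain_point_prefix d x p T : 0 <= T -> path (mesh d) x p ->
  exists r, [/\ path (mesh d) x r, last x r = chain_point f x p T &
    chain_cost f x r <= T].
Proof.
elim: p x T => [|y q ih] x T T0 /=; first by exists [::].
move=> /andP[xy yq]; case: ltP => [_|cT]; first by exists [::].
have [|r [yr lr cr]] := ih y (T - f x * mdist x y) _ yq; first by rewrite subr_ge0.
by exists (y :: r); split => //=; [rewrite xy|lra].
Qed.

(** When the time S falls inside an edge, the chain restarts at the first vertex of that edge and
    pays the whole edge again; one edge costs at most e. *)
Lemma chain_point_between d e x p S T :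
  0 <= e -> (forall a, f a * d <= e) ->
  0 <= S -> S <= T -> path (mesh d) x p ->
  exists r, [/\ path (mesh d) (chain_point f x p S) r,
    last (chain_point f x p S) r = chain_point f x p T &
    chain_cost f (chain_point f x p S) r <= T - S + e].
Proof.
move=> e0 fe; elim: p x S T => [|y q ih] x S T S0 ST.
  by exists [::]; split => //=; rewrite addr_ge0 ?subr_ge0.
move=> /= /andP[xy yq]; set c := f x * mdist x y.
have ce : c <= e.
  by apply: le_trans (fe x); rewrite ler_wpM2l// ltW.
have [Sc|cS] := ltP S c.
  have [Tc|cT] := ltP T c; first by exists [::]; split => //=; lra.
  have [|r [yr lr cr]] := chain_point_prefix _ yq (T := T - c); first by rewrite subr_ge0.
  by exists (y :: r); split => //=; [rewrite xy|rewrite -/c; lra].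
have cT : c <= T by exact: le_trans ST.
rewrite ltNge cT /=.
have [||r [yr lr cr]] := ih y (S - c) (T - c) _ _ yq.
- by rewrite subr_ge0.
- by rewrite lerD2r.
exists r; split => //; lra.
Qed.

Lemma chain_point0 x p : chain_point f x p 0 = x.
Proof.
elim: p x => //= y q ih x; case: ltP => // c0.
have xy : x = y.
  apply: mdist_positivity; apply/eqP; rewrite eq_le mdist_ge0 andbT.
  by apply: le_trans c0; rewrite ler_peMl// mdist_ge0.
by rewrite -xy mdistxx mulr0 subrr ih.
Qed.

Lemma chain_point_last x p T : chain_cost f x p <= T ->
  chain_point f x p T = last x p.
Proof.
elim: p x T => //= y q ih x T cT; rewrite ltNge ifF; last first.
  apply/negbF; apply: le_trans cT; rewrite lerDl; exact: chain_cost_ge0.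
by apply: ih; rewrite lerBrDl.
Qed.

Section Distance.
Variables (d N : R) (x : X).
Hypothesis N0 : 0 <= N.

Let lb0 y : lbound [set c | c = N \/ exists p, [/\ path (mesh d) x p, last x p = y &
  c = chain_cost f x p]] 0.
Proof. by move=> c [->//|[p [_ _ ->]]]; exact: chain_cost_ge0. Qed.

Lemma chain_dist_ge0 y : 0 <= chain_dist f d N x y.
Proof. by apply: lb_le_inf => [|c]; [exists N; left|exact: lb0]. Qed.

Lemma chain_dist_leN y : chain_dist f d N x y <= N.
Proof. by apply: ge_inf; [exists 0; exact: lb0|left]. Qed.

Lemma chain_dist_le p : path (mesh d) x p ->
  chain_dist f d N x (last x p) <= chain_cost f x p.
Proof. by move=> xp; apply: ge_inf; [exists 0; exact: lb0|right; exists p]. Qed.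

Lemma chain_dist_lt y T : chain_dist f d N x y < T -> T <= N ->
  exists p, [/\ path (mesh d) x p, last x p = y & chain_cost f x p < T].
Proof.
move=> VT TN; have [|c + cT] := inf_lt _ VT; first by exists N; left.
case=> [cN|[p [xp py cE]]]; first by move: cT; rewrite cN ltNge TN.
by exists p; rewrite -cE.
Qed.

Lemma chain_dist_step y z : mdist y z < d ->
  chain_dist f d N x z <= chain_dist f d N x y + f y * mdist y z.
Proof.
move=> yz; rewrite -lerBlDr; apply: lb_le_inf; first by exists N; left.
move=> c [->|[p [xp py ->]]].
  rewrite lerBlDr; apply: le_trans (chain_dist_leN z) _.
  by rewrite lerDl mulr_ge0// mdist_ge0.
rewrite lerBlDr -py -chain_cost_rcons.
rewrite -[z in leLHS](last_rcons x p z); apply: chain_dist_le.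
by rewrite rcons_path xp py.
Qed.

End Distance.

End Cost.

Lemma chain_dist_upper_gradient f d N x (K : R) :
  (forall y, 1 <= f y) -> 0 <= N -> 0 <= K -> 0 < d ->
  (forall y z, f z <= f y + K * mdist y z) ->
  upper_gradient (chain_dist f d N x) (EFin \o f).
Proof.
move=> f1 N0 K0 d0 fl; have f0 y : 0 <= f y by exact: le_trans (f1 y).
apply: (le_lip_upper_gradient K0 d0 f0 fl) => y z yz.
have h1 := chain_dist_step f1 x N0 yz.
have zy : mdist z y < d by rewrite metric_sym.
have h2 := chain_dist_step f1 x N0 zy.
have h3 : f z * mdist z y <= (f y + K * mdist y z) * mdist y z.
  by rewrite (metric_sym z) ler_wpM2r ?mdist_ge0.
have h4 : f y * mdist y z <= (f y + K * mdist y z) * mdist y z.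
  by rewrite ler_wpM2r ?mdist_ge0// lerDl mulr_ge0// mdist_ge0.
by rewrite ler_norml; apply/andP; split; lra.
Qed.

Lemma chain_dist_continuous f d N x (K : R) :
  (forall y, 1 <= f y) -> 0 <= N -> 0 <= K -> 0 < d ->
  (forall y z, f z <= f y + K * mdist y z) ->
  continuous (chain_dist f d N x).
Proof.
move=> f1 N0 K0 d0 fl y; apply/cvg_ballP => e e0.
have f0 : 0 < f y + K * d by rewrite ltr_wpDr ?mulr_ge0 ?(ltW d0)// (lt_le_trans _ (f1 y)).
apply/nbhs_ballP; exists (Num.min d (e / (f y + K * d))).
  by rewrite /= lt_min d0 divr_gt0.
move=> z; rewrite ballEmdist /ball /= lt_min => /andP[yz]; rewrite ltr_pdivlMr// => yze.
have h1 := chain_dist_step f1 x N0 yz.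
have zy : mdist z y < d by rewrite metric_sym.
have h2 := chain_dist_step f1 x N0 zy.
have m0 := mdist_ge0 y z.
have h3 : f z * mdist z y <= mdist y z * (f y + K * d).
  rewrite (metric_sym z) mulrC ler_wpM2l//; apply: le_trans (fl y z) _.
  by rewrite lerD2l ler_wpM2l// ltW.
have h4 : f y * mdist y z <= mdist y z * (f y + K * d).
  by rewrite mulrC ler_wpM2l// lerDl mulr_ge0// ltW.
by rewrite ltr_norml; apply/andP; split; lra.
Qed.

End Chains.

(** * Lipschitz approximation of a lower semicontinuous function from below *)

Section LipschitzApproximation.
Context {R : realType} {X : pmetricType R}.
Variable rho : X -> \bar R.
Hypothesis rho_lsc : forall a : R, open [set x | (a%:E < rho x)%E].
Hypothesis rho1 : forall x, (1 <= rho x)%E.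

(** The infimal convolution of [rho], cut at k+1, with the cone of slope k+1. The cut makes it
    real-valued even where [rho] is +oo. *)
Definition lip_approx (k : nat) (y : X) : R :=
  inf (range (fun z => fine (mine (rho z) k.+1%:R%:E) + k.+1%:R * mdist y z)).

Let cut k z := fine (mine (rho z) k.+1%:R%:E).

Let cutE k z : (cut k z)%:E = mine (rho z) k.+1%:R%:E.
Proof.
rewrite fineK//; have := rho1 z; rewrite /Order.min.
by case: (rho z) => [r| |] //; case: ifP.
Qed.

Let cut1 k z : 1 <= cut k z.
Proof. by rewrite -lee_fin cutE le_min rho1 lee_fin ler1n. Qed.

Let cutle k z : cut k z <= k.+1%:R.
Proof. by rewrite -lee_fin cutE ge_min lexx orbT. Qed.

Let kd0 k (y z : X) : 0 <= k.+1%:R * mdist y z.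
Proof. by rewrite mulr_ge0// mdist_ge0. Qed.

Let lb1 k y : lbound (range (fun z => cut k z + k.+1%:R * mdist y z)) 1.
Proof. by move=> _ [z _ <-]; rewrite (le_trans (cut1 k z))// lerDl. Qed.

Lemma lip_approx_ge1 k y : 1 <= lip_approx k y.
Proof. by apply: lb_le_inf => [|c]; [exists (cut k y + k.+1%:R * mdist y y); exists y|exact: lb1]. Qed.

Lemma lip_approx_le_cut k y z :
  lip_approx k y <= fine (mine (rho z) k.+1%:R%:E) + k.+1%:R * mdist y z.
Proof. by apply: ge_inf; [exists 1; exact: lb1|exists z]. Qed.

Lemma lip_approx_le k y : lip_approx k y <= k.+1%:R.
Proof.
by apply: le_trans (lip_approx_le_cut k y y) _; rewrite mdistxx mulr0 addr0 cutle.
Qed.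

Lemma lip_approx_le_rho k y : ((lip_approx k y)%:E <= rho y)%E.
Proof.
apply: (@le_trans _ _ (cut k y)%:E).
  by rewrite lee_fin; have := lip_approx_le_cut k y y; rewrite mdistxx mulr0 addr0.
by rewrite cutE ge_min lexx.
Qed.

Lemma lip_approx_lip k y z : lip_approx k z <= lip_approx k y + k.+1%:R * mdist y z.
Proof.
rewrite -lerBlDr; apply: lb_le_inf.
  by exists (cut k y + k.+1%:R * mdist y y); exists y.
move=> _ [w _ <-]; rewrite lerBlDr; apply: le_trans (lip_approx_le_cut k z w) _.
rewrite -addrA lerD2l -mulrDr ler_wpM2l//.
by rewrite addrC (metric_sym y z) metric_triangle.
Qed.

Lemma lip_approx_nd k l y : (k <= l)%N -> lip_approx k y <= lip_approx l y.
Proof.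
move=> kl; apply: lb_le_inf; first by exists (cut l y + l.+1%:R * mdist y y); exists y.
move=> _ [w _ <-]; apply: le_trans (lip_approx_le_cut k y w) _; apply: lerD.
  rewrite -lee_fin !cutE le_min ge_min lexx/= ge_min lee_fin ler_nat ltnS kl orbT//.
by rewrite ler_wpM2r ?mdist_ge0// ler_nat.
Qed.

(** By lower semicontinuity [rho] exceeds a on some ball B(y, r). Outside that ball the cone alone
    reaches |a| once (k+1) r > |a|. *)
Lemma lip_approx_gt (a : R) y : (a%:E < rho y)%E ->
  exists k, a <= lip_approx k y.
Proof.
move=> ay; have /nbhs_ballP[r /= r0 ra] : nbhs y [set x | (a%:E < rho x)%E].
  by apply: open_nbhs_nbhs; split => //; exact: rho_lsc.
pose k := Num.truncn (Num.max `|a| (`|a| / r)).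
have kk : Num.max `|a| (`|a| / r) < k.+1%:R by exact: truncnS_gt.
move: kk; rewrite gt_max => /andP[k1 k2].
exists k; apply: lb_le_inf; first by exists (cut k y + k.+1%:R * mdist y y); exists y.
move=> _ [w _ <-]; have [yw|wy] := ltP (mdist y w) r.
  apply: (@le_trans _ _ (cut k w)); last by rewrite lerDl.
  rewrite -lee_fin cutE le_min ltW/=; last by apply: ra; rewrite ballEmdist.
  by rewrite lee_fin (le_trans (ler_norm a))// ltW.
apply: le_trans (ler_norm a) _.
apply: (@le_trans _ _ (k.+1%:R * r)); first by rewrite -ler_pdivrMr// ltW.
apply: (@le_trans _ _ (k.+1%:R * mdist y w)); first by rewrite ler_wpM2l.
by rewrite -/(cut k w) lerDr (le_trans ler01).
Qed.

Lemma lip_approx_cvg y : (lip_approx k y)%:E @[k --> \oo] --> rho y.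
Proof.
have nd : nondecreasing_seq (fun k => (lip_approx k y)%:E).
  by move=> k l kl; rewrite lee_fin lip_approx_nd.
rewrite (_ : rho y = ereal_sup (range (fun k => (lip_approx k y)%:E))).
  exact: ereal_nondecreasing_cvgn.
apply/eqP; rewrite eq_le; apply/andP; split; last first.
  by apply: ge_ereal_sup => _ [k _ <-]; exact: lip_approx_le_rho.
rewrite leNgt; apply/negP; set S := ereal_sup _ => Sy.
have S1 : (1 <= S)%E.
  apply: (@le_trans _ _ (lip_approx 0 y)%:E); first by rewrite lee_fin lip_approx_ge1.
  by apply: ereal_sup_ubound; exists 0%N.
have [a Sa ay] : exists2 a : R, (S < a%:E)%E & (a%:E < rho y)%E.
  case: S S1 Sy => [s| |]// _ Sy; last by move: Sy; rewrite ltNge leey.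
  case: (rho y) Sy => [t| |]// st; last by exists (s + 1); rewrite ?ltry// lte_fin ltrDl.
  by rewrite lte_fin in st; exists ((s + t) / 2); rewrite lte_fin ?midf_lt.
have [k ak] := lip_approx_gt ay.
have : ((lip_approx k y)%:E <= S)%E by apply: ereal_sup_ubound; exists k.
by apply/negP; rewrite -ltNge (lt_le_trans Sa)// lee_fin.
Qed.

End LipschitzApproximation.

(** * Limits of chains and their line integrals *)

Section LimitCurve.
Context {R : realType} {X : pmetricType R}.
Variables (g : nat -> X -> R) (d : nat -> R) (x y : X) (L : R).
Hypothesis L0 : 0 <= L.
Hypothesis g1 : forall k z, 1 <= g k z.
Hypothesis g_nd : forall k l z, (k <= l)%N -> g k z <= g l z.
Hypothesis g_lip : forall k z w, g k w <= g k z + k.+1%:R * mdist z w.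
Hypothesis g_le : forall k z, g k z <= k.+1%:R.
Hypothesis dE : forall k, d k = k.+1%:R^-1 * k.+1%:R^-1.
Hypothesis bounded_ultra_cvg : forall (F : set_system X) (r : R),
  UltraFilter F -> F (ball x r) -> exists l : X, F --> l.
Hypothesis chains : forall k, exists p, [/\ path (mesh (d k)) x p, last x p = y &
  chain_cost (g k) x p <= L].

(* c T is the limit, along an ultrafilter, of the points of the chains at cost T;
   properness makes these converge. The last inequality says that c is traversed
   at speed at most 1 / g m. *)
Lemma limit_curve : exists c : R -> X, [/\ c 0 = x, c L = y,
  forall S T : R, 0 <= S -> S <= T -> mdist (c S) (c T) <= T - S &
  forall (m : nat) (h S S' T' : R), 0 <= h -> 3 * m.+1%:R * h <= 1 ->
    0 <= S -> S <= S' -> S' <= T' -> T' <= S + h ->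
    mdist (c S') (c T') * (g m (c S) - m.+1%:R * h) <= T' - S'].
Proof.
have [p Hp] := choice chains.
pose ck k T := chain_point (g k) x (p k) T.
(* An edge of the k-th chain costs at most [e k]: its length is below (k+1)^-2, while [g k] is at
   most k+1. The error of [chain_point_between] therefore vanishes as k grows. *)
pose e k : R := k.+1%:R^-1.
have e0 k : 0 <= e k by rewrite invr_ge0.
have ge k a : g k a * d k <= e k.
  rewrite dE mulrA ler_piMl// ler_pdivrMr// mul1r; exact: g_le.
have between k S T : 0 <= S -> S <= T -> exists r,
    [/\ path (mesh (d k)) (ck k S) r, last (ck k S) r = ck k T &
      chain_cost (g k) (ck k S) r <= T - S + e k].
  move=> S0 ST; have [xp _ _] := Hp k.
  exact: chain_point_between (e0 k) (ge k) S0 ST xp.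
have dist k S T : 0 <= S -> S <= T -> mdist (ck k S) (ck k T) <= T - S + e k.
  move=> S0 ST; have [r [_ <- cr]] := between k S T S0 ST.
  by apply: le_trans cr; apply: mdist_le_chain_cost.
have [U [UU oU]] := ultraFilterLemma (eventually_filter : ProperFilter \oo).
have : forall T : R, exists l : X, 0 <= T -> (fun k => ck k T) @ U --> l.
  move=> T; have [T0|T0] := leP 0 T; last by exists x.
  have UF : UltraFilter ((fun k => ck k T) @ U) by exact: ultra_fmap.
  have [|l Hl] := bounded_ultra_cvg (r := T + 2) UF.
    apply: (@filterS _ U _ setT); last exact: filterT.
    move=> k _; rewrite /= ballEmdist /=.
    rewrite -[x in mdist x _](chain_point0 (g1 k) x (p k)).
    apply: le_lt_trans (dist k 0 T (lexx _) T0) _.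
    rewrite subr0 ltrD2l; apply: (@le_lt_trans _ _ 1); last by rewrite ltr1n.
    by rewrite invf_le1// ler1n.
  by exists l.
move=> /choice[c Hc].
have near_c T eps : 0 <= T -> 0 < eps -> U [set k | mdist (c T) (ck k T) < eps].
  move=> T0 eps0; have /cvg_ballP/(_ _ eps0) := Hc T T0.
  by apply: filterS => k; rewrite /= ballEmdist.
have near_e (m : nat) eps : 0 < eps -> U [set k | (m <= k)%N /\ e k < eps].
  move=> eps0; apply: oU; exists (maxn m (Num.truncn eps^-1)) => //= k /=.
  rewrite geq_max => /andP[mk tk]; split => //.
  rewrite /e invf_plt ?posrE//; apply: lt_le_trans (truncnS_gt _) _.
  by rewrite ler_nat ltnS.
have stuck T (z : X) : 0 <= T -> (forall k, ck k T = z) -> c T = z.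
  move=> T0 cz; apply: mdist_positivity; apply/eqP.
  rewrite eq_le mdist_ge0 andbT; apply/ler_addgt0Pr => eps eps0; rewrite add0r.
  have [k] := filter_ex (near_c T eps T0 eps0).
  by rewrite /= cz => /ltW.
have tri S T k eps : mdist (c S) (ck k S) < eps -> mdist (c T) (ck k T) < eps ->
    mdist (c S) (c T) <= mdist (ck k S) (ck k T) + 2 * eps.
  move=> h1 h2; have := metric_triangle (c S) (ck k S) (c T).
  have := metric_triangle (ck k S) (ck k T) (c T).
  by rewrite (metric_sym (ck k T)); lra.
exists c; split.
- by apply: stuck => // k; exact: chain_point0.
- by apply: stuck => // k; have [_ <- ?] := Hp k; exact: chain_point_last.
- move=> S T S0 ST; have T0 : 0 <= T by exact: le_trans ST.
  apply/ler_addgt0Pr => eps eps0; have eps3 : 0 < eps / 3 by rewrite divr_gt0.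
  have [k [[h1 h2] [_ h3]]] := filter_ex (filterI
    (filterI (near_c S _ S0 eps3) (near_c T _ T0 eps3)) (near_e 0 _ eps3)).
  by have := tri S T k _ h1 h2; have := dist k S T S0 ST; rewrite /= in h3; lra.
move=> m h S S' T' h0 h1 S0 SS' ST' Th; set M : R := m.+1%:R in h1 *.
have S'0 : 0 <= S' by exact: le_trans SS'.
have T'0 : 0 <= T' by exact: le_trans ST'.
have M0 : 1 <= M by rewrite ler1n.
suff small eps : 0 < eps -> 3 * M * eps <= 1 ->
    mdist (c S') (c T') * (g m (c S) - M * h) <= T' - S' + eps * (12 * M + 3 * M * h).
  apply/ler_addgt0Pr => eta eta0.
  pose K := 12 * M + 3 * M * h.
  have Mh0 : 0 <= M * h by rewrite mulr_ge0// (le_trans ler01).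
  have K0 : 0 < K by rewrite /K; lra.
  pose eps := Num.min (3 * M)^-1 (eta / K).
  have eps0 : 0 < eps by rewrite lt_min invr_gt0 divr_gt0// andbT; lra.
  apply: (le_trans (small eps eps0 _)).
    by rewrite mulrC -ler_pdivlMr ?mul1r ?ge_min ?lexx//; lra.
  by rewrite lerD2l -ler_pdivlMr// ge_min lexx orbT.
move=> eps0 epsM.
have [k [[[c1 c2] c3] [mk c4]]] := filter_ex (filterI (filterI (filterI
  (near_c S _ S0 eps0) (near_c S' _ S'0 eps0)) (near_c T' _ T'0 eps0)) (near_e m _ eps0)).
rewrite /= in c1 c2 c3 c4 mk.
have ST := tri S' T' k _ c2 c3.
have gS := g_lip m (ck k S) (c S).
have [r [_ rT cr]] := between k S' T' S'0 ST'.
(* The vertices between the times S' and T' stay within h + 2 eps of [ck k S], where [g m], hence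
   also [g k] for k >= m, is at least b. *)
pose b := g m (ck k S) - M * (h + 2 * eps).
have gm1 := g1 m (c S).
have gmM := g_le m (ck k S).
have gSM := g1 m (ck k S).
have Md : M * mdist (ck k S) (c S) <= M * eps.
  by rewrite ler_wpM2l ?(le_trans ler01)// metric_sym ltW.
have b0 : 0 <= b by rewrite /b; lra.
have cost : b * mdist (ck k S') (last (ck k S') r) <= chain_cost (g k) (ck k S') r.
  apply: (chain_cost_lower (g1 k) cr b0) => w ww.
  apply: le_trans (g_nd w mk).
  have := g_lip m w (ck k S); have := metric_triangle (ck k S) (ck k S') w.
  have := dist k S S' S0 SS'; rewrite (metric_sym w).
  move=> u1 u2 u3; have : M * mdist (ck k S) w <= M * (h + 2 * eps).
    by rewrite ler_wpM2l ?(le_trans ler01)//; lra.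
  by rewrite /b -/M in u3 *; lra.
rewrite rT in cost.
have dS := dist k S' T' S'0 ST'.
set a := mdist (ck k S') (ck k T') in ST cost dS.
have a0 : 0 <= a by exact: mdist_ge0.
have ah : a <= h + eps by lra.
have f1 : g m (c S) - M * h <= b + 3 * (M * eps) by rewrite /b -/M in gS *; lra.
have f0 : 0 <= g m (c S) - M * h by lra.
have : mdist (c S') (c T') * (g m (c S) - M * h) <= (a + 2 * eps) * (b + 3 * (M * eps)).
  by rewrite ler_pM// mdist_ge0.
move/le_trans; apply.
have Mh0 : 0 <= M * h by rewrite mulr_ge0// (le_trans ler01).
have Me0 : 0 <= M * eps by rewrite mulr_ge0 ?(ltW eps0)// (le_trans ler01).
have bM : b <= M by rewrite /b -/M in gmM *; lra.
have p1 : M * eps * a <= M * eps * (h + eps).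
  by rewrite ler_wpM2l.
have p2 : eps * b <= eps * M by rewrite ler_wpM2l// ltW.
have p3 : eps * (3 * M * eps) <= eps * 1 by rewrite ler_wpM2l// ltW.
have p4 : eps * 1 <= eps * M by rewrite ler_wpM2l// ltW.
have -> : (a + 2 * eps) * (b + 3 * (M * eps)) =
  b * a + 3 * (M * eps * a) + 2 * (eps * b) + 2 * (eps * (3 * M * eps)) by ring.
have -> : eps * (12 * M + 3 * M * h) = 12 * (eps * M) + 3 * (M * eps * h) by ring.
have p5 : M * eps * eps <= eps * M.
  by rewrite mulrC ler_wpM2l ?(ltW eps0)//; lra.
have p6 : M * eps * (h + eps) = M * eps * h + M * eps * eps by ring.
lra.
Qed.

End LimitCurve.

Lemma ge0_integral_le_limit d (T : measurableType d) (R : realType)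
    (mu : {measure set T -> \bar R}) (D : set T) (g : (T -> \bar R)^nat)
    (f : T -> \bar R) (B : \bar R) : measurable D ->
  (forall n, measurable_fun D (g n)) -> (forall n x, D x -> (0 <= g n x)%E) ->
  (forall x, D x -> nondecreasing_seq (g ^~ x)) ->
  (forall x, D x -> g n x @[n --> \oo] --> f x) ->
  (forall n, (\int[mu]_(x in D) g n x <= B)%E) ->
  (\int[mu]_(x in D) f x <= B)%E.
Proof.
move=> mD mg g0 nd gf gB.
rewrite (_ : (\int[mu]_(x in D) f x = \int[mu]_(x in D) limn (g ^~ x))%E); last first.
  by apply: eq_integral => x; rewrite inE => Dx; apply/esym/cvg_lim => //; exact: gf.
have cv : ((\int[mu]_(x in D) g n x)%E @[n --> \oo] --> (\int[mu]_(x in D) limn (g ^~ x))%E).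
  exact: cvg_monotone_convergence.
rewrite -(cvg_lim _ cv)//; apply: lime_le; first by apply/cvg_ex; eexists; exact: cv.
by apply: nearW => n; exact: gB.
Qed.

Section LimitLineIntegral.
Context {R : realType} {X : pmetricType R}.
Variables (c : R -> X) (L : R).
Hypothesis L0 : 0 <= L.
Hypothesis c_lip : forall S T : R, 0 <= S -> S <= T -> T <= L ->
  mdist (c S) (c T) <= T - S.

(* Over a parameter interval of length h the curve has length at most
   h / (f (c S) - M h), and f is at most f (c S) + M h on it. *)
Lemma line_integral_lip_le (f : X -> R) (M : R) : 0 < M -> (forall z, 1 <= f z) ->
  (forall z w, f w <= f z + M * mdist z w) ->
  (forall h S S' T' : R, 0 <= h -> 3 * M * h <= 1 ->
    0 <= S -> S <= S' -> S' <= T' -> T' <= S + h ->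
    mdist (c S') (c T') * (f (c S) - M * h) <= T' - S') ->
  (line_integral (EFin \o f) c 0 L <= (2 * L)%:E)%E.
Proof.
move=> M0 f1 fl loc; rewrite /line_integral.
have hc : rectifiable_curve c 0 L by exact: lipschitz_rectifiable.
pose l T := fine (curve_length c 0 T); set g := arc_length_param c 0 L.
have l00 : l 0 = 0 by exact: arc_length0 hc.
have lL0 : 0 <= l L by rewrite fine_ge0// curve_length_ge0.
have gl s t : 0 <= s -> s <= t -> t <= l L -> mdist (g s) (g t) <= t - s.
  exact: arc_length_param_lip.
have cf : continuous f by exact: K_lipschitz_continuous fl.
have mF : measurable_fun `[0, l L] (fun s => (f (g s))%:E).
  by apply: (@lipschitz_borel_comp _ _ g (l L) (EFin \o f)) => //; exact: continuous_borel_fun.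
have F0 s : (0 <= (f (g s))%:E)%E by rewrite lee_fin (le_trans ler01).
pose n := (Num.truncn (3 * M * L)).+1; pose h := L / n%:R.
have n0 : 0 < n%:R :> R by rewrite ltr0n.
have h0 : 0 <= h by rewrite divr_ge0.
have h1 : 3 * M * h <= 1.
  by rewrite /h mulrA ler_pdivrMr// mul1r ltW// truncnS_gt.
have nh : h *+ n = L by rewrite -mulr_natr /h divfK// gt_eqF.
suff step i : (i <= n)%N -> (\int[lebesgue_measure]_(s in `[0%R, (l (h *+ i)%R)])
    (f (g s))%:E <= (2 * (h *+ i))%:E)%E.
  by have := step n (leqnn n); rewrite nh.
elim: i => [|i ih] iN.
  by rewrite mulr0n mulr0 l00 set_itv1 integral_set1.
set S := h *+ i; pose T := h *+ i.+1.
have TE : T = S + h by rewrite /T mulrSr.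
have S0 : 0 <= S by rewrite mulrn_wge0.
have ST : S <= T by rewrite TE lerDl.
have TL : T <= L by rewrite -nh /T -!(mulr_natr h) ler_wpM2l// ler_nat.
have lS0 : 0 <= l S by rewrite fine_ge0// curve_length_ge0.
have lST : l S <= l T by exact: (arc_length_le hc).
have lTL : l T <= l L by apply: (arc_length_le hc) => //; exact: le_trans ST.
set b := f (c S) - M * h.
have Mh : M * h <= 1 / 3 by lra.
have b0 : 2 / 3 <= b by have := f1 (c S); rewrite /b; lra.
have bp : 0 < b by lra.
have lTS : l T - l S <= h / b.
  rewrite -lee_fin -(curve_length_subE hc S0 ST TL).
  apply: le_trans (@curve_length_lip_le _ _ c S T b^-1 ST _) _.
    move=> s t Ss st tT; rewrite mulrC ler_pdivlMr//.
    by apply: loc => //; rewrite -TE.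
  by rewrite lee_fin TE [S + h]addrC addrK mulrC.
have sub p q : 0 <= p -> q <= l L -> `[p, q]%classic `<=` `[0, l L]%classic.
  move=> p0 ql s /=; rewrite !in_itv/= => /andP[ps sq].
  by rewrite (le_trans p0)//= (le_trans sq).
rewrite (ge0_integral_itv_split lS0 lST); last 2 first.
- by apply: measurable_funS mF => //; exact: sub.
- by move=> s _; exact: F0.
have -> : (2 * T)%:E = ((2 * S)%:E + (2 * h)%:E)%E by rewrite -EFinD TE mulrDr.
apply: leeD; first exact: (ih (ltnW iN)).
apply: (@le_trans _ _ (\int[lebesgue_measure]_(s in `[l S, l T]) (f (c S) + M * h)%:E)%E).
  apply: ge0_le_integral => //.
    by apply: measurable_funS mF => //; exact: sub.
  move=> s /=; rewrite in_itv/= => /andP[Ss sT]; rewrite lee_fin.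
  apply: le_trans (fl (c S) (g s)) _; rewrite lerD2l ler_wpM2l ?(ltW M0)//.
  have <- : g (l S) = c S by apply: (arc_length_paramK hc) => //; exact: le_trans TL.
  apply: le_trans (gl _ _ lS0 Ss (le_trans sT lTL)) _.
  apply: le_trans (_ : l T - l S <= h); first by rewrite lerD2r.
  rewrite -lee_fin -(curve_length_subE hc S0 ST TL).
  apply: le_trans (@curve_length_lip_le _ _ c S T 1 ST _) _.
    by move=> s1 t1 Ss1 st tT; rewrite mul1r c_lip ?(le_trans S0) ?(le_trans tT).
  by rewrite lee_fin TE [S + h]addrC addrK mul1r.
rewrite integral_cst//= lebesgue_measure_itv/= lte_fin.
have Mh0 : 0 <= M * h by rewrite mulr_ge0// ltW.
case: ifPn => [_|_]; last by rewrite mule0 lee_fin; lra.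
rewrite -EFinB -EFinM lee_fin.
apply: (@le_trans _ _ ((f (c S) + M * h) * (h / b))).
  by rewrite ler_wpM2l//; have := f1 (c S); lra.
(* This gives the factor 2: f + M h <= 2 (f - M h), because 3 M h <= 1 <= f. *)
rewrite mulrA ler_pdivrMr// mulrAC ler_wpM2r//.
by rewrite /b in b0 *; lra.
Qed.

End LimitLineIntegral.

Section ChainLimit.
Context {R : realType} {X : pmetricType R}.
Variables (rho : X -> \bar R) (u : X -> R).
Hypothesis rho_lsc : forall a : R, open [set x | (a%:E < rho x)%E].
Hypothesis rho1 : forall x, (1 <= rho x)%E.
Hypothesis u_rho : upper_gradient u rho.

Definition mesh_size (k : nat) : R := k.+1%:R^-1 * k.+1%:R^-1.

Lemma chain_dist_limit (N L : R) x y : 0 <= N -> L <= N ->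
  (forall (F : set_system X) (r : R),
    UltraFilter F -> F (ball x r) -> exists l : X, F --> l) ->
  (forall k, chain_dist (lip_approx rho k) (mesh_size k) N x y < L) ->
  `|u x - u y| <= 2 * L.
Proof.
move=> N0 LN ultra VL; have g1 k z : 1 <= lip_approx rho k z by exact: lip_approx_ge1.
have L0 : 0 <= L by apply: ltW; apply: le_lt_trans (VL 0%N); exact: chain_dist_ge0.
have chains k : exists p, [/\ path (mesh (mesh_size k)) x p, last x p = y &
    chain_cost (lip_approx rho k) x p <= L].
  have [p [xp py cp]] := chain_dist_lt (VL k) LN.
  by exists p; split => //; exact: ltW.
have [c [cx cy c_lip loc]] := limit_curve L0 g1 (lip_approx_nd rho1)
  (lip_approx_lip rho1) (lip_approx_le rho1) (fun k => erefl) ultra chains.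
have c_lip' S T : 0 <= S -> S <= T -> T <= L -> mdist (c S) (c T) <= T - S.
  by move=> S0 ST _; exact: c_lip.
have hc : rectifiable_curve c 0 L by exact: lipschitz_rectifiable.
have [mrho rho0 ug] := u_rho.
rewrite -lee_fin -cx -cy; apply: le_trans (ug _ _ _ hc) _.
rewrite /line_integral.
apply: (@ge0_integral_le_limit _ _ _ lebesgue_measure _
  (fun k s => (lip_approx rho k (arc_length_param c 0 L s))%:E)) => //.
- move=> k; apply: (@lipschitz_borel_comp _ _ _ _ (EFin \o lip_approx rho k)).
  + by rewrite fine_ge0// curve_length_ge0.
  + exact: arc_length_param_lip.
  + apply: continuous_borel_fun; exact: K_lipschitz_continuous (lip_approx_lip rho1 k).
- by move=> k s _; rewrite lee_fin (le_trans ler01).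
- by move=> s _ k l kl; rewrite lee_fin lip_approx_nd.
- by move=> s _; exact: lip_approx_cvg.
- move=> k; apply: (@line_integral_lip_le _ _ c L L0 c_lip' (lip_approx rho k) k.+1%:R) => //.
  + exact: lip_approx_lip.
  + by move=> h S S' T' h0 h1; exact: loc.
Qed.

End ChainLimit.

(** * Pointwise values bounded by averages *)

Section LebesguePoint.
Context {R : realType} {X : pmetricType R}.
Variable mu : {outer_measure set X -> \bar R}.
Variable Q : R.
Hypothesis Q_gt1 : 1 < Q.
Hypothesis mu_breg : borel_regular mu.
Hypothesis X_complete : complete_space X.
Hypothesis mu_regular : ahlfors_regular mu Q.
Hypothesis mu_poincare : poincare_inequality mu Q.
Local Notation C := (caratheodory_type mu).
Let m : {measure set C -> \bar R} := mu.
Let Q0 : 0 < Q. Proof. exact: lt_trans Q_gt1. Qed.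

Let integrable_cst (c : R) (x : X) (r : R) : mu_integrable mu (ball x r) (cst c).
Proof.
apply: (@measurable_bounded_integrable _ C R m) => //.
- exact: ball_caratheodory.
- exact: (ahlfors_ball_fin mu_regular).
- by exists `|c|; split; [exact: num_real|move=> M cM y _ /=; exact: ltW].
Qed.

Lemma ball_mean_cst (c : R) (x : X) (r : R) : 0 < r -> ball_mean mu (cst c) x r = c.
Proof.
move=> r0; rewrite /ball_mean /mu_integral.
have mB := ball_caratheodory mu_breg x r.
have -> : (\int[m]_(y in ball x r) (EFin \o cst c) y = c%:E * m (ball x r))%E.
  exact: (@integral_cst _ C R m _ mB c%:E).
rewrite fineM//; last first.
  by rewrite ge0_fin_numE ?outer_measure_ge0//; exact: (ahlfors_ball_fin mu_regular).
by rewrite /= mulrC mulfK// gt_eqF//; exact: (fine_mu_ball_gt0 mu_regular).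
Qed.

Lemma ball_meanB (u v : X -> R) (x : X) (r : R) :
  mu_integrable mu (ball x r) u -> mu_integrable mu (ball x r) v ->
  ball_mean mu (fun y => u y - v y) x r = ball_mean mu u x r - ball_mean mu v x r.
Proof.
move=> iu iv; have mB := ball_caratheodory mu_breg x r.
rewrite /ball_mean -mulrBr; congr (_ * _).
have -> : mu_integral mu (ball x r) (EFin \o (fun y => u y - v y)) =
    (mu_integral mu (ball x r) (EFin \o u) - mu_integral mu (ball x r) (EFin \o v))%E.
  by rewrite /mu_integral -(@integralB _ C R m).
by rewrite fineB//; apply: (@integrable_fin_num _ C R m).
Qed.

Lemma le_ball_mean (u v : X -> R) (x : X) (r : R) :
  mu_integrable mu (ball x r) u -> mu_integrable mu (ball x r) v ->
  (forall y, ball x r y -> u y <= v y) -> ball_mean mu u x r <= ball_mean mu v x r.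
Proof.
move=> iu iv uv; have mB := ball_caratheodory mu_breg x r.
rewrite /ball_mean ler_wpM2l ?invr_ge0 ?fine_ge0 ?outer_measure_ge0//.
apply: fine_le; [exact: (@integrable_fin_num _ C R m)|exact: (@integrable_fin_num _ C R m)|].
apply: (@le_integral _ C R m _ mB) => // y; rewrite inE /= lee_fin; exact: uv.
Qed.

Lemma ball_mean_dist (u : X -> R) (x : X) (r c : R) : 0 < r ->
  mu_integrable mu (ball x r) u ->
  `|ball_mean mu u x r - c| <= ball_mean mu (fun y => `|u y - c|) x r.
Proof.
move=> r0 iu; rewrite -{1}(ball_mean_cst c x r0) -ball_meanB//.
apply: ball_mean_norm => //.
by have := @integrableB _ C R m _ (ball_caratheodory mu_breg x r) _ _ iu (integrable_cst c x r).
Qed.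

(** Telescoping over the balls B(x, 2^-k): the mean drops from one ball to the next by at most the
    Poincare bound C0 A q^k times the ratio L of the measures, and the means tend to 0 because V <=
    M d(x, z) near x. *)
Lemma mean_le_geometric : exists C lam : R, [/\ 0 <= C, 1 <= lam &
  forall (V : X -> R) (f : X -> \bar R) (x : X) (q A M d : R),
    0 < q -> q < 1 -> 0 <= A -> 0 <= M -> 0 < d ->
    (forall (x : X) (r : R), 0 < r -> mu_integrable mu (ball x r) V) ->
    upper_gradient V f -> (forall z, 0 <= V z) ->
    (forall z, mdist x z < d -> V z <= M * mdist x z) ->
    (forall k, mu_integral mu (ball x (lam * 2^-1 ^+ k)) (fun y => f y `^ Q)%E
      <= ((A * q ^+ k) `^ Q)%:E)%E ->
    ball_mean mu V x 1 <= C * A / (1 - q)].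
Proof.
have [C0 [lam [C00 lam1 HP]]] := poincare_ball Q_gt1 mu_regular mu_poincare.
have [L L0 HL] := mu_ball_comparable Q_gt1 mu_regular.
exists (C0 * L), lam; split => //; first by rewrite mulr_ge0// ltW.
move=> V f x q A M d q0 q1 A0 M0 d0 iV ug V0 Vd fE.
pose r k : R := 2^-1 ^+ k; have r0 k : 0 < r k by rewrite exprn_gt0// invr_gt0.
have rS k : r k = 2 * r k.+1 by rewrite /r exprS mulrA mulfV ?mul1r ?pnatr_eq0.
pose a k := ball_mean mu V x (r k).
have step k : a k <= a k.+1 + C0 * L * A * q ^+ k.
  have Aq0 : 0 <= A * q ^+ k by rewrite mulr_ge0// exprn_ge0// ltW.
  have := HP V f iV ug x (r k) _ (r0 k) (powR_ge0 _ _) (fE k).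
  rewrite -powRrM mulfV ?gt_eqF// powRr1// -/(a k) => osc.
  have B0 := fine_mu_ball_gt0 mu_regular x (r0 k.+1).
  have := ball_mean_dist (a k) (r0 k.+1) (iV x _ (r0 k.+1)).
  rewrite -/(a k.+1) => dif.
  suff H : ball_mean mu (fun y => `|V y - a k|) x (r k.+1) <= C0 * L * A * q ^+ k.
    by have := le_trans dif H; rewrite ler_norml => /andP[]; lra.
  rewrite /ball_mean ler_pdivrMl//.
  have iVa s : 0 < s -> mu_integrable mu (ball x s) (fun y => `|V y - a k|).
    move=> s0; apply: mu_integrable_norm.
    by have := @integrableB _ C R m _ (ball_caratheodory mu_breg x s) _ _ (iV x s s0)
      (integrable_cst (a k) x s).
  have fn s : 0 < s -> mu_integral mu (ball x s) (EFin \o (fun y => `|V y - a k|)) \is a fin_num.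
    move=> s0; apply: (@integrable_fin_num _ C R m); [exact: ball_caratheodory|exact: iVa].
  rewrite -lee_fin (fineK (fn _ (r0 k.+1))).
  apply: (@le_trans _ _ (mu_integral mu (ball x (r k)) (fun y => `|V y - a k|%:E))).
    apply: (@ge0_subset_integral _ C R m).
    - exact: ball_caratheodory.
    - exact: ball_caratheodory.
    - by have /integrableP[] := iVa _ (r0 k).
    - by move=> y _ /=; rewrite lee_fin.
    - by apply: le_ball; rewrite (rS k) ler_peMl ?(ltW (r0 _))// ler1n.
  apply: le_trans osc _; rewrite lee_fin.
  have rr : r k <= 4 * r k.+1 by rewrite (rS k) ler_wpM2r ?(ltW (r0 _))// ler_nat.
  have := HL x x _ _ (r0 k) rr => h.
  apply: le_trans (ler_wpM2l (_ : 0 <= C0 * (A * q ^+ k)) h) _; first by rewrite mulr_ge0.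
  by rewrite le_eqVlt; apply/orP; left; apply/eqP; ring.
have K0 : 0 <= C0 * L * A by rewrite !mulr_ge0// ltW.
have sum n : a 0%N <= a n + C0 * L * A * ((1 - q ^+ n) / (1 - q)).
  elim: n => [|n ih]; first by rewrite expr0 subrr mul0r mulr0 addr0.
  apply: le_trans ih _; apply: le_trans (lerD (step n) (lexx _)) _.
  rewrite -addrA lerD2l le_eqVlt; apply/orP; left; apply/eqP.
  by rewrite exprS; field; rewrite gt_eqF// subr_gt0.
have -> : ball_mean mu V x 1 = a 0%N by rewrite /a /r expr0.
apply/ler_addgt0Pr => e e0.
have [n nd ne] : exists2 n, r n < d & M * r n <= e.
  pose D := Num.min d (e / (`|M| + 1)).
  have M1 : 0 < `|M| + 1 by rewrite ltr_wpDl.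
  have D0 : 0 < D by rewrite lt_min d0 divr_gt0.
  have := lt_pow2_log (_ : 0 < D^-1) => /(_ _)/wrap[]; first by rewrite invr_gt0.
  set n := (Num.truncn _).+1 => nD; have rD : r n < D.
    by rewrite /r exprVn invf_plt ?posrE ?exprn_gt0//.
  exists n.
  - by apply: lt_le_trans rD _; rewrite ge_min lexx.
  - apply: (@le_trans _ _ ((`|M| + 1) * r n)).
      by rewrite ler_wpM2r ?(ltW (r0 n))// (le_trans (ler_norm M))// lerDl.
    rewrite mulrC -ler_pdivlMr//; apply: le_trans (ltW rD) _.
    by rewrite ge_min lexx orbT.
apply: le_trans (sum n) _; rewrite addrC; apply: lerD; last first.
  apply: le_trans ne; rewrite -(ball_mean_cst (M * r n) x (r0 n)).
  apply: le_ball_mean; [exact: iV|exact: integrable_cst|move=> z].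
  rewrite ballEmdist /= => xz; apply: le_trans (Vd z (lt_trans xz nd)) _.
  rewrite ler_wpM2l ?(ltW xz)//.
rewrite ler_wpM2l// -[leRHS]mul1r ler_wpM2r ?invr_ge0 ?subr_ge0 ?(ltW q1)//.
by rewrite lerBlDr lerDl exprn_ge0// ltW.
Qed.

Lemma le_chain_dist (f f' : X -> R) (d d' N N' : R) x y :
  (forall z, 1 <= f z) -> (forall z, f z <= f' z) -> d' <= d -> 0 <= N -> N <= N' ->
  chain_dist f d N x y <= chain_dist f' d' N' x y.
Proof.
move=> f1 ff' dd' N0 NN'; apply: lb_le_inf; first by exists N'; left.
have cost p z : chain_cost f z p <= chain_cost f' z p.
  elim: p z => //= w p ih z; apply: lerD (ih w).
  by rewrite ler_wpM2r ?mdist_ge0.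
move=> _ [->|[p [xp py ->]]]; first by rewrite (le_trans _ NN')// chain_dist_leN.
apply: le_trans (cost p x); rewrite -py; apply: chain_dist_le => //.
by apply: sub_path xp => a b ab; exact: lt_le_trans dd'.
Qed.

(** Half of |u x - u y| is at most the supremum over k of the chain distances [V k y], whose mean
    over B(x, 1) is bounded by monotone convergence. The factor 1/2 is the 2 in the bound 2 L for
    the limit curve. *)
Lemma norm_le_mean_norm : exists C lam : R, [/\ 0 <= C, 1 <= lam &
  forall (u : X -> R) (rho : X -> \bar R) (x : X) (q A : R),
    (forall (x : X) (r : R), 0 < r -> mu_integrable mu (ball x r) u) ->
    upper_gradient u rho -> (forall z, (1 <= rho z)%E) ->
    (forall a : R, open [set z | (a%:E < rho z)%E]) ->
    0 < q -> q < 1 -> 0 <= A ->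
    (forall k, mu_integral mu (ball x (lam * 2^-1 ^+ k)) (fun y => rho y `^ Q)%E
      <= ((A * q ^+ k) `^ Q)%:E)%E ->
    `|u x| <= ball_mean mu (fun y => `|u y|) x 1 + C * A / (1 - q)].
Proof.
have [C0 [lam [C00 lam1 HM]]] := mean_le_geometric.
exists (2 * C0), lam; split => //; first by rewrite mulr_ge0.
move=> u rho x q A iu ug rho1 lsc q0 q1 A0 rhoE.
have mrho : borel_fun rho by case: ug.
pose f k := lip_approx rho k; have f1 k z : 1 <= f k z by exact: lip_approx_ge1.
have d0 k : 0 < mesh_size k :> R by rewrite /mesh_size mulr_gt0 ?invr_gt0.
(* As k grows, the weight increases, the mesh shrinks and the truncation level k rises, so [V k]
   increases; each [V k] is bounded, hence integrable on balls. *)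
pose V k := chain_dist (f k) (mesh_size k) k%:R x.
have V0 k y : 0 <= V k y by exact: chain_dist_ge0.
have ugV k : upper_gradient (V k) (EFin \o f k).
  by apply: (chain_dist_upper_gradient x (f1 k) (ler0n _ _) (ler0n _ k.+1) (d0 k));
    exact: lip_approx_lip.
have cV k : continuous (V k).
  exact: (chain_dist_continuous (f1 k) (ler0n _ _) (ler0n _ k.+1) (d0 k)
    (lip_approx_lip rho1 k)).
have mV k : measurable_fun [set: C] (V k).
  apply/measurable_EFinP; apply: (borel_fun_caratheodory mu_breg).
  exact: continuous_borel_fun.
have iV k z r : mu_integrable mu (ball z r) (V k).
  apply: (@measurable_bounded_integrable _ C R m) => //.
  - exact: ball_caratheodory.
  - exact: (ahlfors_ball_fin mu_regular).
  - exact: measurable_funTS.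
  - exists k%:R; split; first exact: num_real.
    move=> M kM y _ /=; rewrite ger0_norm//; apply: ltW; apply: le_lt_trans kM.
    exact: chain_dist_leN.
have mpow g (B : set X) : borel_fun g -> measurable_fun (B : set C) (fun y => (g y `^ Q)%E).
  by move=> bg; apply: measurable_funTS; exact: (measurable_poweR_borel Q mu_breg bg).
have meanV k : ball_mean mu (V k) x 1 <= C0 * A / (1 - q).
  (* A single edge from x to z gives V k z <= f k x d(x, z) at distances below the mesh. *)
  apply: (HM (V k) (EFin \o f k) x q A (f k x) (mesh_size k)) => //.
  - exact: le_trans (f1 k x).
  - move=> z xz; have := chain_dist_step (f1 k) x (ler0n _ k) xz.
    suff -> : chain_dist (f k) (mesh_size k) k%:R x x = 0 by rewrite add0r.
    apply/le_anti; rewrite chain_dist_ge0// andbT.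
    by have := @chain_dist_le _ _ (f k) (f1 k) (mesh_size k) k%:R x (ler0n _ _) [::] isT.
  move=> j; apply: le_trans (rhoE j).
  apply: (@ge0_le_integral _ C R m).
  - exact: ball_caratheodory.
  - by move=> y _; exact: poweR_ge0.
  - by apply: mpow; case: (ugV k).
  - exact: mpow.
  - move=> y _; apply: gt0_ler_poweR.
    + exact: ltW.
    + by rewrite in_itv/= leey andbT lee_fin (le_trans ler01).
    + by rewrite in_itv/= leey andbT (le_trans _ (rho1 y)).
    + exact: lip_approx_le_rho.
have ndV y : nondecreasing_seq (fun k => (V k y)%:E).
  move=> k l kl; rewrite lee_fin; apply: le_chain_dist => //.
  - by move=> z; exact: lip_approx_nd.
  - by rewrite /mesh_size ler_pM// lef_pV2 ?posrE// ler_nat.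
  - by rewrite ler_nat.
pose S y := ereal_sup (range (fun k => (V k y)%:E)).
have WS y : ((`|u x - u y| / 2)%:E <= S y)%E.
  rewrite leNgt; apply/negP => SW.
  have S0 : (0 <= S y)%E.
    apply: le_trans (_ : ((V 0%N y)%:E <= S y)%E); first by rewrite lee_fin.
    by apply: ereal_sup_ubound; exists 0%N.
  have [L SL LW] : exists2 L : R, (S y < L%:E)%E & L < `|u x - u y| / 2.
    case: (S y) S0 SW => [s| |]// _; rewrite lte_fin => sW.
    by exists ((s + `|u x - u y| / 2) / 2); rewrite ?lte_fin midf_lt.
  have VL k : V k y < L.
    by rewrite -lte_fin; apply: le_lt_trans SL; apply: ereal_sup_ubound; exists k.
  (* The limit argument needs one truncation level N >= L for all k; the distance truncated at N is
     dominated by [V] at the index max(k, N). *)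
  pose N := (Num.truncn L).+1.
  have LN : L <= N%:R by rewrite ltW// truncnS_gt.
  have ultra (F : set_system X) (r : R) : UltraFilter F -> F (ball x r) ->
      exists l : X, F --> l.
    exact: (ultra_bounded_cvg mu_breg X_complete mu_regular).
  have VN k : chain_dist (lip_approx rho k) (mesh_size k) N%:R x y < L.
    apply: le_lt_trans (VL (maxn k N)); apply: le_chain_dist => //.
    + by move=> z; apply: lip_approx_nd => //; exact: leq_maxl.
    + by rewrite /mesh_size ler_pM// lef_pV2 ?posrE// ler_nat ltnS leq_maxl.
    + by rewrite ler_nat leq_maxr.
  have := chain_dist_limit lsc rho1 ug (ler0n _ _) LN ultra VN.
  by move: LW; rewrite ltr_pdivlMr// mulrC => /lt_le_trans h /h; rewrite ltxx.
have mB := ball_caratheodory mu_breg x 1.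
have B0 := fine_mu_ball_gt0 mu_regular x ltr01.
have iW : mu_integrable mu (ball x 1) (fun y => `|u x - u y|).
  apply: mu_integrable_norm.
  by have := @integrableB _ C R m _ mB _ _ (integrable_cst (u x) x 1) (iu x 1 ltr01).
have iW2 : mu_integrable mu (ball x 1) (fun y => `|u x - u y| / 2).
  have := @integrableZl _ C R m _ mB (2^-1) _ iW.
  by apply: eq_integrable => // y _ /=; rewrite -EFinM mulrC.
have meanW : ball_mean mu (fun y => `|u x - u y| / 2) x 1 <= C0 * A / (1 - q).
  rewrite /ball_mean ler_pdivrMl// -lee_fin fineK; last first.
    by apply: (@integrable_fin_num _ C R m).
  apply: (@le_trans _ _ (\int[m]_(y in ball x 1) S y)%E).
    apply: (@ge0_le_integral _ C R m) => //.
    - by move=> y _; rewrite /= lee_fin divr_ge0.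
    - by have /integrableP[] := iW2.
    - apply: (@emeasurable_fun_cvg _ C R _ (fun k y => (V k y)%:E)) => [k|y _].
        by apply: measurable_funTS; apply/measurable_EFinP.
      exact: ereal_nondecreasing_cvgn.
    - by move=> y _; exact: WS.
  apply: (@ge0_integral_le_limit _ C R m (ball x 1) (fun k y => (V k y)%:E)) => //.
  - by move=> k; apply: measurable_funTS; apply/measurable_EFinP.
  - by move=> k y _; rewrite lee_fin.
  - by move=> y _; apply: ereal_nondecreasing_cvgn.
  - move=> k; have := meanV k; rewrite /ball_mean ler_pdivrMl// -lee_fin fineK//.
    exact: (@integrable_fin_num _ C R m _ mB _ (iV k x 1)).
have -> : 2 * C0 * A / (1 - q) = C0 * A / (1 - q) + C0 * A / (1 - q) by rewrite -!mulrA mulr_natl mulr2n.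
pose W2 y : R := `|u x - u y| / 2; pose H y : R := `|u y| + W2 y.
have iu1 := mu_integrable_norm (iu x 1 ltr01).
have iH : mu_integrable mu (ball x 1) H.
  by have := @integrableD _ C R m _ mB _ _ iu1 iW2.
have HE : ball_mean mu H x 1 - ball_mean mu W2 x 1 = ball_mean mu (fun y => `|u y|) x 1.
  rewrite -ball_meanB//; congr (ball_mean mu _ x 1).
  by apply/funext => y; rewrite /H addrK.
have : ball_mean mu (fun y => `|u x| - W2 y) x 1 <= ball_mean mu H x 1.
  apply: le_ball_mean => //.
    by have := @integrableB _ C R m _ mB _ _ (integrable_cst `|u x| x 1) iW2.
  move=> y _; rewrite /H lerBlDr -addrA /W2 -splitr -lerBlDl.
  exact: lerB_dist.
have -> : ball_mean mu (fun y => `|u x| - W2 y) x 1 = `|u x| - ball_mean mu W2 x 1.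
  by have := ball_meanB (integrable_cst `|u x| x 1) iW2; rewrite ball_mean_cst.
rewrite lerBlDr -HE -addrA => /le_trans; apply.
by rewrite lerD2l -lerBlDl opprK lerD.
Qed.

End LebesguePoint.

(** * Thin sets *)

Lemma nneseries_le_geometric (R : realType) (f : nat -> \bar R) (a z : R) :
  0 <= a -> 0 < z -> z < 1 -> (forall k, (0 <= f k)%E) ->
  (forall k, (f k <= (a * z ^+ k)%:E)%E) ->
  (\sum_(0 <= k <oo) f k <= (a / (1 - z))%:E)%E.
Proof.
move=> a0 z0 z1 f0 fz; apply: lime_le; first exact: is_cvg_nneseries.
apply: nearW => n; apply: (@le_trans _ _ (\sum_(0 <= k < n) (a * z ^+ k)%:E)%E).
  exact: lee_sum.
rewrite sumEFin lee_fin; have := @geometric_le_lim R n a z a0 z0.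
by rewrite /series/=; apply; rewrite gtr0_norm.
Qed.

Section Content.
Context {R : realType} {X : pmetricType R}.

Lemma hausdorff_content_ge0 (alpha : R) (F : set X) :
  (0 <= hausdorff_content alpha F)%E.
Proof.
apply: le_ereal_inf_tmp => _ [K [x [r [r0 _ ->]]]].
by apply: esum_ge0 => k _; rewrite lee_fin powR_ge0.
Qed.

(** The balls of all scales form one countable cover, indexed by the codes of the pairs (k, i) with
    i a position in the list [s k]. Allowing an arbitrary index set in the content lets [K] consist
    of exactly these codes. *)
Lemma hausdorff_content_le_series (alpha : R) (F : set X) (s : nat -> seq X)
    (r : nat -> R) : (forall k, 0 < r k) ->
  (forall y, F y -> exists k x, x \in s k /\ mdist x y < r k) ->
  (hausdorff_content alpha F <=
   \sum_(0 <= k <oo) ((size (s k))%:R * r k `^ alpha)%:E)%E.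
Proof.
move=> r0 Fs.
pose D := [set: nat] `*`` (fun k => `I_(size (s k))).
pose idx n : nat * nat := odflt (0, 0)%N (unpickle n).
have idxK p : idx (pickle p) = p by rewrite /idx pickleK.
pose K : set nat := pickle @` D.
apply: ereal_inf_lbound.
exists K, (fun n => nth (point : X) (s (idx n).1) (idx n).2), (fun n => r (idx n).1).
split => //.
  move=> y /Fs[k [x [xs xy]]]; exists (pickle (k, index x (s k))).
    by exists (k, index x (s k)) => //=; split => //=; rewrite index_mem.
  by rewrite idxK/= nth_index// ballEmdist.
rewrite esum_image; last first.
  by move=> p q _ _ pq; rewrite -(idxK p) pq idxK.
under eq_esum do rewrite idxK.
rewrite -(@esum_esum _ _ _ setT (fun k => `I_(size (s k)))
  (fun k _ => (r k `^ alpha)%:E)); last by move=> k i _ _; rewrite lee_fin powR_ge0.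
rewrite nneseries_esumT; last by move=> k; rewrite lee_fin mulr_ge0// powR_ge0.
apply: eq_esum => k _; rewrite esum_fset//; last by move=> i _; rewrite lee_fin powR_ge0.
by rewrite -fsbig_ord sumEFin sumr_const card_ord mulr_natl.
Qed.

End Content.

Lemma powR_exprn (R : realType) (a b : R) (k : nat) : 0 <= a ->
  (a ^+ k) `^ b = (a `^ b) ^+ k.
Proof.
move=> a0; rewrite -powR_mulrn// -powRrM mulrC powRrM powR_mulrn//.
exact: powR_ge0.
Qed.

(** * Covering and thinness of the exceptional set *)

Section ExceptionalSet.
Context {R : realType} {X : pmetricType R}.
Variable mu : {outer_measure set X -> \bar R}.
Hypothesis mu_breg : borel_regular mu.
Local Notation C := (caratheodory_type mu).
Let m : {measure set C -> \bar R} := mu.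
Variable G : X -> \bar R.
Hypothesis G0 : forall x, (0 <= G x)%E.
Hypothesis mG : measurable_fun [set: C] G.
Variable I : R.
Hypothesis IG : (mu_integral mu setT G <= I%:E)%E.

(** Take the centres from a maximal r-separated subset of F: their balls of radius r/2 are disjoint,
    and each holds more than th of a total mass at most I. *)
Lemma excess_cover (F : set X) (r th : R) : 0 < r -> 0 < th ->
  (forall x, F x -> (th%:E < mu_integral mu (ball x (r / 2)) G)%E) ->
  exists s : seq X, (size s)%:R * th <= I /\
    forall y, F y -> exists2 x, x \in s & mdist x y < r.
Proof.
move=> r0 th0 Fth.
have pack s : separated r s -> (forall x, x \in s -> F x) -> (size s)%:R * th <= I.
  move=> ss sF; rewrite -lee_fin; apply: le_trans IG.
  apply: (@packing_le _ _ (measurable : set (set C)) (fun A => mu_integral mu A G) r) => //.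
  - by move=> B; apply: integral_ge0.
  - move=> B D mB oD DB; have mD : measurable (D : set C) by exact: open_caratheodory.
    have mBD : measurable (B `\` D : set C) by exact: measurableD.
    split => //; rewrite /mu_integral -(@ge0_integral_setU _ C R m)//.
    + by rewrite setDUK.
    + by rewrite setDUK//; exact: measurable_funTS.
    + by apply/disj_setPS => z [? []].
  - by move=> x; exact: open_mball.
  - by move=> x /sF/Fth/ltW.
have [|s [ss sF Fs]] := @maximal_separated R X r F (Num.truncn (I / th)).+1 r0.
  move=> s ss sF; have := pack s ss sF; rewrite -ler_pdivlMr// => H.
  by rewrite -(ler_nat R); apply: le_trans H (ltW (truncnS_gt _)).
by exists s; split; [exact: pack|exact: Fs].
Qed.

(** The points that exceed the threshold at scale k are covered by at most I q^(-kQ) balls of radius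
    2 lam 2^-k. Their contribution to the content is I (2 lam)^alpha times the k-th power of q^(-Q)
    2^(-alpha), so the scales form a convergent geometric series. *)
Lemma exceptional_content (F : set X) (Q q lam alpha : R) : 0 < q -> 0 < lam ->
  q `^ (- Q) * 2 `^ (- alpha) < 1 ->
  (forall x, F x -> exists k : nat,
    (((q ^+ k) `^ Q)%:E < mu_integral mu (ball x (lam * 2^-1 ^+ k)) G)%E) ->
  (hausdorff_content alpha F <=
    (I * (2 * lam) `^ alpha / (1 - q `^ (- Q) * 2 `^ (- alpha)))%:E)%E.
Proof.
move=> q0 lam0 th1 FE; set z := q `^ (- Q) * 2 `^ (- alpha) in th1 *.
pose r k : R := 2 * lam * 2^-1 ^+ k.
have r0 k : 0 < r k by rewrite mulr_gt0 ?mulr_gt0// exprn_gt0// invr_gt0.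
have r2 k : r k / 2 = lam * 2^-1 ^+ k by rewrite /r; set t := (2^-1 ^+ k); field.
pose th k := (q ^+ k) `^ Q; have th0 k : 0 < th k by rewrite powR_gt0// exprn_gt0.
pose Fk k := [set x | F x /\ ((th k)%:E < mu_integral mu (ball x (r k / 2)) G)%E].
have /choice[s Hs] : forall k, exists s : seq X, (size s)%:R * th k <= I /\
    forall y, Fk k y -> exists2 x, x \in s & mdist x y < r k.
  by move=> k; apply: excess_cover => // x [].
apply: (le_trans (@hausdorff_content_le_series _ _ alpha F s r r0 _)).
  move=> y Fy; have [k yk] := FE y Fy; exists k.
  by have [|x] := (Hs k).2 y; [split => //; rewrite r2|exists x].
have I0 : 0 <= I.
  by apply: le_trans (Hs 0%N).1; rewrite mulr_ge0// ltW.
apply: nneseries_le_geometric => //.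
- by rewrite mulr_ge0// powR_ge0.
- by rewrite mulr_gt0// powR_gt0.
- by move=> k; rewrite lee_fin mulr_ge0// powR_ge0.
move=> k; rewrite lee_fin /r powRM ?mulr_ge0 ?(ltW lam0)// ?exprn_ge0 ?invr_ge0//.
rewrite powR_exprn ?invr_ge0//.
have -> : 2^-1 `^ alpha = 2 `^ (- alpha) :> R.
  by rewrite -powR_inv1// -powRrM mulN1r.
have -> : z ^+ k = (th k)^-1 * (2 `^ (- alpha)) ^+ k.
  by rewrite /z exprMn /th powR_exprn ?ltW// powRN exprVn.
rewrite mulrACA mulrA -[leLHS]mulrA -mulrA [leRHS]mulrA.
rewrite ler_wpM2r ?mulr_ge0 ?exprn_ge0 ?powR_ge0//.
by rewrite ler_pdivlMr//; have [] := Hs k.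
Qed.

End ExceptionalSet.

Section ThinExceptionalSet.
Context {R : realType} {X : pmetricType R}.
Variable mu : {outer_measure set X -> \bar R}.
Hypothesis mu_breg : borel_regular mu.
Local Notation C := (caratheodory_type mu).

(** Far out, q is so close to 1 that the content of the set in an annulus has a bound B independent
    of the annulus. Division by the radius to the power alpha then leaves the tail of a geometric
    series of ratio 2^(-alpha). *)
Lemma thin_exceptional_set (O : X) (Q lam : R) (G : X -> \bar R) (q : R -> R) :
  0 < Q -> 0 < lam ->
  (forall x, 0 <= G x)%E -> measurable_fun [set: C] G ->
  (mu_integral mu setT G < +oo)%E ->
  (forall t, 0 <= q t) -> (forall s t, 1 <= s -> s <= t -> q s <= q t) ->
  (forall e : R, e < 1 -> exists T, forall t, T <= t -> e <= q t) ->
  thin_set O Q [set x | exists k : nat, (((q (mdist O x) ^+ k) `^ Q)%:E <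
    mu_integral mu (ball x (lam * 2^-1 ^+ k)) G)%E].
Proof.
move=> Q0 lam0 G0 mG IG q0 qnd qlim; set E := [set x | _].
exists 1 => // alpha /andP[al0 alQ].
set w : R := 2 `^ (- alpha).
have w0 : 0 < w by exact: powR_gt0.
have lt1 (a : R) : 0 < a -> 2 `^ (- a) < 1 :> R.
  move=> a0; rewrite powRN invf_lt1 ?powR_gt0//.
  by rewrite -ltr_ln ?posrE ?powR_gt0// ln1 ln_powR mulr_gt0// ln_gt0// ltr1n.
have w1 : w < 1 by exact: lt1.
set v : R := 2 `^ (- (alpha / 2)).
have v1 : v < 1 by apply: lt1; rewrite divr_gt0.
pose I := fine (mu_integral mu setT G).
have IGE : (mu_integral mu setT G <= I%:E)%E.
  by rewrite fineK// ge0_fin_numE//; exact: integral_ge0.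
have I0 : 0 <= I by rewrite fine_ge0//; exact: integral_ge0.
pose B := I * (2 * lam) `^ alpha / (1 - v).
have B0 : 0 <= B by rewrite !mulr_ge0 ?powR_ge0// invr_ge0 subr_ge0 ltW.
pose f j := (hausdorff_content alpha (E `&` annulus O (1 * 2 ^+ j.+1)%R)
  / ((1 * 2 ^+ j.+1) `^ alpha)%:E)%E.
have pw0 j : 0 < ((1 * 2 ^+ j.+1) `^ alpha : R) by rewrite powR_gt0// mul1r exprn_gt0.
have f0 j : (0 <= f j)%E.
  by rewrite /f mule_ge0 ?hausdorff_content_ge0// inver gt_eqF// lee_fin invr_ge0 ltW.
(* Chosen so that e^(-Q) 2^(-alpha) = 2^(-alpha/2) = v: half of alpha is spent on the growth of the
   number of balls. *)
pose e : R := 2 `^ (- (alpha / 2 / Q)).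
have [T HT] : exists T, forall t, T <= t -> e <= q t.
  by apply: qlim; apply: lt1; rewrite !divr_gt0.
pose J := Num.truncn T.
have JT j : (J <= j)%N -> T <= 2 ^+ j.+1.
  move=> Jj; apply: (@le_trans _ _ j.+1%:R).
    by apply: le_trans (ltW (truncnS_gt _)) _; rewrite ler_nat ltnS.
  by rewrite -natrX ler_nat ltnW// ltn_expl.
have fB j : (J <= j)%N -> (f j <= (B * w * w ^+ j)%:E)%E.
  move=> Jj; have eq := HT _ (JT j Jj); set qj := q _ in eq.
  have e0 : 0 < e by exact: powR_gt0.
  have qj0 : 0 < qj by exact: lt_le_trans eq.
  have zv : qj `^ (- Q) * w <= v.
    apply: (@le_trans _ _ (e `^ (- Q) * w)).
      rewrite ler_wpM2r ?(ltW w0)// !powRN lef_pV2 ?posrE ?powR_gt0//.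
      by rewrite ge0_ler_powR// ?nnegrE ltW.
    rewrite /e -powRrM mulrNN divfK ?gt_eqF// /w -powRD; last first.
      by rewrite pnatr_eq0 implybT.
    by rewrite (_ : alpha / 2 + - alpha = - (alpha / 2))//; field.
  have z1 : qj `^ (- Q) * w < 1 by exact: le_lt_trans v1.
  rewrite /f inver gt_eqF//.
  have -> : B * w * w ^+ j = B * ((1 * 2 ^+ j.+1) `^ alpha)^-1.
    by rewrite mul1r powR_exprn// -mulrA -exprS /w powRN exprVn.
  rewrite EFinM; apply: lee_wpmul2r; first by rewrite lee_fin invr_ge0 ltW.
  apply: (le_trans (@exceptional_content _ _ mu mu_breg G G0 mG I IGE _ Q qj lam alpha qj0 lam0 z1 _)).
    (* A point of the annulus has |x| >= 2^(j+1), so the threshold at x is at least the one for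
       [qj], and exceeding the former means exceeding the latter. *)
    move=> x [[k Ek] [_ nx]]; exists k; apply: le_lt_trans Ek.
    rewrite lee_fin ge0_ler_powR ?nnegrE ?exprn_ge0// ?(ltW qj0) ?(ltW Q0)//.
    rewrite lerXn2r ?nnegrE ?(ltW qj0)//; apply: qnd; first by rewrite exprn_ege1// ler1n.
    by move: nx; rewrite ballEmdist /= mul1r => /negP; rewrite -leNgt.
  rewrite lee_fin /B ler_wpM2l ?mulr_ge0 ?powR_ge0// lef_pV2 ?posrE ?subr_gt0//.
  by rewrite lerD2l lerN2.
pose g j := (B * w * w ^+ j)%:E.
have Bw0 : 0 <= B * w by exact: mulr_ge0 B0 (ltW w0).
have g0 j : (0 <= g j)%E by rewrite lee_fin; exact: mulr_ge0 Bw0 (exprn_ge0 j (ltW w0)).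
apply: (@squeeze_cvge _ _ _ _ (cst 0%E) _ (fun N => \sum_(N <= j <oo) g j)%E).
- exists J => // N /= JN; apply/andP; split.
    by apply: nneseries_ge0 => j _ _; exact: f0.
  apply: lee_lim.
  + by apply: is_cvg_nneseries => j _ _; exact: f0.
  + by apply: is_cvg_nneseries => j _ _; exact: g0.
  + apply: nearW => n; rewrite big_nat [leRHS]big_nat.
    by apply: lee_sum => j /andP[Nj _]; apply: fB; exact: leq_trans Nj.
- exact: cvg_cst.
- apply: nneseries_tail_cvg => //.
  apply: (@le_lt_trans _ _ (B * w / (1 - w))%:E); last by rewrite ltry.
  exact: nneseries_le_geometric.
Qed.

End ThinExceptionalSet.

Section LowerSemicontinuousGradient.
Context {R : realType} {X : pmetricType R}.

Lemma le_upper_gradient (u : X -> R) (rho rho' : X -> \bar R) :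
  upper_gradient u rho -> borel_fun rho' -> (forall x, rho x <= rho' x)%E ->
  upper_gradient u rho'.
Proof.
move=> [mrho rho0 ug] mrho' le; split => // [x|c a b hc].
  exact: le_trans (le x).
apply: le_trans (ug c a b hc) _; rewrite /line_integral.
have l0 : 0 <= fine (curve_length c a b).
  by rewrite fine_ge0// curve_length_ge0//; case: hc.
have mcomp (f : X -> \bar R) : borel_fun f ->
    measurable_fun `[0, fine (curve_length c a b)] (f \o arc_length_param c a b).
  by move=> mf; apply: lipschitz_borel_comp => //; exact: arc_length_param_lip.
by apply: ge0_le_integral => //; exact: mcomp.
Qed.

Variable mu : {outer_measure set X -> \bar R}.
Hypothesis mu_breg : borel_regular mu.
Hypothesis mu_ball_fin : forall (x : X) (r : R), (mu (ball x r) < +oo)%E.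

(* Vitali-Caratheodory: the gradient can be enlarged to a lower semicontinuous
   one of the form (1 + G)^(1/Q) with G integrable. *)
Lemma lsc_upper_gradient (Q : R) (u : X -> R) (rho : X -> \bar R) : 0 < Q ->
  upper_gradient u rho -> (mu_integral mu setT (fun x => rho x `^ Q) < +oo)%E ->
  exists G rho' : X -> \bar R,
    [/\ forall x, (0 <= G x)%E, borel_fun G, (mu_integral mu setT G < +oo)%E,
      upper_gradient u rho' &
      [/\ forall x, (1 <= rho' x)%E, forall a : R, open [set x | (a%:E < rho' x)%E] &
        forall x, (rho' x `^ Q = 1 + G x)%E]].
Proof.
move=> Q0 ug Irho; have [mrho rho0 _] := ug.
have mrhoQ : borel_fun (fun x => rho x `^ Q)%E.
  by apply: (measurableT_comp (measurable_poweR _)).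
have [|G [G0 lsc le IG]] := lsc_majorant mu_breg mu_ball_fin point mrhoQ _ Irho.
  by move=> x; exact: poweR_ge0.
have V0 : 0 < Q^-1 by rewrite invr_gt0.
have G1 x : (1 <= 1 + G x)%E by rewrite leeDl.
have G10 x : (0 <= 1 + G x)%E by apply: le_trans (G1 x).
have mono (r : R) (x y : \bar R) : 0 < r -> (0 <= x)%E -> (x <= y)%E -> (x `^ r <= y `^ r)%E.
  move=> r0 x0 xy; apply: gt0_ler_poweR => //; first exact: ltW.
    by rewrite in_itv/= leey andbT.
  by rewrite in_itv/= leey andbT (le_trans x0).
pose rho' x := ((1 + G x) `^ Q^-1)%E.
have rho'Q x : (rho' x `^ Q = 1 + G x)%E.
  by rewrite /rho' -poweRrM mulVf ?gt_eqF// poweRe1.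
have rho'1 x : (1 <= rho' x)%E by rewrite -[leLHS](poweR1r Q^-1); exact: mono.
have lsc' (a : R) : open [set x | (a%:E < rho' x)%E].
  have [a1|a1] := ltP a 1.
    rewrite (_ : [set x | _] = setT); first exact: openT.
    by apply/seteqP; split => // x _ /=; apply: lt_le_trans (rho'1 x); rewrite lte_fin.
  rewrite (_ : [set x | _] = [set x | ((a `^ Q - 1)%:E < G x)%E]); first exact: lsc.
  have a0 : (0 <= a%:E)%E by rewrite lee_fin (le_trans ler01).
  apply: eq_set => x; rewrite !ltNge; congr (is_true (~~ _)).
  apply: (@etrans _ _ (1 + G x <= (a `^ Q)%:E)%E).
    apply/idP/idP => [H|H].
      by rewrite -rho'Q -poweR_EFin; apply: mono => //; rewrite (le_trans _ (rho'1 x)).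
    rewrite /rho' -[a%:E]poweRe1// -[X in (_ <= _ `^ X)%E](@mulfV _ Q) ?gt_eqF//.
    by rewrite poweRrM; apply: mono => //; rewrite poweR_EFin.
  have := G0 x; case: (G x) => [r| |]// _.
  by rewrite -EFinD !lee_fin lerBrDl.
exists G, rho'; split => //; first exact: lsc_borel_fun.
apply: le_upper_gradient ug _ _; first exact: lsc_borel_fun.
move=> x; rewrite -[rho x]poweRe1// -(@mulfV _ Q) ?gt_eqF// poweRrM.
by apply: mono => //; exact: poweR_ge0.
Qed.

End LowerSemicontinuousGradient.

(** * The pointwise limit off a thin set *)

Section NormLimit.
Context {R : realType} {X : pmetricType R}.
Variable mu : {outer_measure set X -> \bar R}.
Variable Q : R.
Hypothesis Q_gt1 : 1 < Q.
Hypothesis mu_breg : borel_regular mu.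
Hypothesis X_complete : complete_space X.
Hypothesis mu_regular : ahlfors_regular mu Q.
Hypothesis mu_poincare : poincare_inequality mu Q.
Local Notation C := (caratheodory_type mu).
Let m : {measure set C -> \bar R} := mu.
Let Q0 : 0 < Q. Proof. exact: lt_trans Q_gt1. Qed.

Lemma norm_limit (O : X) (u : X -> R) : dotN1 mu Q u ->
  exists E : set X, thin_set O Q E /\
    `|u x / ln (mdist O x) `^ ((Q - 1) / Q)|
      @[x --> within (~` E) (at_infinity O)] --> (0 : R).
Proof.
move=> Nu; have [lu [rho ugrho Irho]] := Nu.
set p := (Q - 1) / Q; have p0 : 0 < p by rewrite divr_gt0// subr_gt0.
have p20 : 0 < p / 2 by rewrite divr_gt0.
have [G [rho' [G0 bG IG ug [rho1 lsc rhoQ]]]] := lsc_upper_gradient mu_breg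
  (ahlfors_ball_fin mu_regular) Q0 ugrho Irho.
have mG : measurable_fun [set: C] G by exact: (borel_fun_caratheodory mu_breg).
have iu x r : 0 < r -> mu_integrable mu (ball x r) u.
  by move=> _; exact: (loc_integrable_ball mu_breg X_complete mu_regular lu).
have [K [lam [K0 lam1 HK]]] :=
  norm_le_mean_norm Q_gt1 mu_breg X_complete mu_regular mu_poincare.
have lam0 : 0 < lam by exact: lt_le_trans lam1.
have [CA CA1 HA] := ahlfors_fine mu_regular.
have CA0 : 0 < CA by exact: lt_le_trans CA1.
(* This is 1 / (1 - q). It has to tend to infinity and yet be o((ln t)^p), hence the exponent p/2;
   the summand 2 gives q >= 1/2. *)
pose tau t : R := 2 + ln t `^ (p / 2).
have tau2 t : 2 <= tau t by rewrite lerDl powR_ge0.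
have tau0 t : 0 < tau t by apply: lt_le_trans (tau2 t).
pose q t : R := 1 - (tau t)^-1.
have q2 t : 2^-1 <= q t.
  have : (tau t)^-1 <= 2^-1 by rewrite lef_pV2 ?posrE.
  by rewrite /q => ?; lra.
have q0 t : 0 < q t by apply: lt_le_trans (q2 t); rewrite invr_gt0.
have q1 t : q t < 1 by rewrite /q gtrBl invr_gt0.
have qnd s t : 1 <= s -> s <= t -> q s <= q t.
  move=> s1 st; have s0 : 0 < s by exact: lt_le_trans s1.
  rewrite /q lerD2l lerN2 lef_pV2 ?posrE// /tau lerD2l.
  rewrite ge0_ler_powR ?nnegrE ?(ltW p20) ?ln_ge0 ?(le_trans s1)//.
  by rewrite ler_ln ?posrE// (lt_le_trans s0).
have qlim (e : R) : e < 1 -> exists T, forall t, T <= t -> e <= q t.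
  move=> e1; have [M M1 HM] := powR_unbounded (1 - e)^-1 ltr01 p20.
  exists (expR (M + 1)) => t Mt; have t0 : 0 < t by exact: lt_le_trans (expR_gt0 _) Mt.
  have lt : M < ln t.
    apply: (@lt_le_trans _ _ (M + 1)); first by rewrite ltrDl.
    by rewrite -(expRK (M + 1)) ler_ln ?posrE ?expR_gt0.
  have := HM _ lt; rewrite mul1r => h.
  have : (tau t)^-1 <= 1 - e.
    rewrite -[leRHS]invrK lef_pV2 ?posrE ?invr_gt0 ?subr_gt0//.
    by apply: le_trans h _; rewrite /tau lerDr.
  by rewrite /q => ?; lra.
pose E := [set x | exists k : nat, (((q (mdist O x) ^+ k) `^ Q)%:E <
    mu_integral mu (ball x (lam * 2^-1 ^+ k)) G)%E].
exists E; split.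
  by apply: (thin_exceptional_set mu_breg) => // t; exact: ltW.
(* From rho'^Q = 1 + G: on B(x, lam 2^-k) the 1 integrates to at most CA lam^Q 2^(-kQ), hence to at
   most CA lam^Q q^(kQ) because q >= 1/2, and off E the function G integrates to at most q^(kQ). *)
pose A := (CA * lam `^ Q + 1) `^ Q^-1.
have A0 : 0 <= A by exact: powR_ge0.
have bound x : ~ E x -> `|u x| <= ball_mean mu (fun y => `|u y|) x 1 + K * A * tau (mdist O x).
  move=> nE; set t := mdist O x.
  have -> : K * A * tau t = K * A / (1 - q t).
    by rewrite /q opprB addrCA subrr addr0 invrK.
  apply: (HK u rho' x (q t) A) => // k.
  set B := ball x _; have r0 : 0 < lam * 2^-1 ^+ k :> R.
    by rewrite mulr_gt0// exprn_gt0// invr_gt0.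
  have mB : measurable (B : set C) by exact: ball_caratheodory.
  have eB : (mu_integral mu B G <= ((q t ^+ k) `^ Q)%:E)%E.
    by rewrite leNgt; apply/negP => h; apply: nE; exists k.
  have -> : mu_integral mu B (fun y => rho' y `^ Q)%E = (mu B + mu_integral mu B G)%E.
    rewrite /mu_integral (@eq_integral _ C R m _ (fun y => 1 + G y)%E); last first.
      by move=> y _; rewrite rhoQ.
    rewrite (@ge0_integralD _ C R m B mB (cst 1%E) G)//; last exact: measurable_funTS.
    by rewrite integral_cst// mul1e.
  rewrite (mu_ballE mu_regular); apply: le_trans (leeD (lexx _) eB) _.
  rewrite -EFinD lee_fin.
  have qk0 : 0 <= q t ^+ k by rewrite exprn_ge0// ltW.
  rewrite powRM// /A -powRrM mulVf ?gt_eqF// powRr1; last first.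
    by rewrite addr_ge0// mulr_ge0 ?powR_ge0// ltW.
  rewrite mulrDl mul1r lerD2r; have /andP[_ +] := HA x _ r0; move/le_trans; apply.
  rewrite powRM ?(ltW lam0)// ?exprn_ge0 ?invr_ge0// mulrA.
  rewrite ler_wpM2l ?mulr_ge0 ?powR_ge0 ?(ltW CA0)//.
  rewrite ge0_ler_powR ?nnegrE ?(ltW Q0) ?qk0 ?exprn_ge0 ?invr_ge0//.
  by rewrite lerXn2r ?nnegrE ?invr_ge0 ?(ltW (q0 _)).
apply/cvgr0Pnorm_le => e e0; have e20 : 0 < e / 2 by rewrite divr_gt0.
have [M HM] := mean_norm_growth Q_gt1 mu_breg X_complete mu_regular mu_poincare O Nu e20.
(* With h = l^(p/2), [M1] ensures 4 K A <= e h and [M2] ensures 2 <= h, so tau <= 2 h and K A tau <=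
   (e/2) h^2 = (e/2) l^p. *)
have [M1 M11 HM1] := powR_unbounded (K * A * 4) e0 p20.
have [M2 M21 HM2] := powR_unbounded 2 ltr01 p20.
rewrite /within/=; exists (Num.max M (Num.max (expR M1) (expR M2))) => x.
rewrite !gt_max => /and3P[Mx M1x M2x] nE.
have t0 : 0 < mdist O x by exact: lt_trans (expR_gt0 _) M1x.
set l := ln (mdist O x).
have l1 : M1 < l by rewrite -(expRK M1) ltr_ln ?posrE ?expR_gt0.
have l2 : M2 < l by rewrite -(expRK M2) ltr_ln ?posrE ?expR_gt0.
have l0 : 0 < l `^ p by apply: powR_gt0; rewrite (lt_trans _ l1)// (lt_trans ltr01).
rewrite normr_id normrM normfV (gtr0_norm l0) ler_pdivrMr//.
apply: le_trans (bound x nE) _; rewrite [e in leRHS]splitr mulrDl.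
apply: lerD; first exact: HM.
have := HM1 _ l1; have := HM2 _ l2; rewrite mul1r /tau -/l => h2 h4.
have -> : l `^ p = l `^ (p / 2) * l `^ (p / 2).
  rewrite -powRD -?splitr//; apply/implyP => _.
  by rewrite gt_eqF// (lt_trans _ l1)// (lt_trans ltr01).
set h := l `^ (p / 2) in h2 h4 *; have h0 : 0 <= h by exact: powR_ge0.
have KA0 : 0 <= K * A by rewrite mulr_ge0.
apply: (@le_trans _ _ (K * A * (2 * h))); first by rewrite ler_wpM2l//; lra.
have -> : K * A * (2 * h) = K * A * 4 * (h / 2) by field.
have -> : e / 2 * (h * h) = e * h * (h / 2) by field.
by rewrite ler_wpM2r// divr_ge0.
Qed.

End NormLimit.

Theorem theorem1p5 (R : realType) (X : pmetricType R)
    (mu : {outer_measure set X -> \bar R}) (O : X) (Q : R)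
    (Q_gt1 : 1 < Q)
    (mms : metric_measure_space mu)
    (X_complete : complete_space X)
    (X_unbounded : unbounded_space X)
    (mu_regular : ahlfors_regular mu Q)
    (mu_poincare : poincare_inequality mu Q) :
  (forall u : X -> R, dotN1 mu Q u ->
    exists E : set X, thin_set O Q E /\
      `|u x / ln (mdist O x) `^ ((Q - 1) / Q)|
        @[x --> within (~` E) (at_infinity O)] --> (0 : R)) /\
  (forall u : X -> R, dotN1 mu Q u ->
    `|ball_mean mu u x 1 / ln (mdist O x) `^ ((Q - 1) / Q)|
      @[x --> at_infinity O] --> (0 : R)).
Proof.
have [_ _ _ mu_breg] := mms; split=> u Nu.
  exact: (norm_limit Q_gt1 mu_breg X_complete mu_regular mu_poincare O Nu).
exact: (mean_norm_limit Q_gt1 mu_breg X_complete mu_regular mu_poincare O Nu).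
Qed.
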